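(* Let $0<\alpha\le 1$ and let $\delta,\epsilon,p,q$ be real numbers with $\epsilon\neq 0$ and $p^2+4\epsilon(\delta+q)\ge 0$. Consider the fractional order delay differential equation $$D^\alpha x(t)=\delta x(t-\tau)-\epsilon (x(t-\tau))^3-p(x(t))^2+qx(t)$$ and its equilibrium point $x_2^*=\dfrac{-p+\sqrt{p^2+4\epsilon(\delta+q)}}{2\epsilon}$. If $\epsilon>0$, $p>0$ and $q+\delta<0$, then $x_2^*$ is unstable for all $\tau\ge 0$.
   Context: $D^\alpha$ denotes the Caputo fractional derivative: $D^1x=x'$, and for $0<\alpha<1$, $D^\alpha x(t)=\frac{1}{\Gamma(1-\alpha)}\int_0^t (t-s)^{-\alpha}x'(s)\,ds$. Initial data: $x(t)=\phi(t)$ for $-\tau\le t\le 0$, where $\phi:[-\tau,0]\to\mathbb{R}$; the corresponding solution is denoted $x(t,\phi)$, and $\|\phi\|=\sup_{-\tau\le t\le 0}|\phi(t)|$. (For $\tau=0$ the initial datum is just $x(0)$.) An equilibrium point is a steady state (constant) solution. An equilibrium point $x^*$ is stable if for every $\eta>0$ there is $\rho>0$ such that $\|\phi-x^*\|<\rho$ implies $|x(t,\phi)-x^*|<\eta$ for all $t\ge 0$. It is asymptotically stable if it is stable and there is $b_0>0$ such that $\|\phi-x^*\|<b_0$ implies $\lim_{t\to\infty}x(t,\phi)=x^*$. It is unstable if it is not stable. *)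

(* Defs.v *)
From HB Require Import structures.
From mathcomp Require Import all_boot all_order all_algebra.
From mathcomp Require Import all_classical all_reals all_analysis.
Set Implicit Arguments.
Unset Strict Implicit.
Unset Printing Implicit Defensive.
Import Order.TTheory GRing.Theory Num.Theory.
Import numFieldNormedType.Exports.
Local Open Scope classical_set_scope.
Local Open Scope ring_scope.

Definition Gamma (R : realType) (z : R) : R :=
  \int[lebesgue_measure]_(s in `]0, +oo[) (s `^ (z - 1) * expR (- s)).

Definition caputo_integrand (R : realType) (alpha : R) (x : R -> R) (t : R) :
  R -> R := fun s => (t - s) `^ (- alpha) * derive1 x s.

Definition caputo (R : realType) (alpha : R) (x : R -> R) (t : R) : R :=
  if alpha == 1 then derive1 x t
  else (Gamma (1 - alpha))^-1 *
       \int[lebesgue_measure]_(s in `]0, t[) caputo_integrand alpha x t s.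

(* [derive1] and the integral are total, so the existence of the Caputo
   derivative at [t] has to be required separately. *)
Definition caputo_derivable (R : realType) (alpha : R) (x : R -> R) (t : R) :
  Prop :=
  if alpha == 1 then derivable x t 1
  else lebesgue_measure.-integrable `]0, t[
         (fun s => (caputo_integrand alpha x t s)%:E).

(* Local absolute continuity on [0, T[, as the fundamental theorem of calculus
   for the Lebesgue integral.  Solutions of order alpha < 1 need not be
   differentiable at the multiples of the delay; almost everywhere
   differentiability alone would admit spurious solutions (Cantor functions). *)
Definition locally_ac (R : realType) (T : R) (x : R -> R) : Prop :=
  forall t : R, 0 < t < T ->
    lebesgue_measure.-integrable `]0, t[ (fun s => (derive1 x s)%:E) /\
    x t = x 0 + \int[lebesgue_measure]_(s in `]0, t[) derive1 x s.

(* [x] solves D^alpha x(t) = F (x(t - tau)) (x(t)) for 0 < t < T with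
   x = phi on [-tau, 0]; values of [phi] off [-tau, 0] and of [x] off
   [-tau, T[ are irrelevant. *)
Definition is_solution (R : realType) (alpha tau : R) (F : R -> R -> R)
    (phi : R -> R) (T : R) (x : R -> R) : Prop :=
  [/\ forall t : R, - tau <= t <= 0 -> x t = phi t,
      locally_ac T x
    & forall t : R, 0 < t < T ->
        caputo_derivable alpha x t /\ caputo alpha x t = F (x (t - tau)) (x t)].

Definition init_norm (R : realType) (tau : R) (phi : R -> R) : \bar R :=
  ereal_sup [set (`|phi t|)%:E | t in `[- tau, 0]].

Definition is_equilibrium (R : realType) (alpha tau : R) (F : R -> R -> R)
    (xs : R) : Prop :=
  forall T : R, 0 < T ->
    is_solution alpha tau F (fun=> xs) T (fun=> xs).

(* Ranging over solutions on every [0, T[, rather than on [0, +oo[ only, makes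
   a solution that blows up in finite time count against stability. *)
Definition stable (R : realType) (alpha tau : R) (F : R -> R -> R)
    (xs : R) : Prop :=
  forall eta : R, 0 < eta -> exists2 rho : R, 0 < rho &
    forall phi : R -> R,
      (init_norm tau (fun t => (phi t - xs)%R) < rho%:E)%E ->
      forall (T : R) (x : R -> R), 0 < T -> is_solution alpha tau F phi T x ->
        forall t : R, 0 <= t < T -> `|x t - xs| < eta.

Definition unstable (R : realType) (alpha tau : R) (F : R -> R -> R)
    (xs : R) : Prop :=
  ~ stable alpha tau F xs.

(* First argument: the delayed state x(t - tau); second: the state x(t). *)
Definition dde_rhs (R : realType) (delta epsilon p q : R) (xtau x : R) : R :=
  delta * xtau - epsilon * xtau ^+ 3 - p * x ^+ 2 + q * x.

Definition x2star (R : realType) (delta epsilon p q : R) : R :=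
  (- p + Num.sqrt (p ^+ 2 + 4 * epsilon * (delta + q))) / (2 * epsilon).

(* Main.v *)
Require Import Defs.
From mathcomp Require Import all_boot all_order all_algebra.
From mathcomp Require Import all_classical all_reals all_analysis.
From mathcomp Require Import measurable_realfun ring lra.

(** Write x* for the equilibrium and s for the square root of the discriminant.
    In the coordinate y = x - x* the equation is
      D^alpha y (t) = P (y (t - tau)) + Q (y t),
      P u = b u + c u^2 - eps u^3,  Q v = a v - p v^2,
    where x* < 0 < c, s = 2 eps x* + p >= 0 and a + b = - x* s >= 0. The sum
    P v + Q v = - (x* + v) v (eps v + s) is positive for small positive v: the
    dynamics of constants pushes away from 0, strictly in the linear terms when
    s > 0 and through the quadratic ones when s = 0.

    Solutions. Inverting the Caputo derivative gives the integral equation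
    y = phi + kappa I^alpha (P (y (t - tau)) + Q y). It is solved globally, for
    truncated P and Q, by Picard iteration on the velocity y'
    ([delay_equation_solution]), which provides the absolute continuity that a
    Caputo solution needs; Abel's inversion ([solution_caputo]) leads back to
    the derivative. If x* were stable, solutions with small data would never
    reach the region where the truncation acts ([stable_confines]), so each of
    them would be a bounded global solution of the original equation. A
    contradiction is found in each of four cases.

    Without delay, P + Q >= k v^2 on the right of 0, so a positive solution grows
    at least like t^alpha ([unstable_without_delay]).

    With a delay the Laplace transform replaces comparison arguments: the delay
    becomes the factor exp (- l tau) plus the contribution H of the history
    ([mild_laplace]). If b = 0, a positive pulse in the history gives a
    nonnegative solution with l^alpha Y > K (a / 2) Y, which is absurd for small
    l ([unstable_undelayed_linear_part]).

    If s = 0 then a = - b and c = 3 p / 2. The linear terms cancel at frequency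
    0, and since c > p the quadratic ones do not: they contribute at least a
    multiple of X^2, where X = l Y is the Abel mean of y
    ([abel_mean_inequality]). The inequality
      y(0) + C l^(- alpha) (X^2 - O(l) |X| + l H) <= X
    has no bounded solution as l tends to 0: for alpha < 1 when y(0) > 0, and for
    alpha = 1 when y(0) = 0 and H > 0.

    If s > 0 and b <> 0, the characteristic equation
    l^alpha = K (a + b exp (- l tau)) has a positive root, so linear solutions
    cannot all grow slower than exp (l t) ([growth_ge_root]). Memory makes the
    equation not autonomous when alpha < 1, so there is no linear flow to restart;
    its role is played by the infimum of the exponential rates that bound all
    linear solutions, which yields a rate om that some linear solution w exceeds
    while all of them stay below 2 om ([growth_threshold]). By superposition of
    shifted linear solutions, a forcing of size exp (2 om t) has a response of the
    same size ([forced_growth]). Scale w so that it reaches a fixed small size at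
    a time T where |w(t)| exp (- om t) is maximal. Up to T the nonlinear terms are
    bounded by the square of this envelope, so the nonlinear solution with the
    same history stays within half of the envelope from w and is not small at T
    ([unstable_saddle]). *)

Set Implicit Arguments.
Unset Strict Implicit.
Unset Printing Implicit Defensive.
Import Order.TTheory GRing.Theory Num.Theory.
Import numFieldNormedType.Exports.
Local Open Scope classical_set_scope.
Local Open Scope ring_scope.

(** * Integrals over the real line *)
Section WholeLineIntegral.
Context {R : realType}.
Implicit Types (f g : R -> R).

Definition L1 f := (@lebesgue_measure R).-integrable setT (EFin \o f).
Definition Int f : R := \int[@lebesgue_measure R]_x f x.

Lemma L1_measurable f : L1 f -> measurable_fun setT f.
Proof. by move/integrableP => [/measurable_EFinP]. Qed.

Lemma L1D f g : L1 f -> L1 g -> L1 (fun x => f x + g x).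
Proof. by move=> lf lg; have := integrableD measurableT lf lg. Qed.

Lemma L1Z k f : L1 f -> L1 (fun x => k * f x).
Proof. by move=> lf; have := integrableZl measurableT k lf. Qed.

Lemma L1_le f g : measurable_fun setT f -> L1 g ->
  (forall x, `|f x| <= g x) -> L1 f.
Proof.
move=> mf lg fg; apply: (le_integrable measurableT _ _ lg) => /=.
  exact/measurable_EFinP.
move=> x _; rewrite lee_fin; exact: le_trans (fg x) (ler_norm _).
Qed.

Lemma L1_norm f : L1 f -> L1 (fun x => `|f x|).
Proof.
move=> lf; apply: (le_integrable measurableT _ _ lf) => /=.
  apply/measurable_EFinP; apply: measurableT_comp => //; exact: L1_measurable.
by move=> x _; rewrite normr_id.
Qed.

Lemma Int_ext f g : f =1 g -> Int f = Int g.
Proof. by move=> fg; congr Int; apply/funext. Qed.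

Lemma L1_ext f g : f =1 g -> L1 f -> L1 g.
Proof. by move=> /funext ->. Qed.

Lemma L10 : L1 (fun=> 0).
Proof. exact: integrable0. Qed.

Lemma Int0 : Int (fun=> 0) = 0.
Proof. by rewrite /Int /Rintegral integral0. Qed.

Lemma IntD f g : L1 f -> L1 g -> Int (fun x => f x + g x) = Int f + Int g.
Proof. by move=> lf lg; apply: RintegralD. Qed.

Lemma IntB f g : L1 f -> L1 g -> Int (fun x => f x - g x) = Int f - Int g.
Proof. by move=> lf lg; apply: RintegralB. Qed.

Lemma IntZ k f : L1 f -> Int (fun x => k * f x) = k * Int f.
Proof. by move=> lf; apply: RintegralZl. Qed.

Lemma Int_le f g : L1 f -> L1 g -> (forall x, f x <= g x) -> Int f <= Int g.
Proof. by move=> lf lg fg; apply: le_Rintegral. Qed.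

Lemma Int_ge0 f : (forall x, 0 <= f x) -> 0 <= Int f.
Proof. by move=> f0; apply: Rintegral_ge0. Qed.

Lemma Int_norm f : L1 f -> `|Int f| <= Int (fun x => `|f x|).
Proof. by move=> lf; apply: le_normr_Rintegral. Qed.

Lemma Int_norm_le f g : L1 f -> L1 g -> (forall x, `|f x| <= g x) ->
  `|Int f| <= Int g.
Proof.
move=> lf lg fg; apply: le_trans (Int_norm lf) _.
by apply: Int_le => //; exact: L1_norm.
Qed.

Lemma EFin_Int f : L1 f -> (\int[@lebesgue_measure R]_x (f x)%:E)%E = (Int f)%:E.
Proof. by move=> lf; rewrite /Int /Rintegral fineK//; exact: integrable_fin_num. Qed.

Lemma Int_gt0 f a b c : L1 f -> a < b -> 0 < c -> (forall x, 0 <= f x) ->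
  (forall x, a < x < b -> c <= f x) -> 0 < Int f.
Proof.
move=> lf ab c0 f0 fc.
pose g := fun x : R => c * \1_(`]a, b[%classic : set R) x.
have lg : L1 g.
  by apply: L1Z; exact: integrable_indic_itv.
have gE : Int g = c * (b - a).
  rewrite /g IntZ; last exact: integrable_indic_itv.
  rewrite /Int /Rintegral integral_indic// setIT.
  have := @lebesgue_measure_itv R `]a, b[; rewrite /= lte_fin ab => E.
  by congr (_ * _); transitivity (fine (b%:E - a%:E)); [congr fine; exact: E|].
apply: (@lt_le_trans _ _ (Int g)).
  by rewrite gE mulr_gt0// subr_gt0.
apply: Int_le => // x; rewrite /g indicE.
case: (boolP (x \in _)) => [|_]; last by rewrite mulr0.
by rewrite inE/= in_itv/= mulr1 => /fc.
Qed.

Lemma integrable_affine_ge0 (c d : R) (f : R -> \bar R) : 0 < c ->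
  measurable_fun setT f -> (forall x, 0 <= f x)%E ->
  (\int[@lebesgue_measure R]_x f x =
   c%:E * \int[@lebesgue_measure R]_x f (c * x + d)%R)%E.
Proof.
move=> c0 mf f0.
pose phi : measurableTypeR R -> measurableTypeR R := fun x => c * x + d.
have mphi : measurable_fun setT phi.
  by apply: measurable_funD => //; exact: measurable_funM.
pose k := NngNum (ltW c0).
have -> : (\int[@lebesgue_measure R]_x f (c * x + d)%R =
  \int[@lebesgue_measure R]_(x in phi @^-1` setT) (f \o phi) x)%E.
  by rewrite preimage_setT.
rewrite -(ge0_integral_pushforward mphi)//=.
rewrite -[X in (X * _)%E]/(k%:num%:E) -ge0_integral_mscale//=.
apply: eq_measure_integral => /= A mA _; apply: lebesgue_measure_unique => //.
move=> _ [[a b]] _ <- /=.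
rewrite /mscale/= /pushforward/=.
have -> : phi @^-1` `]a, b]%classic = `](a - d) / c, (b - d) / c]%classic.
  apply/seteqP; split => x /=; rewrite !in_itv/= ltr_pdivrMr// ler_pdivlMr//;
  by rewrite ltrBlDr lerBrDr (mulrC x).
rewrite !lebesgue_measure_itv/= !lte_fin ltr_pM2r ?invr_gt0// ltrD2r.
case: ifPn => ab; last by rewrite mule0.
by rewrite -!EFinB -EFinM; congr EFin; field; exact: lt0r_neq0.
Qed.

Lemma integral_reflect_ge0 (f : R -> \bar R) :
  measurable_fun setT f -> (forall x, 0 <= f x)%E ->
  (\int[@lebesgue_measure R]_x f x = \int[@lebesgue_measure R]_x f (- x)%R)%E.
Proof.
move=> mf f0.
pose phi : measurableTypeR R -> measurableTypeR R := -%R.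
have mphi : measurable_fun setT phi by exact: oppr_measurable.
have -> : (\int[@lebesgue_measure R]_x f (- x)%R =
  \int[@lebesgue_measure R]_(x in phi @^-1` setT) (f \o phi) x)%E.
  by rewrite preimage_setT.
rewrite -(ge0_integral_pushforward mphi)//=.
by apply: eq_measure_integral => /= A mA _; exact/esym/lebesgue_measureN.
Qed.

(** Affine maps and reflections are all treated at once: splitting into positive
    and negative parts, and taking absolute values for integrability, reduces
    everything to nonnegative functions. *)
Lemma change_of_variable (phi : R -> R) (k : R) :
  measurable_fun setT phi -> 0 < k ->
  (forall f : R -> \bar R, measurable_fun setT f -> (forall x, 0 <= f x)%E ->
    (\int[@lebesgue_measure R]_x f x =
     k%:E * \int[@lebesgue_measure R]_x f (phi x))%E) ->
  forall f, L1 f -> L1 (fun x => f (phi x)) /\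
    Int f = k * Int (fun x => f (phi x)).
Proof.
move=> mphi k0 H f lf.
have mf := L1_measurable lf.
have mEf : measurable_fun setT (EFin \o f) by exact/measurable_EFinP.
have lfp : L1 (fun x => f (phi x)).
  apply/integrableP; split.
    by apply/measurable_EFinP; exact: measurableT_comp mf mphi.
  have /integrableP[_] := lf.
  rewrite (H (fun x => `|(EFin \o f) x|%E))//=; last first.
    by apply/measurable_EFinP; exact: measurableT_comp.
  by case: integral => [r||]//=; rewrite ?ltry// gt0_muley.
split=> //; apply: EFin_inj.
rewrite EFinM -!EFin_Int//.
have E1 := integralE (@lebesgue_measure R) setT (EFin \o f).
have E2 := integralE (@lebesgue_measure R) setT (EFin \o (fun x => f (phi x))).
rewrite [LHS]E1 [X in (_ * X)%E]E2.
rewrite (H (EFin \o f)^\+%E)//; last exact: measurable_funepos.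
rewrite (H (EFin \o f)^\-%E)//; last exact: measurable_funeneg.
rewrite [RHS]muleBr//; last first.
  by rewrite fin_num_adde_defl// fin_numN; exact: integrable_neg_fin_num lfp.
by congr (_ * _ - _ * _)%E; apply: eq_integral => x _;
  rewrite ?funeposE ?funenegE.
Qed.

Lemma L1_affine (c d : R) f : 0 < c -> L1 f -> L1 (fun x => f (c * x + d)).
Proof.
move=> c0 lf; apply: (change_of_variable _ c0 _ lf).1.
  by apply: measurable_funD => //; exact: measurable_funM.
by move=> g mg g0; exact: integrable_affine_ge0.
Qed.

Lemma Int_affine (c d : R) f : 0 < c -> L1 f ->
  Int f = c * Int (fun x => f (c * x + d)).
Proof.
move=> c0 lf; apply: (change_of_variable _ c0 _ lf).2.
  by apply: measurable_funD => //; exact: measurable_funM.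
by move=> g mg g0; exact: integrable_affine_ge0.
Qed.

Lemma L1_shift (d : R) f : L1 f -> L1 (fun x => f (x - d)).
Proof. by move=> /(L1_affine (- d) ltr01); apply: L1_ext => x; rewrite mul1r. Qed.

Lemma Int_shift (d : R) f : L1 f -> Int (fun x => f (x - d)) = Int f.
Proof.
move=> lf; rewrite (Int_affine (- d) ltr01 lf) mul1r.
by apply: Int_ext => x; rewrite mul1r.
Qed.

Lemma L1_reflect (d : R) f : L1 f -> L1 (fun x => f (d - x)).
Proof.
move=> lf; have {}lf : L1 (fun x => f (- x)).
  apply: (change_of_variable _ ltr01 _ lf).1; first exact: oppr_measurable.
  by move=> g mg g0; rewrite mul1e; exact: integral_reflect_ge0.
by apply: L1_ext (L1_shift d lf) => x; rewrite opprB.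
Qed.

Lemma Int_reflect (d : R) f : L1 f -> Int (fun x => f (d - x)) = Int f.
Proof.
move=> lf; have mN : measurable_fun setT (-%R : R -> R) by exact: oppr_measurable.
have [lf' E] : L1 (fun x => f (- x)) /\ Int f = 1 * Int (fun x => f (- x)).
  apply: (change_of_variable mN ltr01) => // g mg g0.
  by rewrite mul1e; exact: integral_reflect_ge0.
rewrite E mul1r -(Int_shift d lf'); apply: Int_ext => x.
by rewrite opprB.
Qed.

(** Integrability on the plane is checked through a single iterated integral of
    the absolute value, by Tonelli. *)
Section Fubini.
Variables F : R -> R -> R.
Hypothesis mF : measurable_fun setT (fun z : R * R => F z.1 z.2).
Hypothesis F1 : forall t, L1 (F t).
Hypothesis F2 : forall s, L1 (F ^~ s).
Hypothesis FF : L1 (fun s => Int (fun t => `|F t s|)).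

Let mu := @lebesgue_measure R.

Let integrable_F : (mu \x mu)%E.-integrable setT (fun z : R * R => (F z.1 z.2)%:E).
Proof.
apply/integrable21ltyP; first exact/measurable_EFinP.
have /integrableP[_] := FF; apply: le_lt_trans.
apply: ge0_le_integral => //=.
- by move=> s _; exact: integral_ge0.
- apply: (@measurable_fun_fubini_tonelli_G _ _ _ _ _ mu
    (fun z : R * R => `|F z.1 z.2|%:E)) => //.
  by apply/measurable_EFinP; apply: measurableT_comp.
- apply/measurable_EFinP; apply: measurableT_comp => //.
  exact: L1_measurable.
- move=> s _; rewrite EFin_Int; last exact: L1_norm.
  by rewrite lee_fin ler_norm.
Qed.

Lemma Fubini_L1 : L1 (fun t => Int (F t)).
Proof.
have := integrable_fubini_F integrable_F.
rewrite /fubini_F /=; congr (integrable _ _ _).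
by apply/funext => t /=; rewrite -EFin_Int//.
Qed.

Lemma Fubini_Int : Int (fun t => Int (F t)) = Int (fun s => Int (F ^~ s)).
Proof.
have /= := Fubini integrable_F.
rewrite /Int /Rintegral => E; congr fine.
transitivity (\int[mu]_x \int[mu]_y (F x y)%:E)%E.
  by apply: eq_integral => t _; rewrite -EFin_Int.
by rewrite E; apply: eq_integral => s _; rewrite EFin_Int//; exact: F2.
Qed.
End Fubini.
End WholeLineIntegral.

(** * The power kernel *)
Section PowerKernel.
Context {R : realType}.
Implicit Types (p q t s : R) (f g : R -> R).

(** Kernels and integrands are extended by 0 to the whole line, so that
    convolutions over [0, t] are integrals over the line and inherit its
    translation invariance. *)
Definition ker p t : R := if 0 < t then t `^ (p - 1) else 0.
Definition pos g t : R := if 0 < t then g t else 0.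

Lemma kerE p t : 0 < t -> ker p t = t `^ (p - 1).
Proof. by rewrite /ker => ->. Qed.

Lemma ker_le0 p t : t <= 0 -> ker p t = 0.
Proof. by rewrite /ker ltNge => ->. Qed.

Lemma posE g t : 0 < t -> pos g t = g t.
Proof. by rewrite /pos => ->. Qed.

Lemma pos_le0 g t : t <= 0 -> pos g t = 0.
Proof. by rewrite /pos ltNge => ->. Qed.

Lemma ker_ge0 p t : 0 <= ker p t.
Proof. by rewrite /ker; case: ifP => // _; exact: powR_ge0. Qed.

Lemma ker_gt0 p t : 0 < t -> 0 < ker p t.
Proof. by move=> t0; rewrite kerE// powR_gt0. Qed.

Lemma ker1 t : 0 < t -> ker 1 t = 1.
Proof. by move=> t0; rewrite kerE// subrr powRr0. Qed.

Lemma ker_homo p c t : 0 < c -> ker p (c * t) = c `^ (p - 1) * ker p t.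
Proof.
move=> c0; rewrite /ker pmulr_rgt0//; case: ifPn => t0; last by rewrite mulr0.
by rewrite powRM ?ltW.
Qed.

Lemma ker_dec p s t : p <= 1 -> 0 < s -> s <= t -> ker p t <= ker p s.
Proof.
move=> p1 s0 st; have t0 := lt_le_trans s0 st.
rewrite !kerE// -opprB !powRN lef_pV2 ?posrE ?powR_gt0//.
by apply: ge0_ler_powR => //; rewrite ?nnegrE ?subr_ge0// ltW.
Qed.

Lemma measurable_pos g : measurable_fun setT g -> measurable_fun setT (pos g).
Proof.
move=> mg; apply: measurable_fun_ifT => //=.
by apply: measurable_fun_ltr.
Qed.

Lemma measurable_pos_cont g : (forall t, 0 < t -> {for t, continuous g}) ->
  measurable_fun setT (pos g).
Proof.
move=> cg; rewrite (_ : pos g = g \_ `]0, +oo[).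
  apply/(measurable_restrictT g) => //.
  apply: open_continuous_measurable_fun => //.
  by move=> x; rewrite inE/= in_itv/= andbT; exact: cg.
apply/funext => x; rewrite /pos patchE.
by rewrite mem_setE in_itv/= andbT.
Qed.

Lemma measurable_ker p : measurable_fun setT (ker p).
Proof. by apply: measurable_pos; exact: measurable_powR. Qed.

(** Cutting at 1 separates the two reasons why [t^(p-1) exp (-t)] is integrable:
    the power near 0, the exponential at infinity. *)
Definition kercut p t : R := if t <= 1 then ker p t else 0.

Lemma measurable_kercut p : measurable_fun setT (kercut p).
Proof.
apply: measurable_fun_ifT => //=; last exact: measurable_ker.
by apply: measurable_fun_ler.
Qed.

Lemma kercut_ge0 p t : 0 <= kercut p t.
Proof. by rewrite /kercut; case: ifP => // _; exact: ker_ge0. Qed.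

Lemma L1_kercut p : 0 < p -> L1 (kercut p).
Proof.
move=> p0.
pose F (n : nat) : set R := `[n.+1%:R^-1, 1]%classic.
have FE : \bigcup_i F i = `]0, 1]%classic.
  apply/seteqP; split => x /=.
    move=> [n _]; rewrite /F/= !in_itv/= => /andP[a ->]; rewrite andbT.
    by apply: lt_le_trans a; rewrite invr_gt0 ltr0n.
  rewrite in_itv/= => /andP[x0 x1].
  have [n nx] := ltr_add_invr (y := 0) (x := x) x0.
  exists n => //; rewrite /F/= in_itv/= x1 andbT.
  by move: nx; rewrite add0r => /ltW.
have key : (\int[@lebesgue_measure R]_(x in \bigcup_i F i) (x `^ (p - 1))%:E <= (p^-1)%:E)%E.
  have mpw i : measurable_fun (F i) (fun x : R => (x `^ (p - 1))%:E).
    apply/measurable_EFinP; apply: measurable_funTS; exact: measurable_powR.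
  have mF i : measurable (F i) by exact: measurable_itv.
  have ndF : nondecreasing_seq F.
    move=> m n mn; rewrite subsetEset => x; rewrite /F/= !in_itv/= => /andP[a ->].
    rewrite andbT; apply: le_trans a.
    by rewrite lef_pV2 ?posrE ?ltr0n// ler_nat.
  have f0 i x : F i x -> (0 <= (x `^ (p - 1))%:E)%E by rewrite lee_fin powR_ge0.
  have cv : (\int[@lebesgue_measure R]_(x in F i) (x `^ (p - 1))%:E)%E @[i --> \oo] -->
      (\int[@lebesgue_measure R]_(x in \bigcup_i F i) (x `^ (p - 1))%:E)%E.
    exact: ge0_nondecreasing_set_cvg_integral.
  rewrite -(cvg_lim _ cv)//.
  apply: lime_le.
    apply: ereal_nondecreasing_is_cvgn.
    exact: ge0_nondecreasing_set_nondecreasing_integral.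
  apply: nearW => -[|n].
    rewrite /F invr1 set_itv1 integral_set1 lee_fin invr_ge0; exact: ltW.
  have n1 : n.+2%:R^-1 < 1 :> R by rewrite invf_lt1 ?ltr0n// ltr1n.
  have n0 : 0 < n.+2%:R^-1 :> R by rewrite invr_gt0 ltr0n.
  have dF (x : R) : 0 < x ->
      is_derive x 1 (fun x : R => p^-1 * x `^ p) (x `^ (p - 1)).
    move=> x0; have h := is_derive1_powR p x0.
    have := is_deriveZ p^-1 h.
    by rewrite /GRing.scale/= mulrA mulVf ?mul1r// gt_eqF.
  rewrite /F (@continuous_FTC2 _ _ (fun x => p^-1 * x `^ p))//.
  - rewrite -EFinB lee_fin powR1 mulr1 lerBlDr lerDl.
    by rewrite mulr_ge0 ?invr_ge0 ?powR_ge0// ltW.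
  - apply: derivable_within_continuous => x; rewrite in_itv/= => /andP[a _].
    have x0 : 0 < x by exact: lt_le_trans a.
    by have := is_derive1_powR (p - 1) x0; case.
  - split.
    + move=> x; rewrite in_itv/= => /andP[a _].
      by have [] := dF _ (lt_trans n0 a).
    + apply: cvg_at_right_filter.
      have /derivable1_diffP/differentiable_continuous : derivable (fun x => p^-1 * x `^ p) n.+2%:R^-1 1.
        by have [] := dF _ n0.
      exact.
    + apply: cvg_at_left_filter.
      have /derivable1_diffP/differentiable_continuous : derivable (fun x => p^-1 * x `^ p) (1:R) 1.
        by have [] := dF _ ltr01.
      exact.
  - move=> x; rewrite in_itv/= => /andP[a _].
    by rewrite derive1E; have [_ ->] := dF _ (lt_trans n0 a).
apply/integrableP; split; first by apply/measurable_EFinP; exact: measurable_kercut.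
apply: (le_lt_trans _ (ltry p^-1)); apply: le_trans key.
rewrite FE [X in (_ <= X)%E]integral_mkcond le_eqVlt; apply/orP; left; apply/eqP.
apply: eq_integral => x _ /=; rewrite patchE mem_setE in_itv/= ger0_norm ?kercut_ge0//.
by rewrite /kercut /ker; case: (leP x 1) => x1; case: (ltP 0 x) => x0.
Qed.

Lemma ker_le_cut p t : p <= 1 -> 0 < t ->
  ker p t * expR (- t) <= kercut p t + exponential_pdf 1 t.
Proof.
move=> p1 t0; have -> : exponential_pdf 1 t = expR (- t).
  by rewrite exponential_pdfE ?ltW//= mul1r mulN1r.
rewrite /kercut; case: (leP t 1) => t1.
  apply: (@le_trans _ _ (ker p t)); last by rewrite lerDl expR_ge0.
  by rewrite ler_piMr ?ker_ge0// -expR0 ler_expR oppr_le0 ltW.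
rewrite add0r ler_piMl ?expR_ge0//.
apply: le_trans (ker_dec p1 ltr01 (ltW t1)) _.
by rewrite kerE// powR1.
Qed.

Lemma L1_ker_exp1 p : 0 < p -> p <= 1 -> L1 (fun t => ker p t * expR (- t)).
Proof.
move=> p0 p1.
apply: (@L1_le _ _ (fun t => kercut p t + exponential_pdf 1 t)).
- apply: measurable_funM; first exact: measurable_ker.
  by apply: measurableT_comp => //; exact: measurableT_comp.
- apply: L1D; first exact: L1_kercut.
  exact: integrable_exponential_pdf.
move=> t; rewrite ger0_norm ?mulr_ge0 ?ker_ge0 ?expR_ge0//.
have [t0|t0] := ltP 0 t; first exact: ker_le_cut.
rewrite ker_le0// mul0r addr_ge0 ?kercut_ge0//.
by apply: exponential_pdf_ge0; exact: ler01.
Qed.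

(** the value of the Gamma function at [p] *)
Definition gam p : R := Int (fun t => ker p t * expR (- t)).
Definition cut1 p : R := Int (kercut p).

Lemma gam_gt0 p : 0 < p -> p <= 1 -> 0 < gam p.
Proof.
move=> p0 p1.
apply: (@Int_gt0 _ _ 1 2 (ker p 2 * expR (-2))); first exact: L1_ker_exp1.
- by rewrite ltr1n.
- by rewrite mulr_gt0 ?ker_gt0 ?expR_gt0.
- by move=> x; rewrite mulr_ge0 ?ker_ge0 ?expR_ge0.
- move=> x /andP[x1 x2]; apply: ler_pM; rewrite ?ker_ge0 ?expR_ge0//.
    by apply: ker_dec => //; [exact: lt_trans x1|exact: ltW].
  by rewrite ler_expR lerN2 ltW.
Qed.

Lemma cut1_ge0 p : 0 <= cut1 p.
Proof. by apply: Int_ge0 => x; exact: kercut_ge0. Qed.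

Lemma ker_exp_scale p b : 0 < p -> p <= 1 -> 0 < b ->
  L1 (fun t => ker p t * expR (- (b * t))) /\
  Int (fun t => ker p t * expR (- (b * t))) = b `^ (- p) * gam p.
Proof.
move=> p0 p1 b0; have l1 := L1_ker_exp1 p0 p1.
have E t : b `^ (1 - p) * (ker p (b * t + 0) * expR (- (b * t + 0))) =
    ker p t * expR (- (b * t)).
  rewrite addr0 ker_homo// -opprB mulrA mulrA -powRD; last first.
    by rewrite (gt_eqF b0) implybT.
  by rewrite opprB subrKA subrr powRr0 mul1r.
have l2 := L1Z (b `^ (1 - p)) (L1_affine 0 b0 l1).
split; first exact: L1_ext E l2.
rewrite -(Int_ext E) IntZ; last exact: (L1_affine 0 b0 l1).
rewrite /gam (Int_affine 0 b0 l1) mulrA; congr (_ * _).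
by rewrite -[X in _ = _ * X]powRr1 ?ltW// -powRD ?(gt_eqF b0) ?implybT//; congr (_ `^ _); ring.
Qed.
End PowerKernel.

(** * Fractional integrals in weighted spaces *)
Section FractionalIntegral.
Context {R : realType}.
Implicit Types (p q c b t s : R) (f g h : R -> R).

(** the fractional integral of order [p], up to the factor [1 / Gamma p] *)
Definition conv p g t : R := Int (fun s => ker p (t - s) * pos g s).

(** Functions are measured against this weight: [ker c] records the singularity
    at the origin, the exponential turns fractional integration into a
    contraction when [b] is large. *)
Definition wt c b s : R := ker c s * expR (b * s).

(** a bound for the norm of [conv p] in the weight [wt c b]; what matters is the
    decaying power of [b] *)
Definition qc p c b : R := b `^ (- p) * (2 * gam p + 4 * cut1 c).

Lemma wt_ge0 c b s : 0 <= wt c b s.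
Proof. by rewrite mulr_ge0 ?ker_ge0 ?expR_ge0. Qed.

Lemma wt_gt0 c b s : 0 < s -> 0 < wt c b s.
Proof. by move=> s0; rewrite mulr_gt0 ?ker_gt0 ?expR_gt0. Qed.

Lemma qc_ge0 p c b : 0 < p -> p <= 1 -> 0 <= qc p c b.
Proof.
move=> p0 p1; rewrite mulr_ge0 ?powR_ge0// addr_ge0// mulr_ge0 ?cut1_ge0//.
exact/ltW/gam_gt0.
Qed.

Lemma measurable_conv_ker p t : measurable_fun setT (fun s => ker p (t - s)).
Proof.
by apply: measurableT_comp; [exact: measurable_ker|exact: measurable_funB].
Qed.

Definition kmaj p c b t s : R :=
  expR (b * t) * (2 * ker c t * (ker p (t - s) * expR (- (b * (t - s)))) +
   2 * ker p t * expR (- (b * t / 2)) * kercut c (s / t) * t `^ (c - 1)).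

Lemma ker_half c t s : 0 < c -> c <= 1 -> 0 < t -> t / 2 <= s -> ker c s <= 2 * ker c t.
Proof.
move=> c0 c1 t0 ts; apply: (@le_trans _ _ (ker c (t / 2))).
  by apply: ker_dec => //; rewrite divr_gt0.
rewrite mulrC ker_homo ?invr_gt0// ler_pM2r ?ker_gt0//.
rewrite -[X in X `^ _](invrK) invrK -powR_inv1// -powRrM mulN1r opprB.
apply: (@le_trans _ _ (2 `^ 1)); last by rewrite powRr1.
by apply: ler_powR; rewrite ?ler1n// lerBlDr lerDl ltW.
Qed.

(** Away from each of its two singularities the product kernel is controlled by
    its value there, so it is dominated by the sum of the two one-sided
    kernels; the exponential decay survives on both halves. *)
Lemma kmajP p c b t s : 0 < p -> p <= 1 -> 0 < c -> c <= 1 -> 0 < b -> 0 < t ->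
  ker p (t - s) * wt c b s <= kmaj p c b t s.
Proof.
move=> p0 p1 c0 c1 b0 t0.
have nn1 : 0 <= 2 * ker c t * (ker p (t - s) * expR (- (b * (t - s)))).
  by rewrite !mulr_ge0 ?ker_ge0 ?expR_ge0.
have nn2 : 0 <= 2 * ker p t * expR (- (b * t / 2)) * kercut c (s / t) * t `^ (c - 1).
  by rewrite !mulr_ge0 ?ker_ge0 ?expR_ge0 ?kercut_ge0 ?powR_ge0.
have nn : 0 <= kmaj p c b t s by rewrite mulr_ge0 ?expR_ge0 ?addr_ge0.
have [s0|s0] := ltP 0 s; last by rewrite /wt (ker_le0 _ s0) mul0r mulr0.
have [st|st] := ltP s t; last by rewrite ker_le0 ?mul0r// subr_le0.
have E : expR (b * s) = expR (b * t) * expR (- (b * (t - s))).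
  by rewrite -expRD; congr expR; ring.
rewrite /wt E /kmaj.
rewrite (_ : _ * _ = expR (b * t) * (ker p (t - s) * ker c s * expR (- (b * (t - s))))); last by ring.
rewrite ler_pM2l ?expR_gt0//.
have [ts|ts] := leP (t / 2) s.
  apply: le_trans (_ : 2 * ker c t * (ker p (t - s) * expR (- (b * (t - s)))) <= _); last by rewrite lerDl.
  rewrite [X in _ <= X]mulrA ler_pM2r ?expR_gt0// mulrC ler_wpM2r ?ker_ge0//.
  exact: ker_half.
apply: le_trans (_ : 2 * ker p t * expR (- (b * t / 2)) * kercut c (s / t) * t `^ (c - 1) <= _); last by rewrite lerDr.
rewrite /kercut ler_pdivrMr// mul1r (ltW st).
rewrite (_ : _ * ker c (s / t) * _ = 2 * ker p t * expR (- (b * t / 2)) * (t `^ (c - 1) * ker c (s / t))); last by ring.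
rewrite -ker_homo// (mulrC t) divfK ?gt_eqF//.
rewrite mulrAC ler_wpM2r ?ker_ge0//.
apply: ler_pM; rewrite ?ker_ge0 ?expR_ge0//.
  by apply: ker_half => //; lra.
by rewrite ler_expR lerN2 -mulrA ler_pM2l//; lra.
Qed.

Lemma kmaj_Int p c b t : 0 < p -> p <= 1 -> 0 < c -> c <= 1 -> 0 < b -> 0 < t ->
  L1 (kmaj p c b t) /\ Int (kmaj p c b t) <= qc p c b * wt c b t.
Proof.
move=> p0 p1 c0 c1 b0 t0.
have [l1 e1] := ker_exp_scale p0 p1 b0.
have l1' := L1_reflect t l1; have e1' := Int_reflect t l1.
have it0 : 0 < t^-1 by rewrite invr_gt0.
have l2 := L1_kercut c0.
have l2' := L1_affine 0 it0 l2; have e2' := Int_affine 0 it0 l2.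
set F1 := (fun s => _) in l1' e1'; set F2 := (fun s => _) in l2' e2'.
have kE : kmaj p c b t =1 fun s => expR (b * t) * ((2 * ker c t) * F1 s +
    (2 * ker p t * expR (- (b * t / 2)) * t `^ (c - 1)) * F2 s).
  move=> s; rewrite /kmaj /F1 /F2 addr0 (mulrC t^-1); ring.
have la := L1Z (2 * ker c t) l1'.
have lb := L1Z (2 * ker p t * expR (- (b * t / 2)) * t `^ (c - 1)) l2'.
split; first exact: L1_ext (fsym kE) (L1Z _ (L1D la lb)).
rewrite (Int_ext kE) IntZ; last exact: L1D.
rewrite IntD// !IntZ// e1' e1.
have {e2'} -> : Int F2 = t * cut1 c.
  by rewrite /cut1 e2' mulrA mulfV ?gt_eqF// mul1r.
rewrite /wt [X in _ <= X](_ : _ = expR (b * t) * (qc p c b * ker c t)); last by ring.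
rewrite ler_pM2l ?expR_gt0// /qc.
have -> : 2 * ker p t * expR (- (b * t / 2)) * t `^ (c - 1) * (t * cut1 c) =
   ker c t * (2 * cut1 c) * (t `^ p * expR (- (b * t / 2))).
  rewrite -(mulr_powRB1 (ltW t0) p0) (kerE _ t0) (kerE _ t0); ring.
have -> : b `^ (- p) * (2 * gam p + 4 * cut1 c) * ker c t =
  2 * ker c t * (b `^ (- p) * gam p) + ker c t * (2 * cut1 c) * (2 * b `^ (- p)) by ring.
rewrite lerD2l ler_wpM2l ?mulr_ge0 ?ker_ge0 ?cut1_ge0//.
have bp : 0 < b `^ p by rewrite powR_gt0.
rewrite powRN ler_pdivlMr// mulrAC -(powRM _ (ltW t0) (ltW b0)).
have x0 : 0 < t * b by rewrite mulr_gt0.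
rewrite expRN ler_pdivrMr ?expR_gt0//.
rewrite (mulrC b).
have xp : (t * b) `^ p <= 1 + t * b.
  have [x1|x1] := leP (t * b) 1.
    apply: (@le_trans _ _ 1); last by rewrite lerDl ltW.
    have := @ge0_ler_powR _ p (ltW p0) (t * b) 1.
    by rewrite !nnegrE powR1; apply => //; exact: ltW.
  apply: (@le_trans _ _ (t * b)); last by rewrite lerDr.
  by rewrite -[X in _ <= X](powRr1 (ltW x0)); apply: ler_powR => //; exact: ltW.
apply: le_trans xp _.
have := expR_ge1Dx (t * b / 2); lra.
Qed.

Lemma conv_le0 p g t : t <= 0 -> conv p g t = 0.
Proof.
move=> t0; rewrite /conv -[RHS]Int0; apply: Int_ext => s.
have [s0|s0] := ltP 0 s; last by rewrite pos_le0// mulr0.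
by rewrite ker_le0 ?mul0r// subr_le0; exact/ltW/(le_lt_trans t0).
Qed.

Lemma pos_conv p g : pos (conv p g) =1 conv p g.
Proof. by move=> t; rewrite /pos; case: ltP => // t0; rewrite conv_le0. Qed.

Lemma conv_integrand_ext p g h t : (forall s, 0 < s -> s < t -> g s = h s) ->
  (fun s => ker p (t - s) * pos g s) =1 (fun s => ker p (t - s) * pos h s).
Proof.
move=> gh s; have [s0|s0] := ltP 0 s; last by rewrite !pos_le0.
have [st|st] := ltP s t; last by rewrite ker_le0 ?mul0r// subr_le0.
by rewrite !posE// gh.
Qed.

Lemma conv_ext p g h t : (forall s, 0 < s -> s < t -> g s = h s) ->
  conv p g t = conv p h t.
Proof. by move=> gh; apply: Int_ext; exact: conv_integrand_ext. Qed.

Lemma conv_eq0 p g t : (forall s, 0 < s -> s < t -> g s = 0) -> conv p g t = 0.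
Proof.
move=> g0; rewrite (@conv_ext p g (fun=> 0) t g0) /conv -[RHS]Int0.
by apply: Int_ext => r; rewrite /pos if_same mulr0.
Qed.

Section Bound.
Variables (p c b C t : R) (g : R -> R).
Hypotheses (p0 : 0 < p) (p1 : p <= 1) (c0 : 0 < c) (c1 : c <= 1) (b0 : 0 < b).
Hypothesis mg : measurable_fun setT (pos g).
Hypothesis gC : forall s, 0 < s -> s < t -> `|g s| <= C * wt c b s.

Let C_ge0 : 0 < t -> 0 <= C.
Proof.
move=> t0; have t2 : 0 < t / 2 by rewrite divr_gt0.
have := gC t2; rewrite -(pmulr_lge0 _ (wt_gt0 c b t2)) => /(_ _)/(le_trans _); apply=> //.
by rewrite ltr_pdivrMr// ltr_pMr// ltr1n.
Qed.

Let dom : 0 < t -> forall s, `|ker p (t - s) * pos g s| <= C * kmaj p c b t s.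
Proof.
move=> t0 s; rewrite normrM (ger0_norm (ker_ge0 _ _)).
apply: (@le_trans _ _ (C * (ker p (t - s) * wt c b s))); last first.
  by rewrite ler_wpM2l ?C_ge0//; exact: kmajP.
have [s0|s0] := ltP 0 s; last first.
  by rewrite pos_le0// normr0 mulr0 /wt (ker_le0 _ s0) mul0r !mulr0.
have [st|st] := ltP s t; last by rewrite ker_le0 ?mul0r ?mulr0// subr_le0.
by rewrite mulrCA ler_wpM2l ?ker_ge0// posE//; exact: gC.
Qed.

Lemma L1_conv : L1 (fun s => ker p (t - s) * pos g s).
Proof.
have [t0|t0] := ltP 0 t; last first.
  apply: L1_ext L10 => s /=.
  have [s0|s0] := ltP 0 s; last by rewrite pos_le0// mulr0.
  by rewrite ker_le0 ?mul0r// subr_le0; exact/ltW/(le_lt_trans t0).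
apply: (L1_le _ (L1Z C (kmaj_Int p0 p1 c0 c1 b0 t0).1) (dom t0)).
by apply: measurable_funM => //; exact: measurable_conv_ker.
Qed.

Lemma conv_bound : 0 < t -> `|conv p g t| <= C * qc p c b * wt c b t.
Proof.
move=> t0; have [l le] := kmaj_Int p0 p1 c0 c1 b0 t0.
apply: (le_trans (Int_norm_le L1_conv (L1Z C l) (dom t0))).
by rewrite IntZ// -mulrA ler_wpM2l ?C_ge0.
Qed.
End Bound.

Lemma conv_norm_le p g h t :
  L1 (fun s => ker p (t - s) * pos g s) -> L1 (fun s => ker p (t - s) * pos h s) ->
  (forall s, 0 < s -> s < t -> `|g s| <= h s) -> `|conv p g t| <= conv p h t.
Proof.
move=> lg lh gh; apply: Int_norm_le => // s.
rewrite normrM (ger0_norm (ker_ge0 _ _)).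
have [s0|s0] := ltP 0 s; last by rewrite !pos_le0// normr0 mulr0.
have [st|st] := ltP s t; last by rewrite ker_le0 ?mul0r// subr_le0.
by rewrite ler_wpM2l ?ker_ge0// !posE//; exact: gh.
Qed.

Lemma conv_ge0 p g t : (forall s, 0 < s -> s < t -> 0 <= g s) -> 0 <= conv p g t.
Proof.
move=> g0; apply: Int_ge0 => s.
have [s0|s0] := ltP 0 s; last by rewrite pos_le0// mulr0.
have [st|st] := ltP s t; last by rewrite ker_le0 ?mul0r// subr_le0.
by rewrite mulr_ge0 ?ker_ge0// posE// g0.
Qed.

Lemma convD p g h t :
  L1 (fun s => ker p (t - s) * pos g s) -> L1 (fun s => ker p (t - s) * pos h s) ->
  conv p (fun s => g s + h s) t = conv p g t + conv p h t.
Proof.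
move=> lg lh; rewrite /conv -IntD//; apply: Int_ext => s.
by rewrite /pos; case: ifP => _; rewrite -mulrDr ?addr0.
Qed.

Lemma convB p g h t :
  L1 (fun s => ker p (t - s) * pos g s) -> L1 (fun s => ker p (t - s) * pos h s) ->
  conv p (fun s => g s - h s) t = conv p g t - conv p h t.
Proof.
move=> lg lh; rewrite /conv -IntB//; apply: Int_ext => s.
by rewrite /pos; case: ifP => _; rewrite -mulrBr ?subr0.
Qed.

Lemma convZ p k g t : L1 (fun s => ker p (t - s) * pos g s) ->
  conv p (fun s => k * g s) t = k * conv p g t.
Proof.
move=> lg; rewrite /conv -IntZ//; apply: Int_ext => s.
by rewrite /pos; case: ifP => _; rewrite mulrCA ?mulr0.
Qed.
End FractionalIntegral.

(** * Continuity of fractional integrals *)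
Section ConvolutionCalculus.
Context {R : realType}.
Implicit Types (p q c b t s : R) (f g h : R -> R).

Lemma near_eq_cont f g t : (\forall x \near t, f x = g x) ->
  {for t, continuous f} -> {for t, continuous g}.
Proof.
move=> fg cf; rewrite /prop_for /continuous_at -(nbhs_singleton fg).
by apply: cvg_trans cf; apply: near_eq_cvg.
Qed.

Lemma Int_continuous (F : R -> R -> R) (g : R -> R) (u v a : R) : u < a -> a < v ->
  (forall x, u < x -> x < v -> L1 (F x)) -> L1 g ->
  (forall y x, u < x -> x < v -> {for x, continuous (F ^~ y)}) ->
  (forall x y, u < x -> x < v -> `|F x y| <= g y) ->
  {for a, continuous (fun x => Int (F x))}.
Proof.
move=> ua av lF lg cF dF.
apply: (@continuity_under_integral R _ _ (@lebesgue_measure R) F setT measurableT u v _ _ g).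
- by move=> x; rewrite /= in_itv/= => /andP[ux xv]; exact: lF.
- apply/aeW => y _ x; rewrite inE/= in_itv/= => /andP[ux xv]; exact: cF.
- exact: lg.
- move=> x; rewrite /= in_itv/= => /andP[ux xv]; apply/aeW => y _; exact: dF.
- by rewrite inE/= in_itv/= ua av.
Qed.

(** In the variable [s / t] the domain of integration no longer moves with [t],
    which makes continuity a matter of dominated convergence. *)
Lemma conv_scale p g t : 0 < t -> L1 (fun s => ker p (t - s) * pos g s) ->
  L1 (fun s => ker p (1 - s) * pos g (t * s)) /\
  conv p g t = t `^ p * Int (fun s => ker p (1 - s) * pos g (t * s)).
Proof.
move=> t0 l.
have E s : ker p (t - (t * s + 0)) * pos g (t * s + 0) =
    t `^ (p - 1) * (ker p (1 - s) * pos g (t * s)).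
  by rewrite addr0 mulrA -ker_homo// mulrBr mulr1.
have l' := L1_affine 0 t0 l.
have tp : t `^ (p - 1) != 0 by rewrite gt_eqF// powR_gt0.
have l'' : L1 (fun s => ker p (1 - s) * pos g (t * s)).
  apply: L1_ext (L1Z (t `^ (p - 1))^-1 l') => s.
  by rewrite E mulrA mulVf ?mul1r.
split=> //; rewrite /conv (Int_affine 0 t0 l) (Int_ext E) IntZ// mulrA.
congr (_ * _); rewrite -[X in X * _](powRr1 (ltW t0)) -powRD; last first.
  by rewrite (gt_eqF t0) implybT.
by congr (_ `^ _); ring.
Qed.

(** Continuous functions on the open half line bounded by a weight are the class
    on which fractional integrals are iterated. *)
Section AdmissibleFunctions.
Variables (p c b C : R) (g : R -> R).
Hypotheses (p0 : 0 < p) (p1 : p <= 1) (c0 : 0 < c) (c1 : c <= 1) (b0 : 0 < b).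
Hypothesis cg : forall s, 0 < s -> {for s, continuous g}.
Hypothesis gC : forall s, 0 < s -> `|g s| <= C * wt c b s.

Let C0 : 0 <= C.
Proof.
have := gC ltr01; rewrite -(pmulr_lge0 _ (wt_gt0 c b ltr01)).
by move=> /(le_trans (normr_ge0 _)).
Qed.

Let mg : measurable_fun setT (pos g). Proof. exact: measurable_pos_cont. Qed.

Lemma adm_L1 t : L1 (fun s => ker p (t - s) * pos g s).
Proof. by apply: (L1_conv p0 p1 c0 c1 b0 mg) => s s0 _; exact: gC. Qed.

Lemma adm_bound t : 0 < t -> `|conv p g t| <= C * qc p c b * wt c b t.
Proof. by apply: (conv_bound p0 p1 c0 c1 b0 mg) => s s0 _; exact: gC. Qed.

Lemma adm_continuous t : 0 < t -> {for t, continuous (conv p g)}.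
Proof.
move=> t0.
pose F x s := ker p (1 - s) * pos g (x * s).
have : {for t, continuous (fun x : R => x `^ p * Int (F x))}.
  apply: continuousM.
    have h := is_derive1_powR p t0.
    by apply: differentiable_continuous; apply/derivable1_diffP; case: h.
  pose D := C * (t / 2) `^ (c - 1) * expR (b * (2 * t)).
  have t20 : 0 < t / 2 by rewrite divr_gt0.
  have c1' s : 0 < s -> s < 1 -> `|wt c 1 s| <= 1 * wt c 1 s.
    by move=> _ _; rewrite mul1r ger0_norm// wt_ge0.
  have mw : measurable_fun setT (pos (wt c 1)).
    apply: measurable_pos; apply: measurable_funM; first exact: measurable_ker.
    by apply: measurableT_comp => //; exact: measurable_funM.
  have l := L1Z D (L1_conv p0 p1 c0 c1 (@ltr01 R) mw c1').
  apply: (Int_continuous _ _ _ l (u := t / 2) (v := 2 * t)).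
  - by rewrite ltr_pdivrMr// ltr_pMr// ltr1n.
  - by rewrite ltr_pMl// ltr1n.
  - move=> x tx xt; have x0 := lt_trans t20 tx.
    exact: (conv_scale x0 (adm_L1 x)).1.
  - move=> s x tx xt; have x0 := lt_trans t20 tx.
    apply: continuousM; first exact: cst_continuous.
    have [s0|s0] := ltP 0 s.
      have xs : {for x * s, continuous g} by apply: cg; rewrite mulr_gt0.
      have h : {for x, continuous (fun y : R => g (y * s))}.
        by apply: continuous_comp => //; apply: continuousM => //; exact: cst_continuous.
      apply: near_eq_cont h; near=> y; rewrite posE// mulr_gt0//.
      by near: y; exact: lt_nbhsr.
    have xs0 : x * s <= 0 by rewrite mulr_ge0_le0// ltW.
    apply: (@near_cst_continuous _ _ 0); near=> y; rewrite pos_le0// mulr_ge0_le0// ltW//.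
    by near: y; exact: lt_nbhsr.
  - move=> x s tx xt; have x0 := lt_trans t20 tx.
    rewrite /F normrM (ger0_norm (ker_ge0 _ _)).
    have [s0|s0] := ltP 0 s; last first.
      rewrite !pos_le0 ?normr0 ?mulr0// mulr_ge0_le0//; exact: ltW.
    have [s1|s1] := ltP s 1; last first.
      by rewrite ker_le0 ?mul0r ?mulr0// subr_le0.
    rewrite mulrCA ler_wpM2l ?ker_ge0// !posE ?mulr_gt0//.
    apply: le_trans (gC (mulr_gt0 x0 s0)) _.
      rewrite /D /wt ker_homo// mul1r.
      rewrite [X in _ <= X](_ : _ = C * (((t / 2) `^ (c - 1) * ker c s) * (expR (b * (2 * t)) * expR s))); last by ring.
      rewrite ler_wpM2l//; apply: ler_pM.
      - by rewrite mulr_ge0 ?powR_ge0 ?ker_ge0.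
      - exact: expR_ge0.
      - rewrite ler_wpM2r ?ker_ge0//.
        by rewrite -!kerE//; apply: ker_dec => //; exact: ltW.
      - have xs : x * s <= 2 * t.
          apply: (@le_trans _ _ x); last exact: ltW.
          by rewrite ler_piMr// ltW.
        rewrite -expRD ler_expR -[X in X <= _]addr0; apply: lerD; last exact: ltW.
        by rewrite ler_pM2l.
apply: near_eq_cont; near=> x.
have x0 : 0 < x by near: x; exact: lt_nbhsr.
by rewrite (conv_scale x0 (adm_L1 x)).2.
Unshelve. all: by end_near. Qed.
End AdmissibleFunctions.
End ConvolutionCalculus.

(** * Composition, inversion and Laplace transform of fractional integrals *)
Section ConvolutionTheorems.
Context {R : realType}.
Implicit Types (p q c b t s : R) (f g h : R -> R).

(** The one exchange of integrals behind both the composition of fractional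
    integrals ([m] a kernel) and their Laplace transform ([m] an exponential). *)
Lemma conv_fubini q g (m : R -> R) :
  measurable_fun setT m -> (forall r, 0 <= m r) -> measurable_fun setT (pos g) ->
  (forall r, L1 (fun s => ker q (r - s) * pos g s)) ->
  (forall s, L1 (fun r => m r * ker q (r - s))) ->
  L1 (fun s => `|pos g s| * Int (fun r => m r * ker q (r - s))) ->
  L1 (fun r => m r * conv q g r) /\
  Int (fun r => m r * conv q g r) =
    Int (fun s => pos g s * Int (fun r => m r * ker q (r - s))).
Proof.
move=> mm m0 mg l1 l2 l3.
pose F r s := m r * (ker q (r - s) * pos g s).
have mF : measurable_fun setT (fun z : R * R => F z.1 z.2).
  apply: measurable_funM; first exact: measurableT_comp.
  apply: measurable_funM; last exact: measurableT_comp.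
  apply: measurableT_comp; first exact: measurable_ker.
  exact: measurable_funB.
have F1 r : L1 (F r) by exact: L1Z.
have F2E s r : pos g s * (m r * ker q (r - s)) = F r s by rewrite /F; ring.
have F2 s : L1 (F ^~ s) by exact: L1_ext (F2E s) (L1Z _ (l2 s)).
have nE s : (fun r => `|pos g s| * (m r * ker q (r - s))) =1 (fun r => `|F r s|).
  by move=> r; rewrite -F2E normrM [X in _ = _ * X]ger0_norm// mulr_ge0 ?ker_ge0.
have F3 : L1 (fun s => Int (fun r => `|F r s|)).
  by apply: L1_ext l3 => s; rewrite -(Int_ext (nE s)) IntZ.
have E1 r : Int (F r) = m r * conv q g r by rewrite IntZ.
split; first exact: L1_ext E1 (Fubini_L1 mF F1 F2 F3).
rewrite -(Int_ext E1) (Fubini_Int mF F1 F2 F3); apply: Int_ext => s.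
by rewrite -IntZ//; apply: Int_ext => r; rewrite F2E.
Qed.

Lemma pos_ker p : pos (ker p) =1 ker p.
Proof. by move=> t; rewrite /pos /ker; case: (ltP 0 t). Qed.

Lemma ker_wt p b t : 0 < b -> 0 < t -> `|ker p t| <= 1 * wt p b t.
Proof.
move=> b0 t0; rewrite mul1r ger0_norm ?ker_ge0// /wt ler_peMr ?ker_ge0//.
by rewrite -expR0 ler_expR mulr_ge0// ltW.
Qed.

Lemma ker_continuous p t : 0 < t -> {for t, continuous (ker p)}.
Proof.
move=> t0; have h := is_derive1_powR (p - 1) t0.
have : {for t, continuous (fun x : R => x `^ (p - 1))}.
  by apply: differentiable_continuous; apply/derivable1_diffP; case: h.
apply: near_eq_cont; near=> x; rewrite kerE//; near: x; exact: lt_nbhsr.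
Unshelve. all: by end_near. Qed.

Lemma L1_conv_ker p q t : 0 < p -> p <= 1 -> 0 < q -> q <= 1 ->
  L1 (fun s => ker p (t - s) * ker q s).
Proof.
move=> p0 p1 q0 q1.
have := @adm_L1 R p q 1 1 (ker q) p0 p1 q0 q1 ltr01 (fun s => @ker_continuous q s)
  (fun s => @ker_wt q 1 s ltr01) t.
by apply: L1_ext => s; rewrite pos_ker.
Qed.

Lemma conv_ker_bound p q t : 0 < p -> p <= 1 -> 0 < q -> q <= 1 ->
  conv p (ker q) t <= qc p q 1 * (ker q t * expR t).
Proof.
move=> p0 p1 q0 q1; have [t0|t0] := ltP 0 t; last first.
  by rewrite conv_le0// ker_le0// mul0r mulr0.
have := @adm_bound R p q 1 1 (ker q) p0 p1 q0 q1 ltr01 (fun s => @ker_continuous q s)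
  (fun s => @ker_wt q 1 s ltr01) t t0.
by rewrite mul1r /wt mul1r => /(le_trans (ler_norm _)).
Qed.

Lemma conv_kerC p q t : 0 < p -> p <= 1 -> 0 < q -> q <= 1 ->
  conv p (ker q) t = conv q (ker p) t.
Proof.
move=> p0 p1 q0 q1; have l := L1_conv_ker t p0 p1 q0 q1.
rewrite /conv -(Int_ext (fun s => congr1 _ (esym (pos_ker q s)))).
rewrite -(Int_reflect t l); apply: Int_ext => s.
by rewrite pos_ker opprB addrC subrK mulrC.
Qed.

Lemma conv_ker_scale p q t : 0 < p -> p <= 1 -> 0 < q -> q <= 1 -> 0 < t ->
  conv p (ker q) t = t `^ (p + q - 1) * conv p (ker q) 1.
Proof.
move=> p0 p1 q0 q1 t0.
have l u : L1 (fun s => ker p (u - s) * pos (ker q) s).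
  by apply: L1_ext (L1_conv_ker u p0 p1 q0 q1) => s; rewrite pos_ker.
have [_ ->] := conv_scale t0 (l t).
have E s : ker p (1 - s) * pos (ker q) (t * s) =
    t `^ (q - 1) * (ker p (1 - s) * pos (ker q) s).
  by rewrite !pos_ker ker_homo// mulrCA.
rewrite (Int_ext E) IntZ; last exact: l.
rewrite mulrA -powRD ?addrA//.
by rewrite (gt_eqF t0) implybT.
Qed.

Section Composition.
Variables (c b C : R) (g : R -> R).
Hypotheses (c0 : 0 < c) (c1 : c <= 1) (b0 : 0 < b).
Hypothesis cg : forall s, 0 < s -> {for s, continuous g}.
Hypothesis gC : forall s, 0 < s -> `|g s| <= C * wt c b s.

Let C0 : 0 <= C.
Proof.
have := gC ltr01; rewrite -(pmulr_lge0 _ (wt_gt0 c b ltr01)).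
by move=> /(le_trans (normr_ge0 _)).
Qed.

Let mg : measurable_fun setT (pos g). Proof. exact: measurable_pos_cont. Qed.

Lemma conv_conv p q t : 0 < p -> p <= 1 -> 0 < q -> q <= 1 ->
  conv p (conv q g) t = Int (fun s => pos g s * conv p (ker q) (t - s)).
Proof.
move=> p0 p1 q0 q1.
have lq := adm_L1 q0 q1 c0 c1 b0 cg gC.
have kE s : (fun r => ker p (t - r) * ker q (r - s)) =1
    (fun r => (fun r' => ker p (t - s - r') * ker q r') (r - s)).
  by move=> r /=; congr (ker p _ * _); ring.
have l2 s : L1 (fun r => ker p (t - r) * ker q (r - s)).
  apply: (L1_ext (fsym (kE s))).
  exact: (@L1_shift _ s _ (L1_conv_ker (t - s) p0 p1 q0 q1)).
have i2 s : Int (fun r => ker p (t - r) * ker q (r - s)) = conv p (ker q) (t - s).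
  rewrite (Int_ext (kE s)) (Int_shift s (L1_conv_ker (t - s) p0 p1 q0 q1)).
  by apply: Int_ext => r; rewrite pos_ker.
have mck : measurable_fun setT (conv p (ker q)).
  have := @measurable_pos_cont R (conv p (ker q)).
  rewrite (funext (pos_conv _ _)); apply=> u u0.
  exact: (adm_continuous p0 p1 q0 q1 (@ltr01 R) (fun s => @ker_continuous q s)
    (fun s => @ker_wt q 1 s ltr01) u0).
have l3 : L1 (fun s => `|pos g s| * Int (fun r => ker p (t - r) * ker q (r - s))).
  apply: (@L1_le _ _ (fun s => (qc p q 1 * expR t) * `|ker q (t - s) * pos g s|)).
  - apply: measurable_funM; first exact: measurableT_comp.
    rewrite (funext i2); apply: measurableT_comp => //; exact: measurable_funB.
  - exact/L1Z/L1_norm/lq.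
  - move=> s; rewrite i2 normrM normr_id [X in _ * X <= _]ger0_norm; last first.
      by apply: conv_ge0 => r _ _; exact: ker_ge0.
    rewrite normrM [X in _ <= _ * (X * _)]ger0_norm ?ker_ge0//.
    have [s0|s0] := ltP 0 s; last by rewrite pos_le0// normr0 !(mul0r,mulr0).
    rewrite mulrC mulrA ler_wpM2r//.
    apply: le_trans (conv_ker_bound _ p0 p1 q0 q1) _.
    rewrite -[X in _ <= X]mulrA ler_wpM2l ?qc_ge0// mulrC ler_wpM2r ?ker_ge0//.
    by rewrite ler_expR lerBlDr lerDl ltW.
have [_] := conv_fubini (measurable_conv_ker p t) (fun r => ker_ge0 p (t - r)) mg lq l2 l3.
have -> : conv p (conv q g) t = Int (fun r => ker p (t - r) * conv q g r).
  by apply: Int_ext => r; rewrite pos_conv.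
by move=> ->; apply: Int_ext => s; rewrite i2.
Qed.

Lemma convC p q t : 0 < p -> p <= 1 -> 0 < q -> q <= 1 ->
  conv p (conv q g) t = conv q (conv p g) t.
Proof.
move=> p0 p1 q0 q1; rewrite (conv_conv t p0 p1 q0 q1) (conv_conv t q0 q1 p0 p1).
by apply: Int_ext => s; rewrite conv_kerC.
Qed.

(** Abel's inversion: the composition of two kernels is homogeneous of degree
    [p + q - 1], hence constant for complementary exponents. *)
Lemma conv_abel p q t : 0 < p -> 0 < q -> p + q = 1 ->
  conv p (conv q g) t = conv p (ker q) 1 * conv 1 g t.
Proof.
move=> p0 q0 pq.
have p1 : p <= 1 by rewrite -pq lerDl ltW.
have q1 : q <= 1 by rewrite -pq lerDr ltW.
have l1 := adm_L1 (@ltr01 R) (lexx 1) c0 c1 b0 cg gC t.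
rewrite (conv_conv t p0 p1 q0 q1) [in RHS]/(conv 1 g t) -IntZ//; apply: Int_ext => s.
have [st|st] := ltP s t; last first.
  rewrite conv_le0 ?subr_le0// ker_le0 ?subr_le0//; ring.
by rewrite conv_ker_scale ?subr_gt0// pq subrr powRr0 ker1 ?subr_gt0//; ring.
Qed.

Definition Lap (l : R) f : R := Int (fun s => expR (- (l * s)) * pos f s).

Lemma Lap_L1 l : b < l -> L1 (fun s => expR (- (l * s)) * pos g s).
Proof.
move=> bl; have lb0 : 0 < l - b by rewrite subr_gt0.
have [lk _] := ker_exp_scale c0 c1 lb0.
apply: (L1_le _ (L1Z C lk)).
  apply: measurable_funM => //; apply: measurableT_comp => //.
  by apply: measurableT_comp => //; exact: measurable_funM.
move=> s; rewrite normrM (ger0_norm (expR_ge0 _)).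
have [s0|s0] := ltP 0 s; last first.
  by rewrite pos_le0// normr0 mulr0 mulr_ge0// mulr_ge0 ?ker_ge0 ?expR_ge0.
rewrite posE// mulrC; apply: le_trans (ler_wpM2r (expR_ge0 _) (gC s0)) _.
rewrite /wt -!mulrA -expRD le_eqVlt; apply/orP; left; apply/eqP.
by congr (_ * (_ * expR _)); ring.
Qed.

(** The Laplace transform turns the kernel into the factor [l^(-p)], up to Gamma. *)
Lemma Lap_conv p l : 0 < p -> p <= 1 -> b < l ->
  Lap l (conv p g) = l `^ (- p) * gam p * Lap l g.
Proof.
move=> p0 p1 bl; have l0 : 0 < l by exact: lt_trans bl.
have [lk ik] := ker_exp_scale p0 p1 l0.
have lq := adm_L1 p0 p1 c0 c1 b0 cg gC.
have kE s : (fun r => expR (- (l * s)) * ((fun u => ker p u * expR (- (l * u))) (r - s))) =1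
    (fun r => expR (- (l * r)) * ker p (r - s)).
  move=> r /=; rewrite mulrCA -expRD mulrC; congr (expR _ * _); ring.
have l2 s : L1 (fun r => expR (- (l * r)) * ker p (r - s)).
  exact: L1_ext (kE s) (L1Z _ (@L1_shift _ s _ lk)).
have i2 s : Int (fun r => expR (- (l * r)) * ker p (r - s)) =
    expR (- (l * s)) * (l `^ (- p) * gam p).
  rewrite -(Int_ext (kE s)) IntZ; last exact: (@L1_shift _ s _ lk).
  by rewrite (Int_shift s lk) ik.
have me : measurable_fun setT (fun r : R => expR (- (l * r))).
  apply: measurableT_comp => //.
  by apply: measurableT_comp => //; exact: measurable_funM.
have lL := Lap_L1 bl.
have l3 : L1 (fun s => `|pos g s| * Int (fun r => expR (- (l * r)) * ker p (r - s))).
  apply: L1_ext (L1Z (l `^ (- p) * gam p) (L1_norm lL)) => s.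
  by rewrite i2 normrM (ger0_norm (expR_ge0 _)); ring.
have [_] := conv_fubini me (fun r => expR_ge0 _) mg lq l2 l3.
rewrite /Lap (Int_ext (fun r => congr1 _ (pos_conv p g r))) => ->.
rewrite -IntZ//; apply: Int_ext => s; rewrite i2; ring.
Qed.
End Composition.

(** [ker 1] is the Heaviside function, so [conv 1 g] is the primitive of [g]
    from 0 and this is the fundamental theorem of calculus. *)
Lemma conv1_derive g t : (forall u, L1 (fun s => ker 1 (u - s) * pos g s)) ->
  {for t, continuous (pos g)} -> is_derive t 1 (conv 1 g) (pos g t).
Proof.
move=> l ct.
have lu u : (@lebesgue_measure R).-integrable `]-oo, u] (EFin \o pos g).
  have : (@lebesgue_measure R).-integrable `]-oo, u]
      (EFin \o (fun s => ker 1 (u + 1 - s) * pos g s)).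
    by apply: integrableS (l (u + 1)).
  apply: eq_integrable => // s.
  rewrite inE/= in_itv/= => su; rewrite /= ker1 ?mul1r// subr_gt0.
  by apply: (le_lt_trans su); rewrite ltrDl.
have E u : conv 1 g u = \int[@lebesgue_measure R]_(s in `]-oo, u]) pos g s.
  rewrite -Rintegral_itv_bndo_bndc; last first.
    by apply: integrableS (lu u) => // s /=; rewrite !in_itv/=; exact: ltW.
  rewrite Rintegral_mkcond; apply: Int_ext => s; rewrite patchE mem_setE in_itv/=.
  case: (ltP s u) => su; first by rewrite ker1 ?mul1r ?subr_gt0.
  by rewrite ker_le0 ?mul0r ?subr_le0.
rewrite (funext E).
have tt : t < t + 1 by rewrite ltrDl.
have [|dF FE] := @continuous_FTC1 R (pos g) -oo%O t (t + 1) tt (lu _) _ ct.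
  by rewrite ltNyr.
by split; [exact: dF|rewrite -derive1E].
Qed.
End ConvolutionTheorems.

(** * Limits, Lipschitz bounds and continuity up to the origin *)
Section Auxiliary.
Context {R : realType}.
Implicit Types (p q c b t s : R) (f g h : R -> R).

(** Picard iterates will be shown to converge at the rate [2^-n]; the limit and
    its properties are extracted by hand, pointwise, since the weights are
    singular at the origin. *)
Lemma geometric_limit (u : nat -> R) (D : R) :
  (forall n, `|u n.+1 - u n| <= D * 2 ^- n) ->
  exists l, forall n, `|u n - l| <= 2 * D * 2 ^- n.
Proof.
move=> uD.
pose r (n : nat) : R := 2 * D * 2 ^- n.
have rE n : r n = D * 2 ^- n + r n.+1.
  rewrite /r exprS invfM; field; exact: lt0r_neq0 (exprn_gt0 n (ltr0n R 2)).
have lo n : u n - r n <= u n.+1 - r n.+1.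
  have := uD n; rewrite ler_norml (rE n) => /andP[]; lra.
have hi n : u n.+1 + r n.+1 <= u n + r n.
  have := uD n; rewrite ler_norml (rE n) => /andP[]; lra.
have r0 n : 0 <= r n.
  have := le_trans (normr_ge0 _) (uD n).
  by rewrite /r -mulrA => h; rewrite mulr_ge0.
have lomono m n : (m <= n)%N -> u m - r m <= u n - r n.
  elim: n => [|n IH]; first by rewrite leqn0 => /eqP ->.
  rewrite leq_eqVlt => /predU1P[->//|mn]; exact: le_trans (IH mn) (lo n).
have himono m n : (m <= n)%N -> u n + r n <= u m + r m.
  elim: n => [|n IH]; first by rewrite leqn0 => /eqP ->.
  rewrite leq_eqVlt => /predU1P[->//|mn]; exact: le_trans (hi n) (IH mn).
have lohi m n : u m - r m <= u n + r n.
  have a := lomono _ _ (leq_maxl m n); have b := himono _ _ (leq_maxr m n).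
  have := r0 (maxn m n); lra.
pose E := [set u n - r n | n in [set: nat]].
have E0 : E !=set0 by exists (u 0%N - r 0%N); exists 0%N.
have ubE n : ubound E (u n + r n) by move=> _ [m _ <-]; exact: lohi.
exists (sup E) => n; rewrite -/(r n) ler_norml.
have h1 : u n - r n <= sup E by apply: ub_le_sup; [exists (u 0%N + r 0%N)|exists n].
have h2 : sup E <= u n + r n by apply: ge_sup.
by apply/andP; split; lra.
Qed.

Lemma continuous_shift (d : R) f : continuous f -> continuous (fun t => f (t - d)).
Proof.
move=> cf t; apply: (@continuous_comp _ _ _ (fun t : R => t - d) f); last exact: cf.
by apply: cvgB => //; exact: cvg_cst.
Qed.

Lemma dist_tri (x y z e1 e2 : R) :
  `|y - x| <= e1 -> `|y - z| <= e2 -> `|x - z| <= e1 + e2.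
Proof.
move=> h1 h2; rewrite -(subrK y x) -addrA.
by apply: le_trans (ler_normD _ _) (lerD _ h2); rewrite distrC.
Qed.

Lemma half_pow_small (e : R) : 0 < e -> exists n : nat, 2 ^- n < e.
Proof.
move=> e0; have [n] := ltr_add_invr (y := 0) (x := e) e0; rewrite add0r => ne.
exists n; apply: le_lt_trans ne.
rewrite lef_pV2 ?posrE ?exprn_gt0 ?ltr0n// -natrX ler_nat.
exact: ltn_expl.
Qed.

Lemma eq_of_half_pow (x y C : R) : (forall n : nat, `|x - y| <= C * 2 ^- n) -> x = y.
Proof.
move=> H; apply/eqP; rewrite -subr_eq0 -normr_le0; apply/ler_addgt0Pl => e e0.
rewrite addr0.
have C0 : 0 <= C by have := le_trans (normr_ge0 _) (H 0%N); rewrite expr0 invr1 mulr1.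
have [n ne] := half_pow_small (divr_gt0 e0 (ltr_wpDl C0 ltr01)).
apply: le_trans (H n) _.
have C1 : 0 < C + 1 by rewrite ltr_wpDl.
apply: (@le_trans _ _ ((C + 1) * (e / (C + 1)))); last by rewrite mulrC divfK// gt_eqF.
by apply: ler_pM => //; [rewrite lerDl|exact: ltW].
Qed.

Lemma le_of_half_pow (x y C : R) : (forall n : nat, x - y <= C * 2 ^- n) -> x <= y.
Proof.
move=> H; rewrite leNgt; apply/negP => yx.
have xy0 : 0 < x - y by rewrite subr_gt0.
have C0 : 0 < C by have := lt_le_trans xy0 (H 0%N); rewrite expr0 invr1 mulr1.
have [n] := half_pow_small (divr_gt0 xy0 C0).
by rewrite ltr_pdivlMr// mulrC => /lt_le_trans/(_ (H n)); rewrite ltxx.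
Qed.

Lemma limit_continuous (F : nat -> R -> R) f t K :
  (forall n, {for t, continuous (F n)}) ->
  (\forall s \near t, forall n : nat, `|F n s - f s| <= K * 2 ^- n) ->
  {for t, continuous f}.
Proof.
move=> cF near_; apply/cvgrPdist_lt => e e0.
have tK := nbhs_singleton near_.
have K0 : 0 <= K by have := le_trans (normr_ge0 _) (tK 0%N); rewrite expr0 invr1 mulr1.
have K1 : 0 < K + 1 by rewrite ltr_wpDl.
have [n ne] := half_pow_small (divr_gt0 e0 (mulr_gt0 (ltr0n R 3) K1)).
have Kn : K * 2 ^- n < e / 3.
  apply: (@le_lt_trans _ _ ((K + 1) * 2 ^- n)).
    by rewrite ler_wpM2r ?invr_ge0 ?exprn_ge0// lerDl.
  have : (K + 1) * 2 ^- n < (K + 1) * (e / (3 * (K + 1))) by rewrite ltr_pM2l.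
  by rewrite (_ : (K + 1) * (e / (3 * (K + 1))) = e / 3)//; field; exact: lt0r_neq0.
have e30 : 0 < e / 3 by rewrite divr_gt0.
near=> s.
have h1 : `|F n t - F n s| < e / 3.
  by near: s; move/cvgrPdist_lt : (cF n) => /(_ _ e30).
have h2 : `|F n s - f s| <= K * 2 ^- n by have := near near_ s; apply.
have h3 := tK n.
move: h1 h2 h3; rewrite !ltr_norml !ler_norml; lra.
Unshelve. all: by end_near. Qed.

Lemma qc_small p c e : 0 < p -> p <= 1 -> 0 < e ->
  exists2 b0, 0 < b0 & forall b, b0 <= b -> qc p c b <= e.
Proof.
move=> p0 p1 e0.
set K := 2 * gam p + 4 * cut1 c.
have K0 : 0 < K by rewrite ltr_wpDr ?mulr_ge0 ?cut1_ge0// mulr_gt0 ?gam_gt0.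
exists ((K / e) `^ p^-1); first by apply: powR_gt0; exact: divr_gt0.
move=> b bb; have b0 : 0 < b by apply: lt_le_trans bb; apply: powR_gt0; exact: divr_gt0.
rewrite /qc -/K powRN mulrC ler_pdivrMr ?powR_gt0// mulrC -ler_pdivrMr//.
have -> : K / e = ((K / e) `^ p^-1) `^ p.
  by rewrite -powRrM mulVf ?gt_eqF// powRr1// ltW// divr_gt0.
by apply: ge0_ler_powR; rewrite ?nnegrE ?powR_ge0// ltW.
Qed.

Lemma lipschitz_of_derive f f1 (L : R) : (forall u : R, is_derive u 1 f (f1 u)) ->
  (forall u : R, `|f1 u| <= L) -> forall u v : R, `|f u - f v| <= L * `|u - v|.
Proof.
move=> df fL.
have cf u : {for u, continuous f}.
  by apply: differentiable_continuous; apply/derivable1_diffP; case: (df u).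
have H u v : v < u -> `|f u - f v| <= L * `|u - v|.
  move=> vu; have [|c _ ->] := @MVT R f f1 v u vu (fun x _ => df x).
    by apply: continuous_in_subspaceT => x _; exact: cf.
  by rewrite normrM ler_wpM2r.
move=> u v; have [vu|uv|->] := ltgtP v u; first exact: H.
  by rewrite distrC (distrC u); exact: H.
by rewrite !subrr normr0 mulr0.
Qed.

Section Admissible.
Variables (p c b C : R) (g : R -> R).
Hypotheses (p0 : 0 < p) (p1 : p <= 1) (c0 : 0 < c) (c1 : c <= 1) (b0 : 0 < b).
Hypothesis cg : forall s, 0 < s -> {for s, continuous g}.
Hypothesis gC : forall s, 0 < s -> `|g s| <= C * wt c b s.

Lemma adm_bound_pow t : 0 < t ->
  `|conv p g t| <= C * expR (b * t) * conv p (ker c) 1 * t `^ (p + c - 1).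
Proof.
move=> t0.
have C0 : 0 <= C.
  have := gC ltr01; rewrite -(pmulr_lge0 _ (wt_gt0 c b ltr01)).
  by move=> /(le_trans (normr_ge0 _)).
have lk : L1 (fun s => ker p (t - s) * pos (ker c) s).
  by apply: L1_ext (L1_conv_ker t p0 p1 c0 c1) => s; rewrite pos_ker.
rewrite -!mulrA (mulrC (conv _ _ _)) -conv_ker_scale// mulrA -convZ//.
apply: conv_norm_le; first exact: adm_L1 p0 p1 c0 c1 b0 cg gC t.
  apply: L1_ext (L1Z (C * expR (b * t)) lk) => s.
  by rewrite /pos; case: ifP => _; rewrite mulrCA ?mulr0.
move=> s s0 st; apply: le_trans (gC s0) _.
rewrite /wt -mulrA ler_wpM2l// mulrC ler_wpM2r ?ker_ge0//.
by rewrite ler_expR ler_pM2l// ltW.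
Qed.

(** The gain of regularity [p + c > 1] forces the integral to vanish
    continuously at the origin. *)
Lemma adm_continuousT : 1 < p + c -> continuous (conv p g).
Proof.
move=> pc t; have [t0|t0|<-] := ltgtP 0 t.
- exact: (adm_continuous p0 p1 c0 c1 b0 cg gC t0).
- apply: (@near_cst_continuous _ _ 0); near=> s; rewrite conv_le0// ltW//.
  by near: s; exact: lt_nbhsl.
have C0 : 0 <= C.
  have := gC ltr01; rewrite -(pmulr_lge0 _ (wt_gt0 c b ltr01)).
  by move=> /(le_trans (normr_ge0 _)).
set D := C * expR b * conv p (ker c) 1.
have D0 : 0 <= D.
  rewrite !mulr_ge0 ?expR_ge0//; apply: conv_ge0 => s _ _; exact: ker_ge0.
apply/cvgrPdist_lt => e e0; rewrite conv_le0//.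
have pc0 : 0 < p + c - 1 by rewrite subr_gt0.
have D1 : 0 < D + 1 by rewrite ltr_wpDl.
have eD : 0 < e / (D + 1) by rewrite divr_gt0.
pose d := Num.min 1 ((e / (D + 1)) `^ (p + c - 1)^-1).
have d0 : 0 < d by rewrite lt_min ltr01 powR_gt0.
near=> s; rewrite sub0r normrN.
have [s0|s0] := ltP 0 s; last by rewrite conv_le0// normr0.
have sd : s < d by near: s; exact: lt_nbhsl.
have [s1 s2] : s < 1 /\ s < (e / (D + 1)) `^ (p + c - 1)^-1.
  by move: sd; rewrite /d lt_min => /andP.
apply: le_lt_trans (adm_bound_pow s0) _.
apply: (@le_lt_trans _ _ (D * s `^ (p + c - 1))).
  rewrite ler_wpM2r ?powR_ge0// /D ler_wpM2r//.
    by apply: conv_ge0 => r _ _; exact: ker_ge0.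
  by rewrite ler_wpM2l// ler_expR ler_piMr// ltW.
have : s `^ (p + c - 1) < e / (D + 1).
  have -> : e / (D + 1) = ((e / (D + 1)) `^ (p + c - 1)^-1) `^ (p + c - 1).
    by rewrite -powRrM mulVf ?gt_eqF// powRr1// ltW.
  by apply: gt0_ltr_powR; rewrite ?nnegrE ?powR_ge0//; exact: ltW.
rewrite ltr_pdivlMr//; apply: le_lt_trans.
by rewrite mulrC ler_wpM2l ?powR_ge0// lerDl.
Unshelve. all: by end_near. Qed.
End Admissible.

Lemma continuous_bounded g t : continuous g ->
  exists2 K, 0 <= K & forall s, 0 <= s -> s <= t -> `|g s| <= K.
Proof.
move=> cg; have [t0|t0] := leP 0 t; last first.
  by exists 0 => // s s0 st; have := le_lt_trans (le_trans s0 st) t0; rewrite ltxx.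
have [|c _ cmax] := @EVT_max R (fun s => `|g s|) 0 t t0.
  apply: continuous_subspaceT => s; apply: continuous_comp; first exact: cg.
  exact: norm_continuous.
exists `|g c| => // s s0 st; apply: cmax; by rewrite in_itv/= s0.
Qed.

Lemma L1_conv_continuous p g t : 0 < p -> p <= 1 -> continuous g ->
  L1 (fun s => ker p (t - s) * pos g s).
Proof.
move=> p0 p1 cg; have [K K0 gK] := continuous_bounded t cg.
apply: (@L1_conv _ p 1 1 K) => //.
  by apply: measurable_pos; exact: continuous_measurable_fun.
move=> s s0 st; apply: le_trans (gK _ (ltW s0) (ltW st)) _.
by rewrite ler_peMr// /wt ker1// !mul1r -[X in X <= _]expR0 ler_expR ltW.
Qed.
End Auxiliary.

(** * Global existence for the delay equation *)
(** The unknown is the velocity [z] of the solution, not the solution itself: a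
    Caputo solution has to be absolutely continuous, and differentiating the
    integral equation y = phi + kappa I^alpha (A (y (t - tau)) + B y) gives an
    equation for [z] in which the right-hand side is again a fractional
    integral. Picard iteration is carried out on [z]; as the right-hand side
    multiplies [z] by a function of [y], a difference of positions is paid with
    a velocity, and differences of velocities get twice the exponential rate. *)
Section Existence.
Context {R : realType}.
Variables (alpha tau kappa : R) (A A1 B B1 phi phi1 : R -> R) (L M0 : R).
Hypotheses (al0 : 0 < alpha) (al1 : alpha <= 1) (tau0 : 0 <= tau) (kappa0 : 0 < kappa).
Hypothesis dA : forall u : R, is_derive u 1 A (A1 u).
Hypothesis dB : forall u : R, is_derive u 1 B (B1 u).
Hypothesis A1L : forall u, `|A1 u| <= L.
Hypothesis B1L : forall u, `|B1 u| <= L.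
Hypothesis A1lip : forall u v, `|A1 u - A1 v| <= L * `|u - v|.
Hypothesis B1lip : forall u v, `|B1 u - B1 v| <= L * `|u - v|.
Hypothesis dphi : forall t : R, is_derive t 1 phi (phi1 t).
Hypothesis cphi1 : continuous phi1.
Hypothesis phiM : forall t, `|phi t| <= M0.
Hypothesis phi1M : forall t, `|phi1 t| <= M0.
Hypothesis phi1_ge : forall t : R, 0 <= t -> phi1 t = 0.

Let G0 := A (phi (- tau)) + B (phi 0).
Hypothesis compat : tau = 0 /\ (forall t, phi t = phi 0) /\ (forall t, phi1 t = 0)
  \/ 0 < tau /\ G0 = 0.

(** The velocity of the solution behaves like [t^(alpha-1)] at the origin when
    there is no delay, and stays bounded when there is one, thanks to the
    compatibility of the initial datum; [gm - 1] is the exponent. *)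
Let gm := if tau == 0 then alpha else 1.

Let gm0 : 0 < gm. Proof. by rewrite /gm; case: ifP. Qed.
Let gm1 : gm <= 1. Proof. by rewrite /gm; case: ifP. Qed.

Let L0 : 0 <= L. Proof. exact: le_trans (normr_ge0 _) (A1L 0). Qed.
Let M00 : 0 <= M0. Proof. exact: le_trans (normr_ge0 _) (phiM 0). Qed.

Let lipA := lipschitz_of_derive dA A1L.
Let lipB := lipschitz_of_derive dB B1L.

Let cont_of_derive f f1 (t : R) : is_derive t 1 f (f1 t : R) -> {for t, continuous f}.
Proof. by move=> d; apply: differentiable_continuous; apply/derivable1_diffP; case: d. Qed.

Let lip_continuous (f : R -> R) : (forall u v, `|f u - f v| <= L * `|u - v|) -> continuous f.
Proof.
move=> fl u; apply/cvgrPdist_lt => e e0.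
have L1 : 0 < L + 1 by rewrite ltr_wpDl.
have eL : 0 < e / (L + 1) by rewrite divr_gt0.
near=> v.
have uv : `|u - v| < e / (L + 1) by near: v; exact: cvgr_dist_lt eL.
apply: le_lt_trans (fl u v) _.
move: uv; rewrite ltr_pdivlMr//; apply: le_lt_trans.
by rewrite mulrC ler_wpM2l// lerDl.
Unshelve. all: by end_near. Qed.

Let cA : continuous A. Proof. by move=> u; exact: (cont_of_derive (dA u)). Qed.
Let cB : continuous B. Proof. by move=> u; exact: (cont_of_derive (dB u)). Qed.
Let cA1 : continuous A1 := lip_continuous A1lip.
Let cB1 : continuous B1 := lip_continuous B1lip.
Let cphi : continuous phi. Proof. by move=> u; exact: (cont_of_derive (dphi u)). Qed.

(* one rate for three contractions: the bound on velocities, the differences of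
   positions, and the differences of velocities, whose weight has rate [2 b] *)
Let bt_ex : exists b, [/\ 0 < b, kappa * (2 * L * qc alpha gm b) <= 4^-1,
   kappa * (2 * L * qc alpha 1 b) <= 4^-1 & kappa * (2 * L * qc alpha gm (2 * b)) <= 4^-1].
Proof.
have K1 : 0 < kappa * (2 * L + 1) by rewrite mulr_gt0// ltr_wpDl// mulr_ge0.
have e0 : 0 < 4^-1 / (kappa * (2 * L + 1)) by rewrite divr_gt0.
have [b1 b10 H1] := qc_small gm al0 al1 e0.
have [b2 b20 H2] := qc_small 1 al0 al1 e0.
have key c b : qc alpha c b <= 4^-1 / (kappa * (2 * L + 1)) -> kappa * (2 * L * qc alpha c b) <= 4^-1.
  rewrite ler_pdivlMr// => h; apply: le_trans h.
  rewrite [X in _ <= X](_ : _ = kappa * (2 * L * qc alpha c b) + kappa * qc alpha c b); last by ring.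
  by rewrite lerDl mulr_ge0 ?qc_ge0// ltW.
exists (b1 + b2); split; first by rewrite addr_gt0.
- by apply/key/H1; rewrite lerDl ltW.
- by apply/key/H2; rewrite lerDr ltW.
- apply/key/H1; lra.
Qed.

Let bt_sig : {b | [/\ 0 < b, kappa * (2 * L * qc alpha gm b) <= 4^-1,
   kappa * (2 * L * qc alpha 1 b) <= 4^-1 & kappa * (2 * L * qc alpha gm (2 * b)) <= 4^-1]}.
Proof. exact: cid bt_ex. Qed.
Let bt := projT1 bt_sig.
Let bt0 : 0 < bt. Proof. by case: (projT2 bt_sig). Qed.
Let q1 : kappa * (2 * L * qc alpha gm bt) <= 4^-1. Proof. by have [_ h _ _] := projT2 bt_sig; exact: h. Qed.
Let q2 : kappa * (2 * L * qc alpha 1 bt) <= 4^-1. Proof. by have [_ _ h _] := projT2 bt_sig; exact: h. Qed.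
Let q3 : kappa * (2 * L * qc alpha gm (2 * bt)) <= 4^-1. Proof. by have [_ _ _ h] := projT2 bt_sig; exact: h. Qed.
Let bt20 : 0 < 2 * bt. Proof. by rewrite mulr_gt0. Qed.

Let M := M0 + 2 * kappa * `|G0|.
Let M_ge0 : 0 <= M. Proof. by rewrite addr_ge0 ?mulr_ge0// ltW. Qed.

(** position belonging to the velocity [z] *)
Definition Yof (z : R -> R) t := phi t + conv 1 z t.
(** time derivative of the right-hand side along the position [Yof z] *)
Definition gof z t := A1 (Yof z (t - tau)) * z (t - tau) + B1 (Yof z t) * z t.
Definition Gof y t := A (y (t - tau)) + B (y t) : R.
Definition step z t := phi1 t + kappa * (G0 * ker alpha t + conv alpha (gof z) t).

Definition vel (z : R -> R) := [/\ forall t : R, 0 < t \/ 0 < tau -> {for t, continuous z},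
  forall t : R, t <= 0 -> z t = phi1 t &
  forall t : R, 0 < t -> `|z t| <= M * wt gm bt t].

Let wt_delay C b (z : R -> R) : 0 < b -> 0 <= C ->
  (forall t, t <= 0 -> `|z t| <= C) -> (forall t, 0 < t -> `|z t| <= C * wt gm b t) ->
  forall t, 0 < t -> `|z (t - tau)| <= C * wt gm b t.
Proof.
move=> b0 C0 zn zp t t0; have [->|tn0] := eqVneq tau 0; first by rewrite subr0; exact: zp.
have g1 : gm = 1 by rewrite /gm (negbTE tn0).
have w1 s : 0 <= s -> 1 <= expR (b * s).
  by move=> s0; rewrite -expR0 ler_expR mulr_ge0// ltW.
have [tt|tt] := ltP 0 (t - tau).
  apply: le_trans (zp _ tt) _; rewrite ler_wpM2l// /wt g1 !ker1// !mul1r.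
  by rewrite ler_expR ler_pM2l// gerBl.
apply: le_trans (zn _ tt) _; rewrite ler_peMr// /wt g1 ker1// mul1r.
exact/w1/ltW.
Qed.

Section Velocity.
Variable z : R -> R.
Hypothesis vz : vel z.

Let cz t : 0 < t -> {for t, continuous z}.
Proof. by case: vz => h _ _ t0; apply: h; left. Qed.
Let zM t : 0 < t -> `|z t| <= M * wt gm bt t.
Proof. by case: vz => _ _; apply. Qed.

Lemma vel_pos t : pos z t = z t - phi1 t.
Proof.
rewrite /pos; case: ltP => t0; first by rewrite phi1_ge ?subr0// ltW.
by case: vz => _ h _; rewrite h// subrr.
Qed.

Lemma Yof_derive (t : R) : 0 < t \/ 0 < tau -> is_derive t 1 (Yof z) (z t).
Proof.
move=> tt.
have l := adm_L1 (@ltr01 R) (lexx 1) gm0 gm1 bt0 cz zM.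
have cp : {for t, continuous (pos z)}.
  rewrite (_ : pos z = z - phi1); last by apply/funext => s; rewrite vel_pos.
  by apply: continuousB; [case: vz => h _ _; exact: h|exact: cphi1].
have := is_deriveD (dphi t) (conv1_derive l cp).
by rewrite vel_pos [phi1 t + _]addrC subrK.
Qed.

Lemma Yof_continuous : continuous (Yof z).
Proof.
move=> t; apply: continuousD; first exact: cphi.
by apply: (adm_continuousT (@ltr01 R) (lexx 1) gm0 gm1 bt0 cz zM); rewrite ltrDl.
Qed.

Lemma Yof_le0 t : t <= 0 -> Yof z t = phi t.
Proof. by move=> t0; rewrite /Yof conv_le0// addr0. Qed.

Lemma Yof_delay_continuous : continuous (fun t => Yof z (t - tau)).
Proof.
exact: continuous_shift Yof_continuous.
Qed.

Let z_delay_cont t : 0 < t -> {for t, continuous (fun t => z (t - tau))}.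
Proof.
move=> t0; apply: (@continuous_comp _ _ _ (fun t : R => t - tau) z).
  by apply: continuousB => //; exact: cst_continuous.
case: vz => h _ _; apply: h; have [->|tn0] := eqVneq tau 0; first by left; rewrite subr0.
by right; rewrite lt_neqAle eq_sym tn0.
Qed.

Lemma gof_continuous t : 0 < t -> {for t, continuous (gof z)}.
Proof.
move=> t0; apply: continuousD; apply: continuousM.
- by apply: continuous_comp; [exact: Yof_delay_continuous|exact: cA1].
- exact: z_delay_cont.
- by apply: continuous_comp; [exact: Yof_continuous|exact: cB1].
- exact: cz.
Qed.

Lemma vel_delay t : 0 < t -> `|z (t - tau)| <= M * wt gm bt t.
Proof.
apply: wt_delay => // s s0; case: vz => _ h _; rewrite h//.
by apply: le_trans (phi1M s) _; rewrite lerDl mulr_ge0// mulr_ge0// ltW.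
Qed.

Lemma gof_bound t : 0 < t -> `|gof z t| <= 2 * L * M * wt gm bt t.
Proof.
move=> t0; apply: le_trans (ler_normD _ _) _; rewrite !normrM.
rewrite (_ : 2 * L * M * _ = L * (M * wt gm bt t) + L * (M * wt gm bt t)); last by ring.
by apply: lerD; apply: ler_pM => //; [exact: vel_delay|exact: zM].
Qed.

Lemma Gof_continuous : continuous (Gof (Yof z)).
Proof.
move=> t; apply: continuousD.
- by apply: continuous_comp; [exact: Yof_delay_continuous|exact: cA].
- by apply: continuous_comp; [exact: Yof_continuous|exact: cB].
Qed.

Lemma Gof_primitive t : 0 < t -> Gof (Yof z) t = G0 + conv 1 (gof z) t.
Proof.
move=> t0.
pose f s := Gof (Yof z) s - conv 1 (gof z) s.
have cf : continuous f.
  move=> s; apply: continuousB; first exact: Gof_continuous.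
  apply: (adm_continuousT (@ltr01 R) (lexx 1) gm0 gm1 bt0 gof_continuous gof_bound).
  by rewrite ltrDl.
have df (s : R) : s \in `]0, t[ -> is_derive s 1 f 0.
  rewrite in_itv/= => /andP[s0 _].
  have l := adm_L1 (@ltr01 R) (lexx 1) gm0 gm1 bt0 gof_continuous gof_bound.
  have cp : {for s, continuous (pos (gof z))}.
    have := gof_continuous s0; apply: near_eq_cont; near=> r; rewrite posE//.
    by near: r; exact: lt_nbhsr.
  have d1 := Yof_derive (or_introl s0).
  have ts : 0 < s - tau \/ 0 < tau.
    have [->|tn0] := eqVneq tau 0; first by left; rewrite subr0.
    by right; rewrite lt_neqAle eq_sym tn0.
  have d2 : is_derive s 1 (fun r => Yof z (r - tau)) (z (s - tau)).
    have h := Yof_derive ts.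
    have hs : is_derive s 1 (fun r : R => r - tau) (1 - 0) by exact: is_deriveB.
    have := @is_derive1_comp _ (Yof z) (fun r => r - tau) s _ _ h hs.
    by rewrite subr0 mulr1.
  have d3 := @is_derive1_comp _ A (fun r => Yof z (r - tau)) s _ _ (dA _) d2.
  have d4 := @is_derive1_comp _ B (Yof z) s _ _ (dB _) d1.
  have := is_deriveB (is_deriveD d3 d4) (conv1_derive l cp).
  by rewrite posE// subrr.
have [|c _ E] := MVT t0 df; first exact: continuous_subspaceT.
move: E; rewrite mul0r => /eqP; rewrite subr_eq0 => /eqP.
have GE : Gof (Yof z) 0 = G0.
  by rewrite /Gof sub0r (Yof_le0 (lexx 0)) Yof_le0// oppr_le0.
rewrite /f (conv_le0 _ _ (lexx 0)) subr0 GE => <-.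
by move: (Gof _ _) (conv _ _ _) => u v; rewrite subrK.
Unshelve. all: by end_near. Qed.

Let G0_ker t : `|G0| * ker alpha t = `|G0| * ker gm t.
Proof.
case: compat => [[t0 _]|[_ ->]]; last by rewrite normr0 !mul0r.
by rewrite /gm t0 eqxx.
Qed.

Lemma step_vel : vel (step z).
Proof.
split.
- move=> t tt; apply: continuousD; first exact: cphi1.
  apply: continuousM; first exact: cst_continuous.
  have [t0|t0] := ltP 0 t.
    apply: continuousD; last exact: (adm_continuous al0 al1 gm0 gm1 bt0 gof_continuous gof_bound t0).
    apply: continuousM; first exact: cst_continuous.
    exact: ker_continuous.
  case: tt => tt; first by have := lt_le_trans tt t0; rewrite ltxx.
  case: compat => [[E _]|[_ G00]]; first by move: tt; rewrite E ltxx.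
  rewrite (_ : (fun _ => _) = conv alpha (gof z)); last first.
    by apply/funext => s; rewrite G00 mul0r add0r.
  apply: (adm_continuousT al0 al1 gm0 gm1 bt0 gof_continuous gof_bound).
  by rewrite /gm gt_eqF// ltrDr.
- by move=> t t0; rewrite /step ker_le0// conv_le0// mulr0 addr0 mulr0 addr0.
- move=> t t0; rewrite /step (phi1_ge (ltW t0)) add0r normrM (gtr0_norm kappa0).
  have h1 := adm_bound al0 al1 gm0 gm1 bt0 gof_continuous gof_bound t0.
  have h2 : `|G0 * ker alpha t| <= `|G0| * wt gm bt t.
    rewrite normrM [X in _ * X]ger0_norm ?ker_ge0// G0_ker ler_wpM2l//.
    by rewrite ler_peMr ?ker_ge0// -expR0 ler_expR mulr_ge0// ltW.
  have h3 := le_trans (ler_normD _ _) (lerD h2 h1).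
  have h4 := ler_wpM2l (ltW kappa0) h3.
  apply: le_trans h4 _.
  have w0 := wt_ge0 gm bt t.
  rewrite (_ : kappa * _ = (kappa * `|G0| + kappa * (2 * L * qc alpha gm bt) * M) * wt gm bt t); last by ring.
  rewrite ler_wpM2r//.
  apply: (@le_trans _ _ (kappa * `|G0| + 4^-1 * M)); first exact: lerD (lexx _) (ler_wpM2r M_ge0 q1).
  rewrite /M; have : 0 <= kappa * `|G0| by rewrite mulr_ge0// ltW.
  have := M00; lra.
Qed.

(** Fractional integrals commute, so the update of the velocity integrates to
    the plain Picard update of the position. This is where positivity and the
    convergence of positions come from. *)
Lemma Yof_step t : Yof (step z) t = phi t + kappa * conv alpha (Gof (Yof z)) t.
Proof.
rewrite /Yof; congr (_ + _).
have lk : L1 (fun s => ker 1 (t - s) * pos (ker alpha) s).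
  by apply: L1_ext (L1_conv_ker t (@ltr01 R) (lexx 1) al0 al1) => s; rewrite pos_ker.
have [vs _ _] := step_vel.
have vd := adm_bound al0 al1 gm0 gm1 bt0 gof_continuous gof_bound.
have vc := adm_continuous al0 al1 gm0 gm1 bt0 gof_continuous gof_bound.
have lc := adm_L1 (@ltr01 R) (lexx 1) gm0 gm1 bt0 vc vd t.
have lkG : L1 (fun s => ker 1 (t - s) * pos (fun s => G0 * ker alpha s) s).
  apply: L1_ext (L1Z G0 lk) => s; rewrite /pos; case: ifP => _; ring.
have -> : conv 1 (step z) t = kappa * (G0 * conv 1 (ker alpha) t + conv 1 (conv alpha (gof z)) t).
  rewrite -(convZ _ lk) -convD// -convZ; last first.
    apply: L1_ext (L1D lkG lc) => s; rewrite /pos; case: ifP => _; ring.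
  by apply: conv_ext => s s0 _; rewrite /step phi1_ge ?ltW// add0r.
congr (_ * _).
have vc1 := adm_continuous (@ltr01 R) (lexx 1) gm0 gm1 bt0 gof_continuous gof_bound.
have vd1 := adm_bound (@ltr01 R) (lexx 1) gm0 gm1 bt0 gof_continuous gof_bound.
have lc1 := adm_L1 al0 al1 gm0 gm1 bt0 vc1 vd1 t.
have l1 : L1 (fun s => ker alpha (t - s) * pos (ker 1) s).
  by apply: L1_ext (L1_conv_ker t al0 al1 (@ltr01 R) (lexx 1)) => s; rewrite pos_ker.
have l1G : L1 (fun s => ker alpha (t - s) * pos (fun s => G0 * ker 1 s) s).
  apply: L1_ext (L1Z G0 l1) => s; rewrite /pos; case: ifP => _; ring.
rewrite (convC gm0 gm1 bt0 gof_continuous gof_bound t (@ltr01 R) (lexx 1) al0 al1).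
rewrite conv_kerC// -(convZ _ l1) -convD//.
by apply: conv_ext => s s0 _; rewrite Gof_primitive// ker1// mulr1.
Qed.
End Velocity.

Implicit Types (b d s t : R) (z y : R -> R).

Let wt1_le b s t : 0 < b -> 0 < s -> s <= t -> wt 1 b s <= wt 1 b t.
Proof.
move=> b0 s0 st; rewrite /wt !ker1 ?(lt_le_trans s0 st)// !mul1r.
by rewrite ler_expR ler_pM2l.
Qed.

Let wt_double t : 0 < t -> wt 1 bt t * wt gm bt t = wt gm (2 * bt) t.
Proof.
move=> t0; rewrite /wt ker1// mul1r mulrCA -expRD; congr (_ * expR _); ring.
Qed.

Let Ydiff_delay z z' d : vel z -> vel z' -> 0 <= d ->
  (forall t, 0 < t -> `|Yof z t - Yof z' t| <= d * wt 1 bt t) ->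
  forall t, 0 < t -> `|Yof z (t - tau) - Yof z' (t - tau)| <= d * wt 1 bt t.
Proof.
move=> vz vz' d0 H t t0; have [tt|tt] := ltP 0 (t - tau).
  apply: le_trans (H _ tt) _; rewrite ler_wpM2l// wt1_le//.
  by rewrite gerBl.
by rewrite !Yof_le0// subrr normr0 mulr_ge0// wt_ge0.
Qed.

Let gof_diff z z' d d' : vel z -> vel z' -> 0 <= d -> 0 <= d' ->
  (forall t, 0 < t -> `|Yof z t - Yof z' t| <= d * wt 1 bt t) ->
  (forall t, 0 < t -> `|z t - z' t| <= d' * wt gm (2 * bt) t) ->
  forall t, 0 < t -> `|gof z t - gof z' t| <= 2 * L * (d' + d * M) * wt gm (2 * bt) t.
Proof.
move=> vz vz' d0 d'0 HY Hz t t0.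
have HYd := Ydiff_delay vz vz' d0 HY t0.
have Hzd : `|z (t - tau) - z' (t - tau)| <= d' * wt gm (2 * bt) t.
  apply: (@wt_delay d' (2 * bt) (fun s => z s - z' s)) => // s s0.
  by case: vz => _ -> // _; case: vz' => _ -> // _; rewrite subrr normr0.
have key (a1 a1' u u' : R) : `|a1| <= L -> `|a1 - a1'| <= L * (d * wt 1 bt t) ->
    `|u - u'| <= d' * wt gm (2 * bt) t -> `|u'| <= M * wt gm bt t ->
    `|a1 * u - a1' * u'| <= L * (d' + d * M) * wt gm (2 * bt) t.
  move=> h1 h2 h3 h4.
  rewrite (_ : a1 * u - a1' * u' = a1 * (u - u') + (a1 - a1') * u'); last by ring.
  apply: le_trans (ler_normD _ _) _; rewrite !normrM.
  rewrite (_ : L * (d' + d * M) * _ = L * (d' * wt gm (2 * bt) t) + L * (d * M * wt gm (2 * bt) t)); last by ring.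
  have e1 := ler_pM (normr_ge0 a1) (normr_ge0 (u - u')) h1 h3.
  have e2 := ler_pM (normr_ge0 (a1 - a1')) (normr_ge0 u') h2 h4.
  apply: lerD => //; apply: le_trans e2 _.
  by rewrite -wt_double// le_eqVlt; apply/orP; left; apply/eqP; ring.
rewrite /gof.
set p1 := A1 _ * _; set p2 := B1 _ * _; set p3 := A1 _ * _; set p4 := B1 _ * _.
rewrite (_ : p1 + p2 - (p3 + p4) = (p1 - p3) + (p2 - p4)); last by ring.
apply: le_trans (ler_normD _ _) _.
rewrite (_ : 2 * L * _ * _ = L * (d' + d * M) * wt gm (2 * bt) t + L * (d' + d * M) * wt gm (2 * bt) t); last by ring.
apply: lerD; apply: key => //.
- by apply: le_trans (A1lip _ _) _; rewrite ler_wpM2l.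
- exact: (@vel_delay z' vz' t t0).
- exact: le_trans (B1lip _ _) (ler_wpM2l L0 (HY _ t0)).
- exact: Hz.
- by case: vz' => _ _; apply.
Qed.

Let zs n := iter n step phi1.

Let vel_zs n : vel (zs n).
Proof.
elim: n => [|n IH]; last exact: step_vel.
split=> //.
- by move=> t _; exact: cphi1.
- by move=> t t0; rewrite /= (phi1_ge (ltW t0)) normr0 mulr_ge0// wt_ge0.
Qed.

Let CG := `|A 0| + `|B 0| + 2 * L * M0.
Let D := kappa * CG * qc alpha 1 bt.
Let CG0 : 0 <= CG. Proof. by rewrite !addr_ge0 ?mulr_ge0. Qed.
Let D0 : 0 <= D.
Proof. by apply: mulr_ge0; [apply: mulr_ge0 => //; exact: ltW|exact: qc_ge0]. Qed.

Let Gof_phi t : `|Gof (Yof (zs 0%N)) t| <= CG.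
Proof.
have Yphi s : Yof (zs 0%N) s = phi s.
  by rewrite /Yof conv_eq0 ?addr0// => r r0 _; rewrite /= (phi1_ge (ltW r0)).
rewrite /Gof !Yphi; apply: le_trans (ler_normD _ _) _.
have hA u : `|u| <= M0 -> `|A u| <= `|A 0| + L * M0.
  move=> uM; have := lipA u 0; rewrite subr0 => h.
  have h' : L * `|u| <= L * M0 by rewrite ler_wpM2l.
  have := ler_normD (A u - A 0) (A 0); rewrite subrK; lra.
have hB u : `|u| <= M0 -> `|B u| <= `|B 0| + L * M0.
  move=> uM; have := lipB u 0; rewrite subr0 => h.
  have h' : L * `|u| <= L * M0 by rewrite ler_wpM2l.
  have := ler_normD (B u - B 0) (B 0); rewrite subrK; lra.
have := hA _ (phiM (t - tau)); have := hB _ (phiM t); rewrite /CG; lra.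
Qed.

Let lG z t : vel z -> L1 (fun s => ker alpha (t - s) * pos (Gof (Yof z)) s).
Proof. by move=> vz; apply: L1_conv_continuous => //; exact: Gof_continuous. Qed.

Let Ydiff n t : 0 < t ->
  `|Yof (zs n.+1) t - Yof (zs n) t| <= D * 2 ^- n * wt 1 bt t.
Proof.
elim: n t => [|n IH] t t0.
  rewrite expr0 invr1 mulr1.
  have -> : Yof (zs 1%N) t - Yof (zs 0%N) t = kappa * conv alpha (Gof (Yof (zs 0%N))) t.
    rewrite (Yof_step (vel_zs 0)) addrAC (_ : Yof (zs 0%N) t = phi t) ?subrr ?add0r//.
    by rewrite /Yof conv_eq0 ?addr0// => r r0 _; rewrite /= (phi1_ge (ltW r0)).
  rewrite normrM gtr0_norm// [X in _ <= X](_ : _ = kappa * (CG * qc alpha 1 bt * wt 1 bt t)); last by rewrite /D; ring.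
  rewrite ler_pM2l//.
  apply: (adm_bound al0 al1 (@ltr01 R) (lexx 1) bt0) => //.
    by move=> s _; exact: (Gof_continuous (vel_zs 0)).
  move=> s s0; apply: le_trans (Gof_phi s) _.
  rewrite ler_peMr// /wt ker1// mul1r -expR0 ler_expR.
  by rewrite mulr_ge0// ltW.
have -> : Yof (zs n.+2) t - Yof (zs n.+1) t =
    kappa * conv alpha (fun s => Gof (Yof (zs n.+1)) s - Gof (Yof (zs n)) s) t.
  rewrite (Yof_step (vel_zs n.+1)) (Yof_step (vel_zs n)) convB; try exact: lG.
  by move: (conv _ _ t) (conv _ _ t) => u v; ring.
have Dn : 0 <= D * 2 ^- n by rewrite mulr_ge0// invr_ge0 exprn_ge0.
rewrite normrM gtr0_norm//.
have := @adm_bound R alpha 1 bt (2 * L * (D * 2 ^- n)) _ al0 al1 (@ltr01 R) (lexx 1) bt0 _ _ t t0.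
move=> /(_ (fun s => Gof (Yof (zs n.+1)) s - Gof (Yof (zs n)) s)) h.
apply: le_trans (ler_wpM2l (ltW kappa0) (h _ _)) _.
- by move=> s s0; apply: continuousB; exact: Gof_continuous.
- move=> s s0.
  rewrite (_ : _ - _ = (A (Yof (zs n.+1) (s - tau)) - A (Yof (zs n) (s - tau))) +
     (B (Yof (zs n.+1) s) - B (Yof (zs n) s))); last by rewrite /Gof; ring.
  apply: le_trans (ler_normD _ _) _.
  rewrite (_ : 2 * L * _ * _ = L * (D * 2 ^- n * wt 1 bt s) + L * (D * 2 ^- n * wt 1 bt s)); last by ring.
  apply: lerD.
    apply: le_trans (lipA _ _) _; rewrite ler_wpM2l//.
    exact: (Ydiff_delay (vel_zs _) (vel_zs _) Dn IH).
  by apply: le_trans (lipB _ _) _; rewrite ler_wpM2l// IH.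
rewrite [X in X <= _](_ : _ = kappa * (2 * L * qc alpha 1 bt) * (D * 2 ^- n) * wt 1 bt t); last by ring.
rewrite exprS invfM [X in _ <= X](_ : _ = 2^-1 * (D * 2 ^- n) * wt 1 bt t); last by ring.
rewrite ler_wpM2r ?wt_ge0//.
by rewrite ler_wpM2r//; apply: le_trans q2 _; lra.
Qed.

Let D' := 2 * M + D * M.
Let D'0 : 0 <= D'. Proof. by apply: addr_ge0; apply: mulr_ge0. Qed.

Let lg z t : vel z -> L1 (fun s => ker alpha (t - s) * pos (gof z) s).
Proof.
by move=> vz; exact: adm_L1 al0 al1 gm0 gm1 bt0 (gof_continuous vz) (gof_bound vz) t.
Qed.

Let step_diff z z' e : vel z -> vel z' ->
  (forall t, 0 < t -> `|gof z t - gof z' t| <= e * wt gm (2 * bt) t) ->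
  forall t, 0 < t -> `|step z t - step z' t| <= kappa * (e * qc alpha gm (2 * bt)) * wt gm (2 * bt) t.
Proof.
move=> vz vz' H t t0.
have -> : step z t - step z' t = kappa * conv alpha (fun s => gof z s - gof z' s) t.
  rewrite /step convB; try exact: lg.
  by move: (conv _ _ t) (conv _ _ t) => u v; ring.
rewrite normrM gtr0_norm// -mulrA ler_pM2l//.
apply: (adm_bound al0 al1 gm0 gm1 bt20) => // s s0.
by apply: continuousB; exact: gof_continuous.
Qed.

Let zdiff n t : 0 < t -> `|zs n.+1 t - zs n t| <= D' * 2 ^- n * wt gm (2 * bt) t.
Proof.
elim: n t => [|n IH] t t0.
  rewrite expr0 invr1 mulr1; apply: (@le_trans _ _ (2 * M * wt gm bt t)).
    have h n := (let: And3 _ _ h := vel_zs n in h) t t0.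
    have := h 0%N; have := h 1%N; have := ler_normB (zs 1 t) (zs 0 t); lra.
  have w2 : wt gm bt t <= wt gm (2 * bt) t.
    rewrite -wt_double// ler_peMl ?wt_ge0// /wt ker1// mul1r -expR0 ler_expR.
    by rewrite mulr_ge0// ltW.
  apply: ler_pM => //; first by rewrite mulr_ge0.
    exact: wt_ge0.
  by rewrite lerDl mulr_ge0.
have pn : 0 <= 2 ^- n :> R by rewrite invr_ge0 exprn_ge0.
have Dn : 0 <= D * 2 ^- n by rewrite mulr_ge0.
have D'n : 0 <= D' * 2 ^- n by rewrite mulr_ge0.
have h := gof_diff (vel_zs n.+1) (vel_zs n) Dn D'n (@Ydiff n) IH.
apply: le_trans (step_diff (vel_zs n.+1) (vel_zs n) h t0) _.
rewrite ler_wpM2r ?wt_ge0//.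
rewrite (_ : kappa * _ = kappa * (2 * L * qc alpha gm (2 * bt)) * ((D' + D * M) * 2 ^- n)); last by ring.
apply: le_trans (ler_wpM2r _ q3) _; first by rewrite mulr_ge0// addr_ge0// mulr_ge0.
have : D * M * 2 ^- n <= D' * 2 ^- n.
  by rewrite ler_wpM2r// lerDr mulr_ge0.
rewrite exprS invfM; move: D'n; lra.
Qed.

Let zlim_ex : exists z : R -> R, forall t n,
  `|zs n t - z t| <= 2 * pos (fun t => D' * wt gm (2 * bt) t) t * 2 ^- n.
Proof.
have H t : exists l, forall n, `|zs n t - l| <= 2 * pos (fun t => D' * wt gm (2 * bt) t) t * 2 ^- n.
  apply: geometric_limit => n; have [t0|t0] := ltP 0 t.
    by rewrite posE// mulrAC; exact: zdiff.
  rewrite pos_le0// mul0r.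
  case: (vel_zs n) => _ -> // _; case: (vel_zs n.+1) => _ -> // _.
  by rewrite subrr normr0.
by have [z Hz] := choice H; exists z.
Qed.

Let ylim_ex : exists y : R -> R, forall t n,
  `|Yof (zs n) t - y t| <= 2 * pos (fun t => D * wt 1 bt t) t * 2 ^- n.
Proof.
have H t : exists l, forall n, `|Yof (zs n) t - l| <= 2 * pos (fun t => D * wt 1 bt t) t * 2 ^- n.
  apply: geometric_limit => n; have [t0|t0] := ltP 0 t.
    by rewrite posE// mulrAC; exact: Ydiff.
  by rewrite pos_le0// mul0r !Yof_le0// subrr normr0.
by have [z Hz] := choice H; exists z.
Qed.

Let vel_limit z : (forall t n,
    `|zs n t - z t| <= 2 * pos (fun t => D' * wt gm (2 * bt) t) t * 2 ^- n) ->
  vel z.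
Proof.
move=> Hz; split.
- move=> t tt.
  have [K HK] : exists K, \forall s \near t, 2 * pos (fun t => D' * wt gm (2 * bt) t) s <= K.
    have [t0|t0] := ltP 0 t.
      have cw : {for t, continuous (fun s => 2 * (D' * wt gm (2 * bt) s))}.
        apply: continuousM; first exact: cst_continuous.
        apply: continuousM; first exact: cst_continuous.
        apply: continuousM; first exact: ker_continuous.
        apply: continuous_comp; last exact: continuous_expR.
        by apply: continuousM => //; exact: cst_continuous.
      exists (2 * (D' * wt gm (2 * bt) t) + 1).
      near=> s; rewrite posE; last by near: s; exact: lt_nbhsr.
      have : `|2 * (D' * wt gm (2 * bt) t) - 2 * (D' * wt gm (2 * bt) s)| < 1.
        by near: s; move/cvgrPdist_lt : cw; apply.
      rewrite ltr_norml; lra.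
    case: tt => tt; first by have := lt_le_trans tt t0; rewrite ltxx.
    have g1 : gm = 1 by rewrite /gm gt_eqF.
    exists (2 * (D' * expR (2 * bt))); near=> s.
    rewrite ler_pM2l//; have [s0|s0] := ltP 0 s; last by rewrite pos_le0// mulr_ge0// expR_ge0.
    rewrite posE// ler_wpM2l// /wt g1 ker1// mul1r ler_expR ler_piMr//.
      exact: ltW.
    apply: ltW; near: s; apply: lt_nbhsl; exact: le_lt_trans t0 ltr01.
  apply: (@limit_continuous R zs z t K).
    by move=> n; case: (vel_zs n) => h _ _; exact: h.
  near=> s => n; apply: le_trans (Hz s n) _.
  rewrite ler_wpM2r ?invr_ge0 ?exprn_ge0//.
  by near: s.
- move=> t t0; apply: (@eq_of_half_pow R _ _ 0) => n.
  by rewrite distrC; have := Hz t n; rewrite pos_le0// mulr0 !mul0r; case: (vel_zs n) => _ -> .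
- move=> t t0; apply: (@le_of_half_pow R _ _ (2 * pos (fun t => D' * wt gm (2 * bt) t) t)) => n.
  have h1 : `|zs n t| <= M * wt gm bt t by case: (vel_zs n) => _ _; apply.
  have := Hz t n; have := ler_normD (z t - zs n t) (zs n t).
  rewrite subrK distrC; lra.
Unshelve. all: by end_near. Qed.

(** Besides the integral equation, the statement exports the velocity equation
    and its bounds, from which the Caputo derivative is computed, and the
    invariance of a half line, which holds for every Picard iterate. *)
Theorem delay_equation_solution : exists y z : R -> R,
  [/\ [/\ forall t, t <= 0 -> y t = phi t, continuous y,
        forall t : R, 0 < t \/ 0 < tau -> is_derive t 1 y (z t)
      & forall t : R, 0 < t \/ 0 < tau -> {for t, continuous z} ],
   [/\ forall t, y t = phi t + conv 1 z t,
       forall t, y t = phi t + kappa * conv alpha (Gof y) t &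
       forall t, 0 < t -> z t = kappa * (G0 * ker alpha t + conv alpha (gof z) t) ],
   exists c b C, [/\ 0 < c, c <= 1, 0 < b,
       forall t, 0 < t -> `|z t| <= C * wt c b t &
       [/\ forall t, 0 < t -> {for t, continuous (gof z)},
        forall t, 0 < t -> `|gof z t| <= C * wt c b t &
        forall t, 0 < t -> Gof y t = G0 + conv 1 (gof z) t ]]
  & forall m, (forall u v, m <= u -> m <= v -> 0 <= A u + B v) ->
      (forall t, m <= phi t) -> forall t, m <= y t].
Proof.
have [z Hz] := zlim_ex; have vz := vel_limit Hz.
have [y Hy] := ylim_ex.
have yE : y = Yof z.
  apply/funext => t; have [t0|t0] := ltP 0 t; last first.
    rewrite Yof_le0//; apply: (@eq_of_half_pow R _ _ 0) => n.
    by have := Hy t n; rewrite pos_le0// mulr0 Yof_le0// distrC.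
  set C1 := 2 * pos (fun t => D * wt 1 bt t) t.
  set C2 := 2 * D' * qc 1 gm (2 * bt) * wt gm (2 * bt) t.
  apply: (@eq_of_half_pow R _ _ (C1 + C2)) => n.
  have h1 := Hy t n; rewrite -/C1 in h1.
  have h2 : `|Yof (zs n) t - Yof z t| <= C2 * 2 ^- n.
    have -> : Yof (zs n) t - Yof z t = conv 1 (fun s => zs n s - z s) t.
      have cn s : 0 < s -> {for s, continuous (zs n)}.
        by move=> s0; case: (vel_zs n) => h _ _; apply: h; left.
      have bn s : 0 < s -> `|zs n s| <= M * wt gm bt s by case: (vel_zs n) => _ _; apply.
      have cz s : 0 < s -> {for s, continuous z}.
        by move=> s0; case: vz => h _ _; apply: h; left.
      have bz s : 0 < s -> `|z s| <= M * wt gm bt s by case: vz => _ _; apply.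
      rewrite /Yof convB; first ring.
        exact: (adm_L1 (@ltr01 R) (lexx 1) gm0 gm1 bt0 cn bn).
      exact: (adm_L1 (@ltr01 R) (lexx 1) gm0 gm1 bt0 cz bz).
    rewrite [X in _ <= X](_ : _ = 2 * D' * 2 ^- n * qc 1 gm (2 * bt) * wt gm (2 * bt) t); last by rewrite /C2; ring.
    apply: (adm_bound (@ltr01 R) (lexx 1) gm0 gm1 bt20) => // s s0.
      apply: continuousB; last by case: vz => h _ _; apply: h; left.
      by case: (vel_zs n) => h _ _; apply: h; left.
    apply: le_trans (Hz s n) _; rewrite posE// le_eqVlt; apply/orP; left; apply/eqP; ring.
  rewrite mulrDl; exact: dist_tri h1 h2.
have zE : z = step z.
  apply/funext => t; have [t0|t0] := ltP 0 t; last first.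
    by have [_ h1 _] := vz; have [_ h2 _] := step_vel vz; rewrite h1// h2.
  set C1 := 2 * pos (fun t => D' * wt gm (2 * bt) t) t.
  set C2 := kappa * (2 * L * (2 * D' + 2 * D * M) * qc alpha gm (2 * bt)) * wt gm (2 * bt) t.
  apply: (@eq_of_half_pow R _ _ (C1 + C2)) => n.
  have h1 := Hz t n.+1; rewrite -/C1 in h1.
  have pn : 0 <= 2 ^- n :> R by rewrite invr_ge0 exprn_ge0.
  have h1' : C1 * 2 ^- n.+1 <= C1 * 2 ^- n.
    apply: ler_wpM2l; first by rewrite /C1 posE// mulr_ge0// mulr_ge0// wt_ge0.
    by rewrite exprS invfM ler_piMl// invf_le1// ler1n.
  have h2 : `|step (zs n) t - step z t| <= C2 * 2 ^- n.
    have dn : 0 <= 2 * D * 2 ^- n by apply: mulr_ge0 => //; apply: mulr_ge0.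
    have d'n : 0 <= 2 * D' * 2 ^- n by apply: mulr_ge0 => //; apply: mulr_ge0.
    have hY s : 0 < s -> `|Yof (zs n) s - Yof z s| <= 2 * D * 2 ^- n * wt 1 bt s.
      move=> s0; rewrite -yE; apply: le_trans (Hy s n) _; rewrite posE//.
      by rewrite le_eqVlt; apply/orP; left; apply/eqP; ring.
    have hZ s : 0 < s -> `|zs n s - z s| <= 2 * D' * 2 ^- n * wt gm (2 * bt) s.
      move=> s0; apply: le_trans (Hz s n) _; rewrite posE//.
      by rewrite le_eqVlt; apply/orP; left; apply/eqP; ring.
    have hg := gof_diff (vel_zs n) vz dn d'n hY hZ.
    apply: le_trans (step_diff (vel_zs n) vz hg t0) _.
    by rewrite /C2 le_eqVlt; apply/orP; left; apply/eqP; ring.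
  rewrite mulrDl; exact: dist_tri (le_trans h1 h1') h2.
exists y, z; split.
- split.
  + by move=> t t0; rewrite yE Yof_le0.
  + by rewrite yE; exact: Yof_continuous.
  + by move=> t tt; rewrite yE; exact: Yof_derive.
  + by case: vz.
- split.
  + by move=> t; rewrite yE.
  + by move=> t; rewrite {1}yE {1}zE (Yof_step vz) yE.
  + by move=> t t0; rewrite {1}zE /step (phi1_ge (ltW t0)) add0r.
- exists gm, bt, (M + 2 * L * M); have M2 : 0 <= 2 * L * M by apply: mulr_ge0 => //; apply: mulr_ge0.
  split=> //.
  + move=> t t0; case: vz => _ _ /(_ t t0)/le_trans; apply.
    by rewrite ler_wpM2r ?wt_ge0// lerDl.
  + split.
    * by move=> t t0; exact: gof_continuous.
    * move=> t t0; apply: le_trans (gof_bound vz t0) _.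
      by rewrite ler_wpM2r ?wt_ge0// lerDr.
    * by move=> t t0; rewrite yE; exact: Gof_primitive.
- move=> m AB mphi t.
  have hn n s : m <= Yof (zs n) s.
    elim: n s => [|n IH] s.
      by rewrite /Yof conv_eq0 ?addr0// => r r0 _; rewrite /= (phi1_ge (ltW r0)).
    rewrite /= (Yof_step (vel_zs n)); apply: (le_trans (mphi s)); rewrite lerDl.
    rewrite mulr_ge0 ?(ltW kappa0)//; apply: conv_ge0 => r _ _; exact: AB.
  apply: (@le_of_half_pow R _ _ (2 * pos (fun t => D * wt 1 bt t) t)) => n.
  have := Hy t n; rewrite ler_norml => /andP[_]; have := hn n t; lra.
Qed.
End Existence.

(** * From the integral equation to the Caputo derivative *)
Section CaputoBridge.
Context {R : realType}.
Implicit Types (p q c b t s : R) (f g h x y z : R -> R).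

Lemma Gamma_gam p : Gamma p = gam p.
Proof.
rewrite /Gamma /gam Rintegral_mkcond; apply: Int_ext => s.
by rewrite patchE mem_setE in_itv/= andbT /ker; case: (ltP 0 s) => s0; rewrite ?mul0r.
Qed.

Lemma beta_gt0 p q : 0 < p -> p <= 1 -> 0 < q -> q <= 1 -> 0 < conv p (ker q) 1.
Proof.
move=> p0 p1 q0 q1.
have l : L1 (fun s => ker p (1 - s) * pos (ker q) s).
  by apply: L1_ext (L1_conv_ker 1 p0 p1 q0 q1) => s; rewrite pos_ker.
apply: (Int_gt0 (a := 0) (b := 1) (c := 1)) => //.
  by move=> s; rewrite pos_ker mulr_ge0 ?ker_ge0.
have k1 r w : 0 < r -> r <= 1 -> w <= 1 -> 1 <= ker w r.
  move=> r0 r1 w1; rewrite -[X in X <= _](_ : ker w 1 = 1); first exact: ker_dec.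
  by rewrite kerE// powR1.
move=> s /andP[s0 s1]; rewrite pos_ker -[X in X <= _]mulr1.
apply: ler_pM => //; apply: k1 => //; last exact: ltW.
  by rewrite subr_gt0.
by rewrite lerBlDr lerDl ltW.
Qed.

(** The constant that makes [conv p] the inverse of the Caputo derivative. The
    denominator is the Beta function at (1 - p, p), which keeps Abel's inversion
    an identity between integrals; the quotient is [1 / Gamma p]. *)
Definition kap p : R := if p == 1 then 1 else Gamma (1 - p) / conv (1 - p) (ker p) 1.

Lemma kap_gt0 p : 0 < p -> p <= 1 -> 0 < kap p.
Proof.
move=> p0 p1; rewrite /kap; case: eqVneq => // pn1.
have p10 : 0 < 1 - p by rewrite subr_gt0 lt_neqAle pn1.
have p11 : 1 - p <= 1 by rewrite lerBlDr lerDl ltW.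
by rewrite divr_gt0 ?beta_gt0// Gamma_gam gam_gt0.
Qed.

Lemma patch_conv p g t : (fun s => (t - s) `^ (p - 1) * g s) \_ `]0, t[ =1
  (fun s => ker p (t - s) * pos g s).
Proof.
move=> s; rewrite patchE mem_setE in_itv/= /pos /ker subr_gt0.
by case: (ltP 0 s) => s0; case: (ltP s t) => st; rewrite ?mulr0 ?mul0r.
Qed.

Section Solution.
Variables (alpha tau : R) (A A1 B B1 phi y z : R -> R) (c b C : R).
Hypotheses (al0 : 0 < alpha) (al1 : alpha <= 1) (tau0 : 0 <= tau).
Let kappa := kap alpha.
Let G0 := A (phi (- tau)) + B (phi 0).
Hypothesis phi_ge : forall t, 0 <= t -> phi t = phi 0.
Hypothesis y_le0 : forall t, t <= 0 -> y t = phi t.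
Hypothesis dy : forall t, 0 < t -> is_derive t 1 y (z t).
Hypothesis cz : forall t, 0 < t -> {for t, continuous z}.
Hypothesis yz : forall t, y t = phi t + conv 1 z t.
Let g := gof tau A1 B1 phi z.
Hypothesis zE : forall t, 0 < t -> z t = kappa * (G0 * ker alpha t + conv alpha g t).
Hypotheses (c0 : 0 < c) (c1 : c <= 1) (b0 : 0 < b).
Hypothesis zC : forall t, 0 < t -> `|z t| <= C * wt c b t.
Hypothesis cg : forall t, 0 < t -> {for t, continuous g}.
Hypothesis gC : forall t, 0 < t -> `|g t| <= C * wt c b t.
Hypothesis GE : forall t, 0 < t -> Gof tau A B y t = G0 + conv 1 g t.
Variable xs : R.

Let x t := y t + xs.

Lemma derive1_solution t : 0 < t -> derive1 x t = z t.
Proof.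
move=> t0; rewrite derive1E.
have d := dy t0.
have dc : is_derive t 1 (cst xs : R -> R) 0 by exact: is_derive_cst.
by have := is_deriveD d dc; rewrite addr0 => -[_ <-].
Qed.

Lemma derivable_solution t : 0 < t -> derivable x t 1.
Proof.
move=> t0; have d := dy t0.
have dc : is_derive t 1 (cst xs : R -> R) 0 by exact: is_derive_cst.
by have := is_deriveD d dc; rewrite addr0 => -[h _].
Qed.

Let restrict_integral p t f : 0 < p -> p <= 1 ->
  (forall s, 0 < s -> s < t -> f s = (t - s) `^ (p - 1) * z s) ->
  (@lebesgue_measure R).-integrable `]0, t[ (EFin \o f) /\
  \int[@lebesgue_measure R]_(s in `]0, t[) f s = conv p z t.
Proof.
move=> p0 p1 fE.
have l := adm_L1 p0 p1 c0 c1 b0 cz zC t.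
have E : f \_ `]0, t[ =1 (fun s => ker p (t - s) * pos z s).
  move=> s; rewrite -patch_conv !patchE mem_setE in_itv/=.
  by case: ifP => // /andP[s0 st]; rewrite fE.
split; last by rewrite Rintegral_mkcond; exact: Int_ext.
apply/(integrable_mkcond _ _).2 => //.
by rewrite restrict_EFin (funext E).
Qed.

Lemma solution_ac T : locally_ac T x.
Proof.
move=> t /andP[t0 tT].
have [|i1 i2] := @restrict_integral 1 t (derive1 x) (@ltr01 R) (lexx 1).
  by move=> s s0 st; rewrite derive1_solution// subrr powRr0 mul1r.
split=> //; rewrite i2 /x (y_le0 (lexx 0)) yz (phi_ge (ltW t0)).
by rewrite addrAC.
Qed.

(** Abel's inversion applied to the velocity equation recovers the right-hand
    side from its derivative. *)
Lemma solution_caputo t : 0 < t ->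
  caputo_derivable alpha x t /\ caputo alpha x t = Gof tau A B y t.
Proof.
move=> t0; rewrite /caputo_derivable /caputo.
have [a1|an1] := eqVneq alpha 1.
  split; first exact: derivable_solution.
  rewrite derive1_solution// zE// GE// /kappa /kap a1 eqxx mul1r ker1//.
  by rewrite mulr1.
have p10 : 0 < 1 - alpha by rewrite subr_gt0 lt_neqAle an1.
have p11 : 1 - alpha <= 1 by rewrite lerBlDr lerDl ltW.
have [|i1 i2] := @restrict_integral (1 - alpha) t (caputo_integrand alpha x t) p10 p11.
  move=> s s0 st; rewrite /caputo_integrand derive1_solution//.
  by congr (_ `^ _ * _); ring.
split=> //; rewrite i2.
have lk : L1 (fun s => ker (1 - alpha) (t - s) * pos (ker alpha) s).
  by apply: L1_ext (L1_conv_ker t p10 p11 al0 al1) => s; rewrite pos_ker.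
have ca := adm_continuous al0 al1 c0 c1 b0 cg gC.
have ba := adm_bound al0 al1 c0 c1 b0 cg gC.
have lc := adm_L1 p10 p11 c0 c1 b0 ca ba t.
have lkG : L1 (fun s => ker (1 - alpha) (t - s) * pos (fun s => G0 * ker alpha s) s).
  apply: L1_ext (L1Z G0 lk) => s; rewrite /pos; case: ifP => _; ring.
have -> : conv (1 - alpha) z t = kappa * (G0 * conv (1 - alpha) (ker alpha) t +
    conv (1 - alpha) (conv alpha g) t).
  rewrite -(convZ _ lk) -convD// -convZ; last first.
    apply: L1_ext (L1D lkG lc) => s; rewrite /pos; case: ifP => _; ring.
  by apply: conv_ext => s s0 _; rewrite zE.
rewrite (conv_abel c0 c1 b0 cg gC _ p10 al0); last by rewrite subrK.
rewrite conv_ker_scale// subrK subrr powRr0 mul1r GE//.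
have B0 := beta_gt0 p10 p11 al0 al1.
have Ga0 : 0 < Gamma (1 - alpha) by rewrite Gamma_gam gam_gt0.
rewrite /kappa /kap (negbTE an1).
move: (conv (1 - alpha) (ker alpha) 1) (conv 1 g t) B0 Ga0 => u v u0; move: (Gamma _) => w w0.
by field; rewrite !gt_eqF.
Qed.

Lemma solution_correct F T :
  (forall t, 0 < t -> t < T -> F (x (t - tau)) (x t) = Gof tau A B y t) ->
  is_solution alpha tau F (fun t => phi t + xs) T x.
Proof.
move=> FE; split.
- by move=> t /andP[_ t0]; rewrite /x y_le0.
- exact: solution_ac.
- by move=> t /andP[t0 tT]; rewrite FE//; exact: solution_caputo.
Qed.
End Solution.

Lemma constant_is_equilibrium alpha tau (F : R -> R -> R) xs : F xs xs = 0 ->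
  is_equilibrium alpha tau F xs.
Proof.
move=> F0 T T0.
have d0 : derive1 (fun=> xs : R) = fun=> 0.
  by apply/funext => s; rewrite derive1_cst.
split=> //.
- move=> t _; rewrite d0; split; first exact: integrable0.
  by rewrite /Rintegral integral0 addr0.
- move=> t _; rewrite F0 /caputo_derivable /caputo.
  have i0 : caputo_integrand alpha (fun=> xs) t = fun=> 0.
    by apply/funext => s; rewrite /caputo_integrand d0 mulr0.
  case: ifP => _; first by rewrite d0.
  by rewrite i0; split; [exact: integrable0|rewrite /Rintegral integral0 mulr0].
Qed.

Lemma init_norm_lt tau (f : R -> R) r rho : r < rho ->
  (forall t, `|f t| <= r) -> (init_norm tau f < rho%:E)%E.
Proof.
move=> rr fr; apply: (@le_lt_trans _ _ r%:E); last by rewrite lte_fin.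
by apply: ge_ereal_sup => _ [t _ <-]; rewrite lee_fin.
Qed.
End CaputoBridge.

(** * Cutoff functions *)
Section Cutoffs.
Context {R : realType}.
Implicit Types (u v s t r : R).

Lemma is_derive_conv (f g : R -> R) (t d d' : R) : f =1 g -> d = d' ->
  is_derive t 1 f d -> is_derive t 1 g d'.
Proof. by move=> /funext -> ->. Qed.

Lemma is_derive_affine (f : R -> R) (k l u d : R) : is_derive (k * u + l) 1 f d ->
  is_derive u 1 (fun x => f (k * x + l)) (d * k).
Proof.
move=> df; have d1 : is_derive u 1 (fun x : R => k * x + l) k.
  have := is_deriveD (is_deriveZ k (is_derive_id u (1:R))) (is_derive_cst l u (1:R)).
  by rewrite /GRing.scale/= mulr1 addr0.
exact: (@is_derive1_comp _ f (fun x : R => k * x + l) u _ _ df d1).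
Qed.

Lemma affine_continuous (k l : R) : continuous (fun x : R => k * x + l).
Proof.
move=> x; apply: continuousD; last exact: cst_continuous.
by apply: continuousM => //; exact: cst_continuous.
Qed.

Definition ramp s : R := Num.max s 0.
Definition sqramp s : R := ramp s * ramp s.

Lemma rampE s : 0 <= s -> ramp s = s.
Proof. by move=> s0; rewrite /ramp max_l. Qed.

Lemma ramp_le0 s : s <= 0 -> ramp s = 0.
Proof. by move=> s0; rewrite /ramp max_r. Qed.

Lemma ramp_lip s t : `|ramp s - ramp t| <= `|s - t|.
Proof.
have [s0|s0] := leP 0 s; have [t0|t0] := leP 0 t.
- by rewrite !rampE.
- by rewrite rampE// (ramp_le0 (ltW t0)) !ger0_norm; lra.
- by rewrite (ramp_le0 (ltW s0)) rampE// !ler0_norm; lra.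
- by rewrite !(ramp_le0 (ltW _))// subrr normr0.
Qed.

Lemma ramp_continuous : continuous ramp.
Proof.
move=> s; apply/cvgrPdist_lt => e e0; near=> t.
apply: le_lt_trans (ramp_lip s t) _.
by near: t; exact: cvgr_dist_lt e0.
Unshelve. all: by end_near. Qed.

Lemma sqramp_derive s : is_derive s 1 sqramp (2 * ramp s).
Proof.
have [s0|s0|<-] := ltgtP 0 s.
- rewrite (rampE (ltW s0)).
  have h : is_derive s 1 (fun x : R => x * x) (2 * s).
    have := is_deriveM (is_derive_id s (1:R)) (is_derive_id s (1:R)).
    by rewrite /GRing.scale/= mulr1 -mulr2n mulr_natl.
  apply: near_eq_is_derive h; near=> t; rewrite /sqramp rampE// ltW//.
  by near: t; exact: lt_nbhsr.
- rewrite (ramp_le0 (ltW s0)) mulr0.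
  have h : is_derive s 1 (cst 0 : R -> R) 0 by exact: is_derive_cst.
  apply: near_eq_is_derive h; near=> t.
  rewrite /sqramp (ramp_le0 (ltW _)) ?mulr0//.
  by near: t; exact: lt_nbhsl.
rewrite (ramp_le0 (lexx 0)) mulr0.
have H : (fun h : R => h^-1 *: (sqramp (h *: (1:R) + 0) - sqramp 0)) @ 0^' --> (0:R).
  apply/cvgrPdist_lt => e e0; near=> h.
  have h0 : h != 0 by near: h; exact: nbhs_dnbhs_neq.
  rewrite /GRing.scale/= mulr1 addr0 /sqramp (ramp_le0 (lexx 0)) mulr0 subr0 sub0r.
  rewrite normrN mulrA normrM.
  have rh : `|ramp h| <= `|h|.
    by have := ramp_lip h 0; rewrite (ramp_le0 (lexx 0)) !subr0.
  have h1 : `|h^-1 * ramp h| <= 1.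
    by rewrite normrM normfV mulrC ler_pdivrMr ?mul1r// normr_gt0.
  apply: (@le_lt_trans _ _ (1 * `|h|)); first exact: ler_pM.
  rewrite mul1r; near: h; exact: dnbhs0_lt.
split; first by apply/cvg_ex; exists 0.
by apply/cvg_lim.
Unshelve. all: by end_near. Qed.

(** a C^1 truncation: the identity on [-1, 1], constant beyond [-2, 2] *)
Definition trunc1 u : R := u - (sqramp (u - 1) - sqramp (u - 2)) / 2
  + (sqramp (- u - 1) - sqramp (- u - 2)) / 2.

Definition trunc1' u : R := 1 - (ramp (u - 1) - ramp (u - 2))
  - (ramp (- u - 1) - ramp (- u - 2)).

Lemma trunc1_derive (u : R) : is_derive u 1 trunc1 (trunc1' u).
Proof.
have dq (k l : R) := @is_derive_affine sqramp k l u _ (sqramp_derive (k * u + l)).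
have d := is_deriveD (is_deriveB (is_derive_id u (1:R))
  (is_deriveZ 2^-1 (is_deriveB (dq 1 (-1)) (dq 1 (-2)))))
  (is_deriveZ 2^-1 (is_deriveB (dq (-1) (-1)) (dq (-1) (-2)))).
apply: is_derive_conv d.
  move=> x; rewrite /trunc1 !fctE/= /GRing.scale/= !mul1r !mulN1r.
  ring.
rewrite /trunc1' /GRing.scale/= !mul1r !mulN1r.
move: (ramp (u - 1)) (ramp (u - 2)) (ramp (- u - 1)) (ramp (- u - 2)) => p q v w.
by field.
Qed.

Lemma trunc1_id u : `|u| <= 1 -> trunc1 u = u.
Proof.
rewrite ler_norml => /andP[u1 u2]; rewrite /trunc1 /sqramp.
by rewrite !ramp_le0 ?(mulr0,subrr,subr0,mul0r,addr0); lra.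
Qed.

Lemma trunc1N u : trunc1 (- u) = - trunc1 u.
Proof. by rewrite /trunc1 opprK; ring. Qed.

Lemma trunc1_ge0 u : 0 <= u -> 0 <= trunc1 u <= 2.
Proof.
move=> u0; rewrite /trunc1 /sqramp.
rewrite (@ramp_le0 (- u - 1)); last lra.
rewrite (@ramp_le0 (- u - 2)); last lra.
rewrite mulr0 subrr mul0r addr0.
have [u1|u1] := leP u 1; first by rewrite !ramp_le0; lra.
rewrite (@rampE (u - 1)); last lra.
have [u2|u2] := leP u 2; first by rewrite ramp_le0; [nra|lra].
by rewrite rampE; [nra|lra].
Qed.

Lemma trunc1_le u : `|trunc1 u| <= 2.
Proof.
have [u0|u0] := leP 0 u.
  by have /andP[h1 h2] := trunc1_ge0 u0; rewrite ger0_norm.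
have : 0 <= - u by lra.
move=> /trunc1_ge0 /andP[h1 h2]; move: h1 h2; rewrite trunc1N => h1 h2.
by rewrite ler0_norm//; lra.
Qed.

Lemma ramp_mono s t : s <= t -> ramp s <= ramp t.
Proof.
move=> st; have [s0|s0] := leP 0 s; have [t0|t0] := leP 0 t.
- by rewrite !rampE.
- by lra.
- by rewrite (ramp_le0 (ltW s0)) rampE.
- by rewrite !(ramp_le0 (ltW _)).
Qed.

Lemma trunc1'_le u : `|trunc1' u| <= 3.
Proof.
have h (v : R) : 0 <= ramp (v - 1) - ramp (v - 2) <= 1.
  have := @ramp_mono (v - 2) (v - 1); have := ramp_lip (v - 1) (v - 2).
  rewrite (_ : v - 1 - (v - 2) = 1); last ring.
  rewrite normr1 ler_norml => /andP[_ h1] /(_ _); rewrite lerD2l lerN2 ler1n => /(_ isT); lra.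
have := h u; have := h (- u); rewrite /trunc1' ler_norml.
move: (ramp _ - _) (ramp _ - _) => a b; lra.
Qed.

Lemma trunc1'_lip u v : `|trunc1' u - trunc1' v| <= 4 * `|u - v|.
Proof.
have h1 := ramp_lip (u - 1) (v - 1); have h2 := ramp_lip (u - 2) (v - 2).
have h3 := ramp_lip (- u - 1) (- v - 1); have h4 := ramp_lip (- u - 2) (- v - 2).
have e k : u - k - (v - k) = u - v by ring.
have e' k : - u - k - (- v - k) = - (u - v) by ring.
move: h1 h2 h3 h4; rewrite !e !e' normrN /trunc1'.
move: (ramp (u - 1)) (ramp (u - 2)) (ramp (- u - 1)) (ramp (- u - 2)) => a1 a2 a3 a4.
move: (ramp (v - 1)) (ramp (v - 2)) (ramp (- v - 1)) (ramp (- v - 2)) => b1 b2 b3 b4.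
rewrite !ler_norml; move: `|_| => d; lra.
Qed.

(** Bounding the function as well as its derivative makes the class closed under
    products, hence stable under polynomials of a truncated variable. *)
Definition bc11 (f f1 : R -> R) := exists K : R,
  [/\ forall u : R, is_derive u 1 f (f1 u), forall u, `|f u| <= K,
      forall u, `|f1 u| <= K & forall u v, `|f1 u - f1 v| <= K * `|u - v|].

Lemma bc11Z k f f1 : bc11 f f1 -> bc11 (fun u => k * f u) (fun u => k * f1 u).
Proof.
move=> [K [d h1 h2 h3]]; exists (`|k| * K); split.
- by move=> u; have := is_deriveZ k (d u).
- by move=> u; rewrite normrM ler_wpM2l.
- by move=> u; rewrite normrM ler_wpM2l.
- by move=> u v; rewrite -mulrBr normrM -mulrA ler_wpM2l.
Qed.

Lemma bc11D f f1 g g1 : bc11 f f1 -> bc11 g g1 ->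
  bc11 (fun u => f u + g u) (fun u => f1 u + g1 u).
Proof.
move=> [K [d h1 h2 h3]] [K' [d' h1' h2' h3']]; exists (K + K'); split.
- by move=> u; have := is_deriveD (d u) (d' u).
- by move=> u; apply: le_trans (ler_normD _ _) (lerD _ _).
- by move=> u; apply: le_trans (ler_normD _ _) (lerD _ _).
- move=> u v; rewrite opprD addrACA mulrDl.
  exact: le_trans (ler_normD _ _) (lerD _ _).
Qed.

Lemma bc11M f f1 g g1 : bc11 f f1 -> bc11 g g1 ->
  bc11 (fun u => f u * g u) (fun u => f u * g1 u + g u * f1 u).
Proof.
move=> [K [d h1 h2 h3]] [K' [d' h1' h2' h3']].
have K0 : 0 <= K by exact: le_trans (normr_ge0 _) (h1 0).
have K0' : 0 <= K' by exact: le_trans (normr_ge0 _) (h1' 0).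
have l1 := lipschitz_of_derive d h2; have l2 := lipschitz_of_derive d' h2'.
exists (4 * (K * K')).
have KK : 0 <= K * K' by rewrite mulr_ge0.
have mm (a b e e' : R) : `|a| <= e -> `|b| <= e' -> `|a * b| <= e * e'.
  by move=> ha hb; rewrite normrM; exact: ler_pM.
split.
- by move=> u; have := is_deriveM (d u) (d' u).
- by move=> u; apply: le_trans (mm _ _ _ _ (h1 u) (h1' u)) _; lra.
- move=> u; apply: le_trans (ler_normD _ _) _.
  have := mm _ _ _ _ (h1 u) (h2' u); have := mm _ _ _ _ (h1' u) (h2 u); lra.
- move=> u v.
  rewrite (_ : _ - _ = ((f u - f v) * g1 u + f v * (g1 u - g1 v)) +
     ((g u - g v) * f1 u + g v * (f1 u - f1 v))); last by ring.
  have a1 := mm _ _ _ _ (l1 u v) (h2' u); have a2 := mm _ _ _ _ (h1 v) (h3' u v).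
  have a3 := mm _ _ _ _ (l2 u v) (h2 u); have a4 := mm _ _ _ _ (h1' v) (h3 u v).
  apply: le_trans (ler_normD _ _) _.
  apply: le_trans (lerD (ler_normD _ _) (ler_normD _ _)) _.
  have -> : 4 * (K * K') * `|u - v| = K * `|u - v| * K' + K * (K' * `|u - v|) +
     (K' * `|u - v| * K + K' * (K * `|u - v|)) by ring.
  by apply: lerD; exact: lerD.
Qed.

Definition trunc r u : R := r * trunc1 (r^-1 * u + 0).

Lemma trunc_bc11 r : 0 < r -> bc11 (trunc r) (fun u => trunc1' (r^-1 * u + 0)).
Proof.
move=> r0; have ri : 0 < r^-1 by rewrite invr_gt0.
exists (2 * r + 3 + 4 * r^-1); split.
- move=> u.
  have := is_deriveZ r (@is_derive_affine trunc1 r^-1 0 u _ (trunc1_derive _)).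
  rewrite /GRing.scale/= (mulrC r) mulfVK ?gt_eqF//.
- move=> u; rewrite normrM gtr0_norm//; have := trunc1_le (r^-1 * u + 0).
  rewrite -(ler_pM2l r0); lra.
- move=> u; have := trunc1'_le (r^-1 * u + 0); lra.
- move=> u v; apply: le_trans (trunc1'_lip _ _) _.
  rewrite (_ : _ - _ = r^-1 * (u - v)); last by ring.
  rewrite normrM gtr0_norm// mulrA ler_wpM2r//; lra.
Qed.

Lemma trunc_id r u : 0 < r -> `|u| <= r -> trunc r u = u.
Proof.
move=> r0 ur; rewrite /trunc addr0 trunc1_id ?mulrA ?mulfV ?gt_eqF// ?mul1r//.
by rewrite normrM gtr0_norm ?invr_gt0// mulrC ler_pdivrMr// mul1r.
Qed.

Lemma trunc_ge0 r u : 0 < r -> 0 <= u -> 0 <= trunc r u <= 2 * r.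
Proof.
move=> r0 u0; have /trunc1_ge0 /andP[h1 h2] : 0 <= r^-1 * u + 0.
  by rewrite addr0 mulr_ge0// invr_ge0 ltW.
by rewrite /trunc mulr_ge0 ?(ltW r0)//= mulrC ler_pM2r.
Qed.

Definition smoothstep s : R := (sqramp s + - 2 * sqramp (s - 1) + sqramp (s - 2)) / 2.
Definition smoothstep' s : R := ramp s - 2 * ramp (s - 1) + ramp (s - 2).

Lemma smoothstep_derive s : is_derive s 1 smoothstep (smoothstep' s).
Proof.
have dq (l : R) := @is_derive_affine sqramp 1 l s _ (sqramp_derive (1 * s + l)).
have d := is_deriveZ 2^-1 (is_deriveD (is_deriveD (dq 0) (is_deriveZ (-2) (dq (-1)))) (dq (-2))).
apply: is_derive_conv d.
  by move=> x; rewrite /smoothstep !fctE/= /GRing.scale/= !mul1r addr0 mulrC.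
rewrite /smoothstep' /GRing.scale/= !mul1r addr0.
move: (ramp s) (ramp (s - 1)) (ramp (s - 2)) => p q v; by field.
Qed.

Lemma smoothstep'_continuous : continuous smoothstep'.
Proof.
move=> s; have rc (k : R) : {for s, continuous (fun x => ramp (x - k))}.
  apply: continuous_comp; last exact: ramp_continuous.
  by apply: continuousB => //; exact: cst_continuous.
apply: cvgD (rc 2); apply: cvgB; first exact: ramp_continuous.
by apply: cvgM (rc 1); exact: cvg_cst.
Qed.

Lemma smoothstep_le0 s : s <= 0 -> smoothstep s = 0 /\ smoothstep' s = 0.
Proof. by move=> s0; rewrite /smoothstep /smoothstep' /sqramp !ramp_le0; lra. Qed.

Lemma smoothstep_ge2 s : 2 <= s -> smoothstep s = 1 /\ smoothstep' s = 0.
Proof. by move=> s2; rewrite /smoothstep /smoothstep' /sqramp !rampE; lra. Qed.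

Lemma smoothstep_01 s : 0 <= smoothstep s <= 1.
Proof.
have [s0|s0] := leP s 0; first by rewrite (smoothstep_le0 s0).1 lexx ler01.
have [s2|s2] := leP 2 s; first by rewrite (smoothstep_ge2 s2).1 ler01 lexx.
rewrite /smoothstep /sqramp (@ramp_le0 (s - 2)); last lra.
rewrite (rampE (ltW s0)); have [s1|s1] := leP s 1.
  by rewrite ramp_le0; [nra|lra].
by rewrite rampE; [nra|lra].
Qed.

Lemma smoothstep'_le s : `|smoothstep' s| <= 1.
Proof.
have [s0|s0] := leP s 0; first by rewrite (smoothstep_le0 s0).2 normr0.
have [s2|s2] := leP 2 s; first by rewrite (smoothstep_ge2 s2).2 normr0.
rewrite /smoothstep' (@ramp_le0 (s - 2)); last lra.
rewrite (rampE (ltW s0)) ler_norml; have [s1|s1] := leP s 1.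
  by rewrite ramp_le0; lra.
by rewrite rampE; lra.
Qed.

Lemma smoothstep_mid s : 3 / 2 <= s -> 1 / 2 <= smoothstep s.
Proof.
move=> s1; have [s2|s2] := leP 2 s; first by rewrite (smoothstep_ge2 s2).1; lra.
rewrite /smoothstep /sqramp (@ramp_le0 (s - 2)); last lra.
by rewrite !rampE; [nra|lra|lra].
Qed.
End Cutoffs.

(** * Data, solutions and confinement *)
Section GlobalSolutions.
Context {R : realType}.
Implicit Types (s t u v r : R) (y z phi : R -> R).

(** right-hand sides for which the equation is globally solvable *)
Definition c11 (f f1 : R -> R) := exists K : R,
  [/\ forall u : R, is_derive u 1 f (f1 u), forall u, `|f1 u| <= K &
      forall u v, `|f1 u - f1 v| <= K * `|u - v|].

Lemma bc11_c11 f f1 : bc11 f f1 -> c11 f f1.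
Proof. by move=> [K [d _ h2 h3]]; exists K. Qed.

Lemma linear_c11 k : c11 (fun u => k * u) (fun=> k).
Proof.
exists `|k|; split=> //.
- move=> u; have := is_deriveZ k (is_derive_id u (1:R)).
  by rewrite /GRing.scale/= mulr1.
- by move=> u v; rewrite subrr normr0 mulr_ge0.
Qed.

(** Data are given on the whole line, as C^1 functions frozen from time 0 on.
    Without delay only constants make sense: the past is then invisible to the
    equation. *)
Definition datum (tau : R) (phi phi1 : R -> R) :=
  [/\ forall t : R, is_derive t 1 phi (phi1 t), continuous phi1,
      exists M : R, forall t, `|phi t| <= M /\ `|phi1 t| <= M,
      forall t, 0 <= t -> phi t = phi 0 /\ phi1 t = 0 &
      tau = 0 -> forall t, phi t = phi 0 /\ phi1 t = 0].

(** With a delay, the right-hand side has to vanish at time 0 for the velocity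
    to stay bounded there; otherwise solutions of order alpha < 1 lose their
    regularity at the multiples of the delay. *)
Definition compatible (tau : R) (A B phi : R -> R) :=
  0 < tau -> A (phi (- tau)) + B (phi 0) = 0.

(** the integral equation behind D^alpha y = A (y (t - tau)) + B (y t) *)
Definition mild (alpha tau : R) (A B phi y : R -> R) :=
  [/\ forall t, t <= 0 -> y t = phi t, continuous y &
      forall t, y t = phi t + kap alpha * conv alpha (Gof tau A B y) t].

Lemma global_solution (alpha tau : R) (A A1 B B1 phi phi1 : R -> R) :
  0 < alpha -> alpha <= 1 -> 0 <= tau -> c11 A A1 -> c11 B B1 ->
  datum tau phi phi1 -> compatible tau A B phi ->
  exists y z : R -> R, [/\ mild alpha tau A B phi y,
    0 < tau -> (forall t : R, is_derive t 1 y (z t)) /\ continuous z,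
    forall F xs T,
      (forall t, 0 < t -> t < T -> F (y (t - tau) + xs) (y t + xs) = Gof tau A B y t) ->
      is_solution alpha tau F (fun t => phi t + xs) T (fun t => y t + xs) &
    forall m, (forall u v, m <= u -> m <= v -> 0 <= A u + B v) ->
      (forall t, m <= phi t) -> forall t, m <= y t].
Proof.
move=> al0 al1 tau0 [KA [dA A1K A1l]] [KB [dB B1K B1l]] [dphi cphi1 [M phiM] phi_ge phi_c] co.
have KA0 : 0 <= KA by exact: le_trans (normr_ge0 _) (A1K 0).
have KB0 : 0 <= KB by exact: le_trans (normr_ge0 _) (B1K 0).
pose L := KA + KB.
have A1L u : `|A1 u| <= L by apply: le_trans (A1K u) _; rewrite lerDl.
have B1L u : `|B1 u| <= L by apply: le_trans (B1K u) _; rewrite lerDr.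
have A1Lip u v : `|A1 u - A1 v| <= L * `|u - v|.
  by apply: le_trans (A1l u v) _; rewrite ler_wpM2r// lerDl.
have B1Lip u v : `|B1 u - B1 v| <= L * `|u - v|.
  by apply: le_trans (B1l u v) _; rewrite ler_wpM2r// lerDr.
have k0 := kap_gt0 al0 al1.
have co' : tau = 0 /\ (forall t, phi t = phi 0) /\ (forall t, phi1 t = 0)
  \/ 0 < tau /\ A (phi (- tau)) + B (phi 0) = 0.
  have [t0|tn0] := eqVneq tau 0.
    by left; split=> //; split=> t; have [] := phi_c t0 t.
  have tp : 0 < tau by rewrite lt_neqAle eq_sym tn0.
  by right; split=> //; exact: co.
have phi1_ge t : 0 <= t -> phi1 t = 0 by case/phi_ge.
have [y [z [[yn cy dy cz] [yz yE zE] [c [b [C [c0 c1 b0 zC [cg gC GE]]]]] yp]]] :=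
  @delay_equation_solution R alpha tau (kap alpha) A A1 B B1 phi phi1 L M al0 al1 tau0 k0
   dA dB A1L B1L A1Lip B1Lip dphi cphi1 (fun t => (phiM t).1) (fun t => (phiM t).2)
   phi1_ge co'.
exists y, z; split=> //.
- by move=> tp; split=> t; [apply: dy; right|apply: cz; right].
- move=> F xs T FE.
  apply: (@solution_correct R alpha tau A A1 B B1 phi y z c b C) => //.
  + by move=> t /phi_ge[].
  + by move=> t t0; apply: dy; left.
  + by move=> t t0; apply: cz; left.
Qed.

Lemma first_hit (g : R -> R) t1 : continuous g -> g 0 < 0 -> 0 <= t1 -> 0 <= g t1 ->
  exists t, [/\ 0 < t, t <= t1, g t = 0 & forall s, 0 <= s -> s < t -> g s < 0].
Proof.
move=> cg g0 t10 gt1.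
pose E := [set t | 0 <= t /\ 0 <= g t].
have E0 : E !=set0 by exists t1.
have lbE : has_lbound E by exists 0 => x [].
have hi : has_inf E by [].
pose t := inf E.
have t0 : 0 <= t by apply: lb_le_inf => // x [].
have below s : 0 <= s -> s < t -> g s < 0.
  move=> s0 st; rewrite ltNge; apply/negP => gs.
  by have : t <= s; [apply: ge_inf => //; split|rewrite leNgt st].
have gt0 : g t <= 0.
  rewrite leNgt; apply/negP => gp.
  have tp : 0 < t by rewrite lt_neqAle t0 andbT; apply/eqP => E'; move: gp; rewrite -E'; lra.
  have /cvgrPdist_lt/(_ _ gp)[e /= e0 He] := cg t.
  pose s := Num.max (t / 2) (t - e / 2).
  have s0 : 0 <= s by rewrite le_max divr_ge0.
  have st : s < t by rewrite gt_max; apply/andP; split; lra.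
  have ts : `|t - s| < e.
    rewrite gtr0_norm ?subr_gt0// ltrBlDr -ltrBlDl lt_max; apply/orP; right; lra.
  have := He s ts; have := below s s0 st; rewrite ltr_norml; lra.
have gtp : 0 <= g t.
  rewrite leNgt; apply/negP => gn.
  have gn' : 0 < - g t by rewrite oppr_gt0.
  have /cvgrPdist_lt/(_ _ gn')[e /= e0 He] := cg t.
  have te : inf E < t + e by rewrite ltrDl.
  have [x [x0 gx] xt] := inf_lt E0 te.
  have tx : t <= x by apply: ge_inf.
  have := He x; rewrite /= distrC ger0_norm ?subr_ge0// ltrBlDl => /(_ xt).
  rewrite ltr_norml; lra.
exists t; split.
- by rewrite lt_neqAle t0 andbT; apply/eqP => E'; move: gtp; rewrite -E'; lra.
- by apply: ge_inf.
- by apply/eqP; rewrite eq_le gt0.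
- exact: below.
Qed.

Section Stability.
Variables (alpha tau : R) (F : R -> R -> R) (xs r : R) (A B : R -> R).
Hypothesis FE : forall u v, `|u| <= r -> `|v| <= r -> (tau = 0 -> u = v) ->
  F (u + xs) (v + xs) = A u + B v.

(** Stability confines every solution of the truncated equation to the region
    where the truncation is inactive: up to its first exit it solves the
    original equation. *)
Lemma stable_confines eta : 0 <= tau -> 0 < eta -> eta < r -> stable alpha tau F xs ->
  exists2 rho, 0 < rho & forall phi y, (forall t, `|phi t| <= rho) ->
    (forall t, t <= 0 -> y t = phi t) -> continuous y ->
    (forall F xs T,
      (forall t, 0 < t -> t < T -> F (y (t - tau) + xs) (y t + xs) = Gof tau A B y t) ->
      is_solution alpha tau F (fun t => phi t + xs) T (fun t => y t + xs)) ->
    forall t, `|y t| < eta.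
Proof.
move=> tau0 eta0 etar st; have [rho rho0 H] := st eta eta0.
pose rho' := Num.min (rho / 2) (eta / 2).
have r'0 : 0 < rho' by rewrite lt_min; apply/andP; split; lra.
have r'1 : rho' < rho by rewrite gt_min; apply/orP; left; lra.
have r'2 : rho' < eta by rewrite gt_min; apply/orP; right; lra.
exists rho' => // phi y phir yphi cy sol t.
have yneg s : s <= 0 -> `|y s| < eta by move=> s0; rewrite yphi//; exact: le_lt_trans r'2.
have [t0|t0] := leP t 0; first exact: yneg.
rewrite ltNge; apply/negP => yt.
have cg : continuous (fun s => `|y s| - eta).
  by move=> s; apply: cvgB; [exact: cvg_norm (cy s)|exact: cvg_cst].
have [||//|t' [t'0 _ E below]] := first_hit cg (t1 := t).
- by rewrite subr_lt0; exact: yneg.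
- exact: ltW.
- by rewrite subr_ge0.
have /cvgrPdist_lt/(_ (r - eta))[|e /= e0 He] := cg t'; first by rewrite subr_gt0.
have yr s : s < t' + e -> `|y s| <= r.
  move=> ste; have [s0|s0] := leP s 0; first by apply/ltW/(lt_trans (yneg _ s0)).
  have [st'|st'] := ltP s t'.
    by have := below s (ltW s0) st'; rewrite subr_lt0 => /lt_trans/(_ etar)/ltW.
  have := He s; rewrite /= distrC ger0_norm ?subr_ge0// ltrBlDl => /(_ ste).
  by rewrite E sub0r normrN ltr_norml => /andP[_]; rewrite ltrD2r => /ltW.
have T0 : 0 < t' + e by rewrite addr_gt0.
have := H (fun t => phi t + xs) _ (t' + e) (fun t => y t + xs) T0 _ t' _.
rewrite addrK => /(_ _ _ _); move: E => /eqP; rewrite subr_eq0 => /eqP ->.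
rewrite ltxx => K; suff : false by []; apply: K.
- apply: (@init_norm_lt _ _ _ rho') => // s; by rewrite addrK.
- apply: sol => s s0 sT; apply: FE; last by move=> ->; rewrite subr0.
    by apply: yr; apply: le_lt_trans sT; rewrite gerBl.
  exact: yr.
- by rewrite (ltW t'0) ltrDl.
Qed.
End Stability.
End GlobalSolutions.

(** * Initial histories and the Laplace transform of a delay *)
Section InitialData.
Context {R : realType}.
Variable tau : R.
Implicit Types (t u s : R).

(** a history from [u0] to [y0]: its two end values can be chosen to satisfy the
    compatibility condition *)
Definition transition (u0 y0 t : R) : R := u0 + (y0 - u0) * smoothstep (2 / tau * t + 2).

(** a bump inside the delay interval: compatible whenever the right-hand side
    vanishes at the origin *)
Definition pulse (k t : R) : R :=
  k * (smoothstep (4 / tau * t + 4) - smoothstep (4 / tau * t + 2)).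

Lemma constant_datum (y0 : R) : datum tau (fun=> y0) (fun=> 0).
Proof.
split=> //; first by move=> t; exact: is_derive_cst.
- exact: cst_continuous.
- by exists `|y0| => t; rewrite normr0.
Qed.

Hypothesis tau0 : 0 < tau.

Let smooth_affine (k l : R) t :
  is_derive t 1 (fun s => smoothstep (k * s + l)) (smoothstep' (k * t + l) * k).
Proof. exact/is_derive_affine/smoothstep_derive. Qed.

Let smooth'_affine (k l : R) : continuous (fun s => smoothstep' (k * s + l)).
Proof.
move=> t; apply: (@continuous_comp _ _ _ (fun s => k * s + l) smoothstep').
  exact: affine_continuous.
exact: smoothstep'_continuous.
Qed.

Let arg_ge (k l t : R) : 0 < k -> 0 <= t -> l <= k / tau * t + l.
Proof. by move=> k0 t0; rewrite lerDr mulr_ge0// divr_ge0// ltW. Qed.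

Let arg_le (k t : R) : 0 < k -> t <= - tau -> k / tau * t + k <= 0.
Proof.
move=> k0 t0; rewrite -subr_ge0 (_ : _ - _ = k / tau * (- tau - t)); last first.
  by field; rewrite gt_eqF.
by rewrite mulr_ge0 ?subr_ge0// divr_ge0// ltW.
Qed.

Lemma transition_ge u0 y0 t : 0 <= t -> transition u0 y0 t = y0.
Proof.
move=> t0; rewrite /transition (smoothstep_ge2 _).1 ?mulr1 ?subrKC//.
exact: arg_ge.
Qed.

Lemma transition_le u0 y0 t : t <= - tau -> transition u0 y0 t = u0.
Proof. by move=> t0; rewrite /transition (smoothstep_le0 _).1 ?mulr0 ?addr0//; exact: arg_le. Qed.

Lemma transition_norm u0 y0 e t : `|u0| <= e -> `|y0| <= e -> `|transition u0 y0 t| <= e.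
Proof.
rewrite /transition; have /andP[] := smoothstep_01 (2 / tau * t + 2).
move: (smoothstep _) => a a0 a1; rewrite !ler_norml => /andP[u1 u2] /andP[y1 y2].
by rewrite (_ : u0 + _ = (1 - a) * u0 + a * y0); [apply/andP; split; nra|ring].
Qed.

Lemma transition_datum u0 y0 : exists phi1, datum tau (transition u0 y0) phi1.
Proof.
pose phi1 t := (y0 - u0) * (smoothstep' (2 / tau * t + 2) * (2 / tau)).
exists phi1; split.
- move=> t.
  have := is_deriveD (is_derive_cst u0 t (1:R)) (is_deriveZ (y0 - u0) (smooth_affine (2 / tau) 2 t)).
  by rewrite add0r.
- move=> t; apply: cvgM; first exact: cvg_cst.
  by apply: cvgM (cvg_cst _); exact: smooth'_affine.
- exists (`|u0| + `|y0| + `|y0 - u0| * (2 / tau)) => t; split.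
    apply: (@le_trans _ _ (`|u0| + `|y0|)); last by rewrite lerDl mulr_ge0// divr_ge0// ltW.
    by apply: transition_norm; rewrite ?lerDl ?lerDr.
  apply: (@le_trans _ _ (`|y0 - u0| * (2 / tau))); last by rewrite lerDr addr_ge0.
  rewrite /phi1 normrM ler_wpM2l// normrM [X in _ * X]ger0_norm; last by rewrite divr_ge0// ltW.
  by rewrite ler_piMl// ?smoothstep'_le// divr_ge0// ltW.
- move=> t t0; rewrite !transition_ge//; split=> //.
  by rewrite /phi1 (smoothstep_ge2 _).2 ?mul0r ?mulr0//; exact: arg_ge.
- by move=> E; move: tau0; rewrite E ltxx.
Qed.

Lemma pulse_out k t : 0 <= t \/ t <= - tau -> pulse k t = 0.
Proof.
move=> [t0|t0]; rewrite /pulse.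
  rewrite (smoothstep_ge2 _).1; last by apply: le_trans (arg_ge _ _ t0) => //; rewrite ler_nat.
  by rewrite (smoothstep_ge2 _).1 ?subrr ?mulr0//; exact: arg_ge.
have h : 4 / tau * t + 4 <= 0 by exact: arg_le.
by rewrite !(smoothstep_le0 _).1 ?subrr ?mulr0//; lra.
Qed.

Lemma pulse_01 t : 0 <= pulse 1 t <= 1.
Proof.
rewrite /pulse mul1r; set s := 4 / tau * t + 4.
have -> : 4 / tau * t + 2 = s - 2 by rewrite /s; ring.
have /andP[a0 a1] := smoothstep_01 s; have /andP[b0 b1] := smoothstep_01 (s - 2).
have [s2|s2] := leP s 2.
  by rewrite (@smoothstep_le0 _ (s - 2) _).1; lra.
by rewrite (smoothstep_ge2 (ltW s2)).1; lra.
Qed.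

Lemma pulseE k t : pulse k t = k * pulse 1 t.
Proof. by rewrite /pulse mul1r. Qed.

Lemma pulse_norm k t : `|pulse k t| <= `|k|.
Proof.
rewrite pulseE normrM ler_piMr//; have /andP[p0 p1] := pulse_01 t.
by rewrite ger0_norm.
Qed.

Lemma pulse_mid t : - tau * 5 / 8 < t < - tau / 2 -> 1 / 2 <= pulse 1 t.
Proof.
move=> /andP[t1 t2]; rewrite /pulse.
have h1 : 3 / 2 <= 4 / tau * t + 4.
  rewrite -subr_ge0 (_ : _ - _ = 4 / tau * (t - (- tau * 5 / 8))); last by field; rewrite gt_eqF.
  by rewrite mulr_ge0 ?divr_ge0 ?subr_ge0// ltW.
have h2 : 4 / tau * t + 2 <= 0.
  rewrite -subr_ge0 (_ : _ - _ = 4 / tau * (- tau / 2 - t)); last by field; rewrite gt_eqF.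
  by rewrite mulr_ge0 ?divr_ge0 ?subr_ge0// ltW.
by rewrite (smoothstep_le0 h2).1 subr0 [X in _ <= X]mul1r smoothstep_mid.
Qed.

Lemma pulse_datum k : exists phi1, datum tau (pulse k) phi1.
Proof.
pose phi1 t := k * (smoothstep' (4 / tau * t + 4) * (4 / tau) - smoothstep' (4 / tau * t + 2) * (4 / tau)).
exists phi1; split.
- move=> t.
  by have := is_deriveZ k (is_deriveB (smooth_affine (4 / tau) 4 t) (smooth_affine (4 / tau) 2 t)).
- move=> t; apply: cvgM; first exact: cvg_cst.
  by apply: cvgB; apply: cvgM (cvg_cst _); exact: smooth'_affine.
- have q0 : 0 <= 4 / tau by rewrite divr_ge0// ltW.
  exists (`|k| + `|k| * (2 * (4 / tau))) => t; split.
    by apply: le_trans (pulse_norm k t) _; rewrite lerDl mulr_ge0// mulr_ge0.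
  apply: (@le_trans _ _ (`|k| * (2 * (4 / tau)))); last by rewrite lerDr.
  rewrite /phi1 normrM ler_wpM2l// -mulrBl normrM [X in _ * X]ger0_norm// ler_wpM2r//.
  have := smoothstep'_le (4 / tau * t + 4); have := smoothstep'_le (4 / tau * t + 2).
  rewrite !ler_norml; lra.
- move=> t t0; rewrite !pulse_out; [|by left|by left].
  split=> //; rewrite /phi1 (@smoothstep_ge2 _ (4 / tau * t + 4) _).2; last first.
    by apply: le_trans (arg_ge _ _ t0) => //; rewrite ler_nat.
  rewrite (@smoothstep_ge2 _ (4 / tau * t + 2) _).2; last exact: arg_ge.
  by rewrite mul0r subrr mulr0.
- by move=> E; move: tau0; rewrite E ltxx.
Qed.
End InitialData.

Section LaplaceOfDelay.
Context {R : realType}.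
Implicit Types (f g y phi : R -> R) (t s b C : R).

(** what the past contributes to the Laplace transform of a delayed function *)
Definition hist (l tau : R) f : R :=
  Int (fun s => expR (- (l * s)) * (if (- tau < s) && (s <= 0) then f s else 0)).

Definition tame b C f := [/\ continuous f, forall t, t <= 0 -> `|f t| <= C &
  forall t, 0 < t -> `|f t| <= C * expR (b * t)].

Lemma tame_wt b C f t : tame b C f -> 0 < t -> `|f t| <= C * wt 1 b t.
Proof. by move=> [_ _ h] t0; rewrite /wt ker1// mul1r; exact: h. Qed.

Lemma tame_C b C f : tame b C f -> 0 <= C.
Proof. by move=> [_ h _]; exact: le_trans (normr_ge0 _) (h 0 (lexx 0)). Qed.

Lemma tame_L1 b C f l : tame b C f -> 0 < b -> b < l ->
  L1 (fun s => expR (- (l * s)) * pos f s).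
Proof.
move=> tf b0 bl; have [cf _ _] := tf.
apply: (@Lap_L1 R 1 b C f) => //; first by move=> s _; exact: cf.
by move=> s; exact: tame_wt tf.
Qed.

Lemma bounded_tame b C f : 0 < b -> continuous f -> (forall t, `|f t| <= C) -> tame b C f.
Proof.
move=> b0 cf fC; split=> // t t0; apply: le_trans (fC t) _.
have C0 : 0 <= C by exact: le_trans (normr_ge0 _) (fC 0).
by rewrite ler_peMr// -expR0 ler_expR mulr_ge0// ltW.
Qed.

Lemma tameD b C C' f g : tame b C f -> tame b C' g -> tame b (C + C') (fun t => f t + g t).
Proof.
move=> [cf f1 f2] [cg g1 g2]; split.
- by move=> t; apply: cvgD; [exact: cf|exact: cg].
- by move=> t t0; apply: le_trans (ler_normD _ _) (lerD (f1 _ t0) (g1 _ t0)).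
- by move=> t t0; rewrite mulrDl; apply: le_trans (ler_normD _ _) (lerD (f2 _ t0) (g2 _ t0)).
Qed.

Lemma tameZ b C k f : tame b C f -> tame b (`|k| * C) (fun t => k * f t).
Proof.
move=> [cf f1 f2]; split.
- by move=> t; apply: cvgM; [exact: cvg_cst|exact: cf].
- by move=> t t0; rewrite normrM ler_wpM2l// f1.
- by move=> t t0; rewrite normrM -mulrA ler_wpM2l// f2.
Qed.

Lemma tame_delay b C f (tau : R) : 0 < b -> 0 <= tau -> tame b C f ->
  tame b C (fun t => f (t - tau)).
Proof.
move=> b0 tau0 tf; have C0 := tame_C tf; have [cf f1 f2] := tf; split.
- exact: continuous_shift cf.
- by move=> t t0; apply: f1; rewrite subr_le0 (le_trans t0).
- move=> t t0; have [tt|tt] := leP (t - tau) 0.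
    by apply: le_trans (f1 _ tt) _; rewrite ler_peMr// -expR0 ler_expR mulr_ge0// ltW.
  by apply: le_trans (f2 _ tt) _; rewrite ler_wpM2l// ler_expR ler_pM2l// gerBl.
Qed.

Lemma LapD b C C' f g l : 0 < b -> b < l -> tame b C f -> tame b C' g ->
  Lap l (fun t => f t + g t) = Lap l f + Lap l g.
Proof.
move=> b0 bl tf tg; rewrite /Lap -IntD; [|exact: tame_L1 tf b0 bl|exact: tame_L1 tg b0 bl].
by apply: Int_ext => s; rewrite /pos; case: ifP => _; rewrite -mulrDr// addr0.
Qed.

Lemma LapZ b C k f l : 0 < b -> b < l -> tame b C f ->
  Lap l (fun t => k * f t) = k * Lap l f.
Proof.
move=> b0 bl tf; rewrite /Lap -IntZ; last exact: tame_L1 tf b0 bl.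
by apply: Int_ext => s; rewrite /pos; case: ifP => _; rewrite mulrCA ?mulr0.
Qed.

Lemma Lap_le b C C' f g l : 0 < b -> b < l -> tame b C f -> tame b C' g ->
  (forall t, 0 < t -> f t <= g t) -> Lap l f <= Lap l g.
Proof.
move=> b0 bl tf tg fg; apply: Int_le; [exact: tame_L1 tf b0 bl|exact: tame_L1 tg b0 bl|].
move=> s; rewrite ler_wpM2l ?expR_ge0//.
by have [s0|s0] := ltP 0 s; [rewrite !posE// fg|rewrite !pos_le0].
Qed.

Lemma hist_L1 l tau f : continuous f ->
  L1 (fun s => expR (- (l * s)) * (if (- tau < s) && (s <= 0) then f s else 0)).
Proof.
move=> cf.
have [M M0 fM] : exists2 M, 0 <= M & forall s, - tau <= s -> s <= 0 -> `|expR (- (l * s)) * f s| <= M.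
  have ch : continuous (fun s => expR (- (l * (s - tau))) * f (s - tau)).
    apply: (@continuous_shift _ tau (fun s => expR (- (l * s)) * f s)) => s.
    apply: cvgM; last exact: cf.
    apply: (@continuous_comp _ _ _ (fun s => - (l * s)) expR); last exact: continuous_expR.
    by apply: cvgN; apply: cvgM; [exact: cvg_cst|].
  have [K K0 HK] := continuous_bounded tau ch.
  exists K => // s s1 s2; have := HK (s + tau); rewrite addrK; apply; lra.
apply: (@L1_le _ _ (fun s => M * \1_(`[(- tau), 0]%classic : set R) s)).
- apply: measurable_funM.
    apply: measurableT_comp => //.
    by apply: measurableT_comp => //; exact: measurable_funM.
  apply: measurable_fun_ifT => //; last exact: continuous_measurable_fun.
  by apply: measurable_and; [exact: measurable_fun_ltr|exact: measurable_fun_ler].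
- by apply: L1Z; exact: integrable_indic_itv.
move=> s; rewrite indicE mem_setE in_itv/=.
case: ifPn => [/andP[s1 s2]|_]; first by rewrite (ltW s1) s2 mulr1 fM// ltW.
by rewrite mulr0 normr0 mulr_ge0.
Qed.

Lemma Lap_delay b C f (l tau : R) : 0 < b -> b < l -> 0 <= tau -> tame b C f ->
  Lap l (fun t => f (t - tau)) = expR (- (l * tau)) * (Lap l f + hist l tau f).
Proof.
move=> b0 bl tau0 tf; have [cf _ _] := tf.
have lf := tame_L1 tf b0 bl; have lh := hist_L1 l tau cf.
rewrite /Lap /hist -IntD// -IntZ; last exact: L1D.
rewrite -(Int_shift tau (L1Z (expR (- (l * tau))) (L1D lf lh))).
apply: Int_ext => s; rewrite -mulrDr mulrA -expRD.
congr (expR _ * _); first by ring.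
rewrite /pos !ltrBDr addNr add0r subr_le0.
case: (ltP 0 s) => s0 /=; last by rewrite ltNge (le_trans s0 tau0) addr0.
by case: (ltP tau s) => _; rewrite ?addr0 ?add0r.
Qed.

Lemma hist_ge l tau f : 0 <= l -> continuous f -> (forall t, 0 <= f t) ->
  hist 0 tau f <= hist l tau f.
Proof.
move=> l0 cf f0; apply: Int_le; [exact: hist_L1|exact: hist_L1|] => s.
case: ifPn => [/andP[_ s0]|_]; last by rewrite !mulr0.
by rewrite ler_wpM2r// ler_expR mul0r oppr0 oppr_ge0 mulr_ge0_le0.
Qed.

Lemma hist_gt0 tau f u v c : continuous f -> (forall t, 0 <= f t) ->
  - tau <= u -> u < v -> v <= 0 -> 0 < c -> (forall t, u < t < v -> c <= f t) ->
  0 < hist 0 tau f.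
Proof.
move=> cf f0 tu uv v0 c0 fc; apply: (@Int_gt0 _ _ u v c) => //; first exact: hist_L1.
  by move=> s; rewrite mulr_ge0 ?expR_ge0//; case: ifP.
move=> s /andP[us sv]; rewrite (le_lt_trans tu us) (ltW (lt_le_trans sv v0)) /=.
by rewrite mul0r oppr0 expR0 mul1r fc// us.
Qed.

Lemma hist_bound l tau f M : 0 < l -> l * tau <= 1 -> 0 <= tau -> 0 <= M ->
  continuous f -> (forall t, `|f t| <= M) -> `|hist l tau f| <= expR 1 * M * tau.
Proof.
move=> l0 lt1 tau0 M0 cf fM.
have li : L1 (fun s => expR 1 * M * \1_(`[(- tau), 0]%classic : set R) s).
  by apply: L1Z; exact: integrable_indic_itv.
have := Int_norm_le (hist_L1 l tau cf) li.
have -> : Int (fun s => expR 1 * M * \1_(`[(- tau), 0]%classic : set R) s) = expR 1 * M * tau.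
  rewrite IntZ; last exact: integrable_indic_itv.
  congr (_ * _); rewrite /Int /Rintegral integral_indic// setIT.
  have := @lebesgue_measure_itv R `[(- tau), 0]; rewrite /= lte_fin oppr_lt0.
  case: ltP => t0 E; first by transitivity (fine (0%:E - (- tau)%:E)); [congr fine; exact: E|rewrite /= sub0r opprK].
  by transitivity (fine (0%E : \bar R)); [congr fine; exact: E|apply/eqP; rewrite eq_le t0 tau0].
apply=> s; rewrite indicE mem_setE in_itv/= normrM (ger0_norm (expR_ge0 _)).
case: ifPn => [/andP[s1 s2]|_]; last by rewrite normr0 mulr0 mulr_ge0// mulr_ge0 ?expR_ge0.
rewrite (ltW s1) s2 mulr1; apply: ler_pM; rewrite ?expR_ge0// ler_expR.
apply: le_trans lt1; rewrite -mulrN ler_pM2l//; lra.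
Qed.

Lemma Lap_cst (l x : R) : 0 < l -> Lap l (fun=> x) = x * (gam 1 / l).
Proof.
move=> l0; have [l1 e1] := ker_exp_scale (@ltr01 R) (lexx 1) l0.
have -> : x * (gam 1 / l) = x * (l `^ (- 1) * gam 1).
  by rewrite powR_inv1 ?(ltW l0)// (mulrC (l^-1)).
rewrite -e1 -IntZ//; apply: Int_ext => s; rewrite /pos.
by case: (ltP 0 s) => s0; [rewrite (ker1 s0) mul1r mulrC|rewrite (ker_le0 _ s0) mul0r !mulr0].
Qed.

(** The delay becomes the factor [exp (- l tau)] and a contribution of the
    initial history, so that the linear part of the equation turns into
    multiplication by a number. *)
Lemma mild_laplace (alpha tau l b C : R) (A B phi y : R -> R) :
  0 < alpha -> alpha <= 1 -> 0 <= tau -> 0 < b -> b < l ->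
  mild alpha tau A B phi y -> (forall t, 0 <= t -> phi t = phi 0) ->
  tame b C (fun t => A (y t)) -> tame b C (fun t => B (y t)) ->
  Lap l y = phi 0 * (gam 1 / l) + kap alpha * gam alpha * l `^ (- alpha) *
    (expR (- (l * tau)) * (Lap l (fun t => A (y t)) + hist l tau (fun t => A (y t))) +
     Lap l (fun t => B (y t))).
Proof.
move=> al0 al1 tau0 b0 bl [yphi cy yE] phi_ge tA tB.
have l0 : 0 < l by exact: lt_trans bl.
have tAd := tame_delay b0 tau0 tA.
have tG := tameD tAd tB.
have cG : continuous (Gof tau A B y) by case: tG.
have bG s : 0 < s -> `|Gof tau A B y s| <= (C + C) * wt 1 b s by exact: tame_wt tG.
have tc : tame b `|phi 0| (fun=> phi 0).
  by apply: bounded_tame => //; exact: cst_continuous.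
have conv_c := adm_continuous al0 al1 (@ltr01 R) (lexx 1) b0 (fun s _ => cG s) bG.
have conv_b := adm_bound al0 al1 (@ltr01 R) (lexx 1) b0 (fun s _ => cG s) bG.
have lc := Lap_L1 (@ltr01 R) (lexx 1) conv_c conv_b bl.
have -> : Lap l y = Lap l (fun=> phi 0) + kap alpha * Lap l (conv alpha (Gof tau A B y)).
  rewrite /Lap -IntZ// -IntD; [|exact: tame_L1 tc b0 bl|exact: L1Z].
  apply: Int_ext => s; rewrite /pos; case: (ltP 0 s) => s0; last by ring.
  by rewrite yE phi_ge ?(ltW s0)//; ring.
rewrite (Lap_conv (@ltr01 R) (lexx 1) b0 (fun s _ => cG s) bG al0 al1 bl) (Lap_cst _ l0).
rewrite (LapD b0 bl tAd tB) (Lap_delay b0 bl tau0 tA).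
move: (expR _ * _ + _) (gam alpha) (kap alpha) => u v w; ring.
Qed.
End LaplaceOfDelay.

(** * The truncated equation, and instability without delay *)
Section Nonlinearity.
Context {R : realType}.
Variables (a b c eps p r : R).
Implicit Types (u v : R).

(** the delayed and the undelayed part of the right-hand side, in coordinates
    centred at the equilibrium, and their truncations *)
Definition PA u : R := b * u + c * (u * u) - eps * (u * u * u).
Definition PB v : R := a * v - p * (v * v).
Definition TA u : R := PA (trunc r u).
Definition TB v : R := PB (trunc r v).

Lemma PA_continuous : continuous PA.
Proof.
move=> u; apply: cvgB; first apply: cvgD; apply: cvgM; try exact: cvg_cst; try exact: cvg_id;
  apply: cvgM; try exact: cvg_id; apply: cvgM; exact: cvg_id.
Qed.

Lemma PB_continuous : continuous PB.
Proof.
by move=> u; apply: cvgB; apply: cvgM; try exact: cvg_cst; try exact: cvg_id;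
  apply: cvgM; exact: cvg_id.
Qed.

Hypothesis r0 : 0 < r.

Lemma TA_bc11 : exists TA1, bc11 TA TA1.
Proof.
have h := trunc_bc11 r0; have h2 := bc11M h h; have h3 := bc11M h2 h.
have -> : TA = fun u => b * trunc r u + c * (trunc r u * trunc r u)
    + - eps * (trunc r u * trunc r u * trunc r u).
  by apply/funext => u; rewrite /TA /PA mulNr.
eexists; exact: (bc11D (bc11D (bc11Z b h) (bc11Z c h2)) (bc11Z (- eps) h3)).
Qed.

Lemma TB_bc11 : exists TB1, bc11 TB TB1.
Proof.
have h := trunc_bc11 r0; have h2 := bc11M h h.
have -> : TB = fun u => a * trunc r u + - p * (trunc r u * trunc r u).
  by apply/funext => u; rewrite /TB /PB mulNr.
eexists; exact: (bc11D (bc11Z a h) (bc11Z (- p) h2)).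
Qed.

Lemma TA_id u : `|u| <= r -> TA u = PA u.
Proof. by move=> ur; rewrite /TA trunc_id. Qed.

Lemma TB_id u : `|u| <= r -> TB u = PB u.
Proof. by move=> ur; rewrite /TB trunc_id. Qed.
End Nonlinearity.

Section TruncatedEquation.
Context {R : realType}.
Implicit Types (s t u v l : R).

Lemma bc11_continuous (f f1 : R -> R) : bc11 f f1 -> continuous f.
Proof.
move=> [K [d _ _ _]] u; apply: differentiable_continuous.
by apply/derivable1_diffP; case: (d u).
Qed.

Lemma powR_small (g e : R) : 0 < g -> 0 < e ->
  exists2 l0 : R, 0 < l0 & forall l, 0 < l -> l <= l0 -> l `^ g <= e.
Proof.
move=> g0 e0; exists (e `^ g^-1); first exact: powR_gt0.
move=> l l0 le0; have -> : e = (e `^ g^-1) `^ g.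
  by rewrite -powRrM mulVf ?gt_eqF// powRr1// ltW.
by apply: ge0_ler_powR; rewrite ?nnegrE ?powR_ge0//; exact: ltW.
Qed.

Variables (alpha tau : R) (F : R -> R -> R) (xs a b c eps p : R).
Hypotheses (al0 : 0 < alpha) (al1 : alpha <= 1) (tau0 : 0 <= tau).
Hypotheses (c0 : 0 < c) (eps0 : 0 < eps) (p0 : 0 < p).
Hypothesis FE : forall u v, F (u + xs) (v + xs) = PA b c eps u + PB a p v.

(** Without delay the trajectory starting above the equilibrium stays above its
    initial value, so that the right-hand side stays away from 0. *)
Lemma unstable_without_delay k e : tau = 0 -> 0 < k -> 0 < e ->
  (forall v, 0 <= v -> v <= e -> k * v ^+ 2 <= PA b c eps v + PB a p v) ->
  unstable alpha tau F xs.
Proof.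
move=> t0 k0 e0 fk st.
pose r := e / 2; have r0 : 0 < r by rewrite divr_gt0.
pose B u := TA b c eps r u + TB a p r u.
have [A1 hA] := TA_bc11 b c eps r0; have [B1 hB] := TB_bc11 a p r0.
have h := bc11D hA hB.
have FE' u v : `|u| <= r -> `|v| <= r -> (tau = 0 -> u = v) ->
    F (u + xs) (v + xs) = (fun u => 0 * u) u + B v.
  by move=> ur vr /(_ t0) ->; rewrite FE mul0r add0r /B TA_id ?TB_id.
have eta0 : 0 < r / 2 by rewrite divr_gt0.
have [|rho rho0 H] := stable_confines FE' tau0 eta0 _ st; first by rewrite ltr_pdivrMr// ltr_pMr// ltr1n.
pose y0 := Num.min rho r.
have y00 : 0 < y0 by rewrite lt_min rho0.
have compat : compatible tau (fun u => 0 * u) B (fun=> y0) by rewrite /compatible t0 ltxx.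
have [y [z [[yn cy yE] _ sol pos_y]]] := global_solution al0 al1 tau0 (linear_c11 0)
  (bc11_c11 h) (constant_datum tau y0) compat.
have yeta t : `|y t| < r / 2.
  apply: (H (fun=> y0)) => // s; rewrite ger0_norm ?(ltW y00)//.
  by rewrite /y0 ge_min lexx.
have Bk v : 0 <= v -> k * (trunc r v) ^+ 2 <= B v.
  move=> v0; have /andP[h1 h2] := trunc_ge0 r0 v0.
  by apply: fk => //; apply: le_trans h2 _; rewrite /r mulrC divfK.
have ypos t : y0 <= y t.
  apply: pos_y => // u v u0 v0; rewrite mul0r add0r.
  apply: le_trans (Bk v (le_trans (ltW y00) v0)).
  by rewrite mulr_ge0 ?sqr_ge0// ltW.
have yr t : `|y t| <= r.
  by apply: ltW; apply: lt_le_trans (yeta t) _; rewrite ler_pdivrMr// ler_pMr// ler1n.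
have cB : continuous B by exact: bc11_continuous h.
have cG : continuous (Gof tau (fun u => 0 * u) B y).
  move=> t; apply: cvgD.
    by under eq_fun do rewrite mul0r; rewrite mul0r; exact: cvg_cst.
  by apply: (@continuous_comp _ _ _ y B); [exact: cy|exact: cB].
pose m := k * y0 ^+ 2; have m0 : 0 < m by rewrite mulr_gt0// exprn_gt0.
have B0 := beta_gt0 al0 al1 (@ltr01 R) (lexx 1).
have kp := kap_gt0 al0 al1.
pose K := kap alpha * m * conv alpha (ker 1) 1.
have K0 : 0 < K by rewrite !mulr_gt0.
have grow t : 0 < t -> K * t `^ alpha <= y t.
  move=> tp; rewrite yE.
  have lk : L1 (fun s => ker alpha (t - s) * pos (ker 1) s).
    by apply: L1_ext (L1_conv_ker t al0 al1 (@ltr01 R) (lexx 1)) => s; rewrite pos_ker.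
  have lkm : L1 (fun s => ker alpha (t - s) * pos (fun s => m * ker 1 s) s).
    by apply: L1_ext (L1Z m lk) => s; rewrite /pos; case: ifP => _; ring.
  have lG := L1_conv_continuous t al0 al1 cG.
  have h1 : m * conv alpha (ker 1) t <= conv alpha (Gof tau (fun u => 0 * u) B y) t.
    rewrite -convZ//; apply: le_trans (ler_norm _) _; apply: conv_norm_le => // s s0 st'.
    rewrite ker1// mulr1 ger0_norm ?(ltW m0)// /Gof mul0r add0r.
    apply: le_trans (Bk _ (le_trans (ltW y00) (ypos s))).
    rewrite trunc_id// ler_pM2l// lerXn2r ?nnegrE ?(ltW y00)//.
    exact: le_trans (ltW y00) (ypos s).
  have -> : K * t `^ alpha = kap alpha * (m * conv alpha (ker 1) t).
    by rewrite (conv_ker_scale al0 al1 (@ltr01 R) (lexx 1) tp) addrK /K; ring.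
  by rewrite -[X in X <= _]add0r lerD ?(ltW y00)// ler_wpM2l// ltW.
pose T := (r / K) `^ alpha^-1.
have rK : 0 < r / K by rewrite divr_gt0.
have T0 : 0 < T by rewrite powR_gt0.
have := grow T T0; rewrite /T -powRrM mulVf ?gt_eqF// powRr1 ?(ltW rK)//.
rewrite mulrC divfK ?gt_eqF// => /le_lt_trans/(_ (le_lt_trans (ler_norm _) (yeta T))).
by apply/negP; rewrite -leNgt ler_pdivrMr// ler_pMr// ler1n.
Qed.

(** Under the assumption of stability, all small compatible data have a global
    solution which never leaves the region where the truncation is the identity;
    contradictions will be drawn from such a solution. *)
Lemma confined_solution : 0 < tau -> forall r, 0 < r -> stable alpha tau F xs ->
  exists2 rho, 0 < rho & forall phi phi1, datum tau phi phi1 ->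
    (forall t, `|phi t| <= rho) -> PA b c eps (phi (- tau)) + PB a p (phi 0) = 0 ->
    exists y z, [/\ mild alpha tau (TA b c eps r) (TB a p r) phi y,
      (forall t : R, is_derive t 1 y (z t)) /\ continuous z,
      forall t, `|y t| < r &
      forall m, (forall u v, m <= u -> m <= v -> 0 <= TA b c eps r u + TB a p r v) ->
        (forall t, m <= phi t) -> forall t, m <= y t].
Proof.
move=> tp r r0 st.
have [A1 hA] := TA_bc11 b c eps r0; have [B1 hB] := TB_bc11 a p r0.
have FE' u v : `|u| <= r -> `|v| <= r -> (tau = 0 -> u = v) ->
    F (u + xs) (v + xs) = TA b c eps r u + TB a p r v.
  by move=> ur vr _; rewrite FE TA_id ?TB_id.
have eta0 : 0 < r / 2 by rewrite divr_gt0.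
have r2 : r / 2 < r by rewrite ltr_pdivrMr// ltr_pMr// ltr1n.
have [rho rho0 H] := stable_confines FE' tau0 eta0 r2 st.
exists (Num.min rho r); first by rewrite lt_min rho0.
move=> phi phi1 dphi phir co.
have phr t : `|phi t| <= r by apply: le_trans (phir t) _; rewrite ge_min lexx orbT.
have compat : compatible tau (TA b c eps r) (TB a p r) phi.
  by move=> _; rewrite TA_id ?TB_id.
have [y [z [[yn cy yE] yz sol pos_y]]] := global_solution al0 al1 tau0 (bc11_c11 hA)
  (bc11_c11 hB) dphi compat.
exists y, z; split=> //; first exact: yz.
move=> t; apply: lt_trans r2; apply: (H phi) => // s.
by apply: le_trans (phir s) _; rewrite ge_min lexx.
Qed.

Section Transform.
Variables (r : R) (phi y : R -> R).
Hypothesis tp : 0 < tau.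
Hypothesis r0 : 0 < r.
Hypothesis my : mild alpha tau (TA b c eps r) (TB a p r) phi y.
Hypothesis yr : forall t, `|y t| < r.
Hypothesis phi_ge : forall t, 0 <= t -> phi t = phi 0.

Let cy : continuous y. Proof. by case: my. Qed.

Lemma confined_tame (f : R -> R) : continuous f -> forall l, 0 < l ->
  exists C, tame (l / 2) C (fun t => f (y t)).
Proof.
move=> cf l l0.
have [M M0 HM] := continuous_bounded (2 * r) (@continuous_shift _ r f cf).
exists M; apply: bounded_tame; first by rewrite divr_gt0.
  by move=> t; apply: (@continuous_comp _ _ _ y f); [exact: cy|exact: cf].
move=> t; have := yr t; rewrite ltr_norml => /andP[y1 y2].
by have := HM (y t + r); rewrite addrK; apply; lra.
Qed.

Lemma transform_identity l : 0 < l ->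
  Lap l y = phi 0 * (gam 1 / l) + kap alpha * gam alpha * l `^ (- alpha) *
    (expR (- (l * tau)) * (Lap l (fun t => PA b c eps (y t)) + hist l tau (fun t => PA b c eps (y t))) +
     Lap l (fun t => PB a p (y t))).
Proof.
move=> l0.
have EA : (fun t => TA b c eps r (y t)) = (fun t => PA b c eps (y t)).
  by apply/funext => t; rewrite TA_id// ltW.
have EB : (fun t => TB a p r (y t)) = (fun t => PB a p (y t)).
  by apply/funext => t; rewrite TB_id// ltW.
have [A1 hA] := TA_bc11 b c eps r0; have [B1 hB] := TB_bc11 a p r0.
have [CA tA] := confined_tame (bc11_continuous hA) l0.
have [CB tB] := confined_tame (bc11_continuous hB) l0.
have l2 : 0 < l / 2 by rewrite divr_gt0.
have ll : l / 2 < l by rewrite ltr_pdivrMr// ltr_pMr// ltr1n.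
have CAB C C' (f : R -> R) : 0 <= C' -> tame (l / 2) C f -> tame (l / 2) (C + C') f.
  move=> C'0 [h1 h2 h3]; split=> // t t0.
    by apply: le_trans (h2 _ t0) _; rewrite lerDl.
  by apply: le_trans (h3 _ t0) _; rewrite ler_wpM2r ?expR_ge0// lerDl.
have tA' := CAB _ _ _ (tame_C tB) tA.
have tB' := CAB _ _ _ (tame_C tA) tB; rewrite addrC in tB'.
by rewrite (mild_laplace al0 al1 tau0 l2 ll my phi_ge tA' tB') EA EB.
Qed.
End Transform.
End TruncatedEquation.

(** * Instability when the delayed term has no linear part *)
Section PositiveFeedback.
Context {R : realType}.
Implicit Types (s t u v l : R).
Variables (alpha tau : R) (F : R -> R -> R) (xs a b c eps p : R).
Hypotheses (al0 : 0 < alpha) (al1 : alpha <= 1) (tau0 : 0 < tau).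
Hypotheses (c0 : 0 < c) (eps0 : 0 < eps) (p0 : 0 < p).
Hypothesis FE : forall u v, F (u + xs) (v + xs) = PA b c eps u + PB a p v.

Let K := kap alpha * gam alpha.
Let K0 : 0 < K. Proof. by rewrite mulr_gt0 ?kap_gt0 ?gam_gt0. Qed.
Let g1 := gam 1 : R.
Let g10 : 0 < g1. Proof. exact: gam_gt0. Qed.

(** A pulse of the sign of [b] makes the linear part nonnegative, and a small
    amplitude keeps the cubic part below half of the quadratic one. *)
Lemma PA_pulse k t : `|k| <= c / (2 * eps) -> 0 <= b * k ->
  c / 2 * (k ^+ 2 * pulse tau 1 t ^+ 2) <= PA b c eps (pulse tau k t).
Proof.
move=> kc bk; rewrite (pulseE tau k) /PA; have /andP[] := pulse_01 tau t.
move: (pulse tau 1 t) => w w0 w1.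
have kw : eps * (k * w) <= c / 2.
  have h : k * w <= c / (2 * eps).
    apply: le_trans (ler_norm _) _; rewrite normrM (ger0_norm w0).
    by apply: le_trans kc; rewrite ler_piMr.
  have := ler_wpM2l (ltW eps0) h.
  by rewrite (_ : eps * (c / (2 * eps)) = c / 2)//; field; exact: lt0r_neq0.
have h2 : 0 <= (k * w) ^+ 2 by exact: sqr_ge0.
have := ler_wpM2r h2 kw; have : 0 <= b * k * w by rewrite mulr_ge0.
move=> h3 h4; rewrite -subr_ge0.
rewrite (_ : _ - _ = b * k * w + (c / 2 * (k * w) ^+ 2 - eps * (k * w) * (k * w) ^+ 2)); last by field.
by rewrite addr_ge0// subr_ge0.
Qed.

Lemma hist_pulse_gt0 k : k != 0 -> `|k| <= c / (2 * eps) -> 0 <= b * k ->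
  0 < hist 0 tau (fun t => PA b c eps (pulse tau k t)).
Proof.
move=> k0 kc bk.
have k2 : 0 < k ^+ 2 by rewrite exprn_even_gt0.
have cpos : 0 < c / 2 * (k ^+ 2 * (1 / 2) ^+ 2).
  by rewrite mulr_gt0 ?divr_gt0// mulr_gt0// exprn_gt0.
have [phi1 [dphi _ _ _ _]] := pulse_datum tau0 k.
apply: (@hist_gt0 _ tau _ (- tau * 5 / 8) (- tau / 2) _ _ _ _ _ _ cpos).
- move=> t; apply: (@continuous_comp _ _ _ (pulse tau k) (PA b c eps)); last exact: PA_continuous.
  by apply: differentiable_continuous; apply/derivable1_diffP; case: (dphi t).
- move=> t; apply: le_trans (PA_pulse t kc bk).
  by rewrite mulr_ge0 ?divr_ge0 ?(ltW c0)// mulr_ge0 ?sqr_ge0.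
- by have := tau0; lra.
- by have := tau0; lra.
- by have := tau0; lra.
- move=> t /(pulse_mid tau0) h; apply: le_trans (PA_pulse t kc bk).
  by rewrite ler_pM2l ?divr_gt0// ler_pM2l// lerXn2r ?nnegrE//; apply: le_trans h.
Qed.

Lemma hist_ext l f g : (forall t, t <= 0 -> f t = g t) -> hist l tau f = hist l tau g.
Proof.
move=> fg; apply: Int_ext => s.
by case: ifP => // /andP[_ s0]; rewrite fg.
Qed.

Lemma hist_pulse_ge l k : 0 < l -> `|k| <= c / (2 * eps) -> 0 <= b * k ->
  hist 0 tau (fun t => PA b c eps (pulse tau k t)) <=
  hist l tau (fun t => PA b c eps (pulse tau k t)).
Proof.
move=> l0 kc bk; have [phi1 [dphi _ _ _ _]] := pulse_datum tau0 k.
apply: hist_ge; first exact: ltW.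
- move=> t; apply: (@continuous_comp _ _ _ (pulse tau k) (PA b c eps)); last exact: PA_continuous.
  by apply: differentiable_continuous; apply/derivable1_diffP; case: (dphi t).
- move=> t; apply: le_trans (PA_pulse t kc bk).
  by rewrite mulr_ge0 ?divr_ge0 ?(ltW c0)// mulr_ge0 ?sqr_ge0.
Qed.

Lemma id_tame r y l : continuous y -> (forall t, `|y t| < r) -> 0 < l -> tame (l / 2) r y.
Proof.
move=> cy yr l0; apply: bounded_tame => //; first by rewrite divr_gt0.
by move=> t; exact: ltW.
Qed.

(** When the delayed term has no linear part, a positive trajectory grows at
    least like the solution of D^alpha y = (a / 2) y, whose Laplace transform
    is infinite at small frequencies. *)
Lemma unstable_undelayed_linear_part : b = 0 -> 0 < a -> unstable alpha tau F xs.
Proof.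
move=> b0 a0 st.
pose r := Num.min (c / (4 * eps)) (a / (4 * p)).
have r0 : 0 < r by rewrite lt_min !divr_gt0 ?mulr_gt0.
have rc : r <= c / (4 * eps) by rewrite ge_min lexx.
have rp : r <= a / (4 * p) by rewrite ge_min lexx orbT.
have [rho rho0 H] := confined_solution al0 al1 (ltW tau0) FE tau0 r0 st.
pose k := Num.min rho (c / (2 * eps)).
have k0 : 0 < k by rewrite lt_min rho0 divr_gt0// mulr_gt0.
have kc : `|k| <= c / (2 * eps) by rewrite ger0_norm ?(ltW k0)// ge_min lexx orbT.
have krho : `|k| <= rho by rewrite ger0_norm ?(ltW k0)// ge_min lexx.
have bk : 0 <= b * k by rewrite b0 mul0r.
have [phi1 dphi] := pulse_datum tau0 k.
have P0 : pulse tau k 0 = 0 by apply: pulse_out => //; left.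
have Pt : pulse tau k (- tau) = 0 by apply: pulse_out => //; right.
have [||y [z [my _ yr ypos]]] := H _ _ dphi.
- by move=> t; apply: le_trans krho; exact: pulse_norm.
- by rewrite Pt P0 /PA /PB !mulr0 subrr subr0 !addr0.
have phi_ge t : 0 <= t -> pulse tau k t = pulse tau k 0.
  by move=> t0; rewrite P0; apply: pulse_out => //; left.
have [yphi cy _] := my.
have PA_ge0 u : 0 <= u -> u <= 2 * r -> 0 <= PA b c eps u.
  move=> u0 ur; rewrite /PA b0 mul0r add0r.
  rewrite (_ : _ - _ = u * u * (c - eps * u)); last by ring.
  rewrite mulr_ge0 ?mulr_ge0// subr_ge0.
  have : u <= c / (2 * eps).
    by apply: le_trans ur _; have := rc; rewrite (_ : c / (2 * eps) = 2 * (c / (4 * eps))); [lra|field; exact: lt0r_neq0].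
  rewrite ler_pdivlMr ?mulr_gt0// => h.
  by have := mulr_ge0 (ltW eps0) u0; have := c0; lra.
have PB_ge u : 0 <= u -> u <= 2 * r -> a / 2 * u <= PB a p u.
  move=> u0 ur; rewrite /PB -subr_ge0 (_ : _ - _ = u * (a / 2 - p * u)); last by field.
  rewrite mulr_ge0// subr_ge0.
  have : u <= a / (2 * p).
    by apply: le_trans ur _; have := rp; rewrite (_ : a / (2 * p) = 2 * (a / (4 * p))); [lra|field; exact: lt0r_neq0].
  rewrite ler_pdivlMr ?mulr_gt0// => h; lra.
have y0 t : 0 <= y t.
  apply: ypos => [u v u0 v0|s].
    have /andP[h1 h2] := trunc_ge0 r0 u0; have /andP[h3 h4] := trunc_ge0 r0 v0.
    apply: addr_ge0; first exact: PA_ge0.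
    by apply: le_trans (PB_ge _ h3 h4); rewrite mulr_ge0// divr_ge0// ltW.
  by rewrite pulseE mulr_ge0 ?(ltW k0)//; have /andP[] := pulse_01 tau s.
have yr' t : y t <= 2 * r.
  have /andP[_ h] : (- r < y t) && (y t < r) by rewrite -ltr_norml.
  by rewrite (le_trans (ltW h))// ler_peMl ?(ltW r0)// ler1n.
have [l0 l00 Hl] := powR_small al0 (mulr_gt0 K0 (divr_gt0 a0 (ltr0n R 2))).
have lK := Hl l0 l00 (lexx _).
have ti := transform_identity al0 al1 (ltW tau0) r0 my yr phi_ge l00.
have l2 : 0 < l0 / 2 by rewrite divr_gt0.
have ll : l0 / 2 < l0 by rewrite ltr_pdivrMr// ltr_pMr// ltr1n.
have tcst x : tame (l0 / 2) `|x| (fun=> x).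
  by apply: bounded_tame => //; exact: cst_continuous.
have [CA tA] := confined_tame my yr (@PA_continuous R b c eps) l00.
have [CB tB] := confined_tame my yr (@PB_continuous R a p) l00.
have ty := id_tame cy yr l00.
have hA : 0 <= Lap l0 (fun t => PA b c eps (y t)).
  have := Lap_le l2 ll (tcst 0) tA (fun t _ => PA_ge0 _ (y0 t) (yr' t)).
  by rewrite {1}/Lap (Int_ext (g := fun=> 0)) ?Int0// => s; rewrite /pos if_same mulr0.
have hB : a / 2 * Lap l0 y <= Lap l0 (fun t => PB a p (y t)).
  rewrite -(LapZ _ l2 ll ty).
  exact: Lap_le l2 ll (tameZ _ ty) tB (fun t _ => PB_ge _ (y0 t) (yr' t)).
have hH : 0 < hist l0 tau (fun t => PA b c eps (y t)).
  rewrite (@hist_ext _ _ (fun t => PA b c eps (pulse tau k t))).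
    apply: lt_le_trans (hist_pulse_ge l00 kc bk).
    by apply: hist_pulse_gt0 => //; rewrite gt_eqF.
  by move=> t t0; rewrite yphi.
have hy : 0 <= Lap l0 y.
  have := Lap_le l2 ll (tcst 0) ty (fun t _ => y0 t).
  by rewrite {1}/Lap (Int_ext (g := fun=> 0)) ?Int0// => s; rewrite /pos if_same mulr0.
have E0 := expR_gt0 (- (l0 * tau)).
move: ti; rewrite P0 mul0r add0r -/K => ti.
have lp : 0 < l0 `^ alpha by rewrite powR_gt0.
have : Lap l0 y < Lap l0 y.
  rewrite {2}ti powRN.
  apply: (@le_lt_trans _ _ (K / l0 `^ alpha * (a / 2 * Lap l0 y))).
    rewrite mulrA ler_peMl// mulrAC ler_pdivlMr// mul1r.
    exact: lK.
  rewrite ltr_pM2l ?divr_gt0//.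
  apply: (@lt_le_trans _ _ (expR (- (l0 * tau)) * (Lap l0 (fun t => PA b c eps (y t)) + hist l0 tau (fun t => PA b c eps (y t))) + a / 2 * Lap l0 y)).
    by rewrite ltrDr mulr_gt0// ltr_wpDl.
  by rewrite lerD2l.
by rewrite ltxx.
Qed.
End PositiveFeedback.

(** * The double equilibrium *)
Section DegenerateEquilibrium.
Context {R : realType}.
Implicit Types (s t u v l : R).
Variables (alpha tau : R) (F : R -> R -> R) (xs a b c eps p : R).
Hypotheses (al0 : 0 < alpha) (al1 : alpha <= 1) (tau0 : 0 < tau).
Hypotheses (eps0 : 0 < eps) (p0 : 0 < p).
Hypotheses (ab : a = - b) (cp : c = 3 / 2 * p).
Hypothesis FE : forall u v, F (u + xs) (v + xs) = PA b c eps u + PB a p v.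

Let c0 : 0 < c. Proof. by rewrite cp mulr_gt0. Qed.
Let K := kap alpha * gam alpha.
Let K0 : 0 < K. Proof. by rewrite mulr_gt0 ?kap_gt0 ?gam_gt0. Qed.
Let g1 := gam 1 : R.
Let g10 : 0 < g1. Proof. exact: gam_gt0. Qed.

Let r := p / (4 * eps).
Let r0 : 0 < r. Proof. by rewrite divr_gt0// mulr_gt0. Qed.

(** At a double root the linear parts cancel up to a factor of order [l], and
    the quadratic parts add up to a positive multiple of the transform of
    [y^2], which dominates the square of the Abel mean [X] of the trajectory. *)
Lemma abel_mean_inequality phi y l :
  mild alpha tau (TA b c eps r) (TB a p r) phi y -> (forall t, `|y t| < r) ->
  (forall t, 0 <= t -> phi t = phi 0) -> 0 < l -> l * tau <= 1 / 10 ->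
  phi 0 * g1 + K * l `^ (- alpha) * (a * (1 - expR (- (l * tau))) * (l * Lap l y) +
    p / (8 * g1) * (l * Lap l y) ^+ 2 +
    l * expR (- (l * tau)) * hist l tau (fun t => PA b c eps (phi t))) <= l * Lap l y.
Proof.
move=> my yr phi_ge l0 lt; set X := l * Lap l y; set E := expR (- (l * tau)); have [yphi cy _] := my.
have l2 : 0 < l / 2 by rewrite divr_gt0.
have ll : l / 2 < l by rewrite ltr_pdivrMr// ltr_pMr// ltr1n.
have ti := transform_identity al0 al1 (ltW tau0) r0 my yr phi_ge l0.
have cPA := @PA_continuous R b c eps.
have cPB := @PB_continuous R a p.
have csq : continuous (fun u : R => u * u) by move=> u; apply: cvgM; exact: cvg_id.
have [CA tA] := confined_tame my yr cPA l0.
have [CB tB] := confined_tame my yr cPB l0.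
have [CQ tQ] := confined_tame my yr csq l0.
have ty := id_tame cy yr l0.
rewrite -/E in ti; set Y := Lap l y in X ti *; set Q := Lap l (fun t => y t * y t).
have hA : b * Y + 5 / 4 * p * Q <= Lap l (fun t => PA b c eps (y t)).
  rewrite /Y /Q -(LapZ b l2 ll ty) -(LapZ _ l2 ll tQ) -(LapD l2 ll (tameZ b ty) (tameZ (5 / 4 * p) tQ)).
  apply: Lap_le l2 ll (tameD (tameZ b ty) (tameZ (5 / 4 * p) tQ)) tA _ => t _.
  rewrite /PA -subr_ge0 (_ : _ - _ = y t * y t * (p / 4 - eps * y t)); last by rewrite cp; field.
  rewrite mulr_ge0 ?subr_ge0//; first by rewrite -expr2 sqr_ge0.
  have := yr t; rewrite ltr_norml => /andP[_ h].
  have := ler_wpM2l (ltW eps0) (ltW h).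
  by rewrite (_ : eps * r = p / 4)// /r; field; exact: lt0r_neq0.
have hB : a * Y + - p * Q <= Lap l (fun t => PB a p (y t)).
  rewrite /Y /Q -(LapZ a l2 ll ty) -(LapZ _ l2 ll tQ) -(LapD l2 ll (tameZ a ty) (tameZ (- p) tQ)).
  by apply: Lap_le l2 ll (tameD (tameZ a ty) (tameZ (- p) tQ)) tB _ => t _; rewrite /PB mulNr.
have hQ : X ^+ 2 / g1 <= l * Q.
  set m := X / g1.
  have tc : tame (l / 2) `|- m ^+ 2| (fun=> - m ^+ 2).
    by apply: bounded_tame => //; exact: cst_continuous.
  have : 2 * m * Y + - m ^+ 2 * (g1 / l) <= Q.
    rewrite /Y /Q -(LapZ _ l2 ll ty) -(Lap_cst _ l0) -(LapD l2 ll (tameZ (2 * m) ty) tc).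
    apply: Lap_le l2 ll (tameD (tameZ (2 * m) ty) tc) tQ _ => t _.
    rewrite -subr_ge0 (_ : _ - _ = (y t - m) ^+ 2); last by ring.
    exact: sqr_ge0.
  rewrite -(ler_pM2l l0); apply: le_trans.
  rewrite le_eqVlt; apply/orP; left; apply/eqP; rewrite /m /X.
  by field; rewrite !gt_eqF.
have E9 : 9 / 10 <= E.
  by have := expR_ge1Dx (- (l * tau)); rewrite -/E; lra.
have Q0 : 0 <= l * Q by apply: le_trans hQ; rewrite divr_ge0 ?sqr_ge0// ltW.
have HE : hist l tau (fun t => PA b c eps (y t)) = hist l tau (fun t => PA b c eps (phi t)).
  by apply: hist_ext => t t0; rewrite yphi.
rewrite HE in ti; set H := hist _ _ _ in ti *.
have lK : 0 <= K * l `^ (- alpha) by rewrite mulr_ge0 ?powR_ge0// ltW.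
rewrite [X in _ <= X](_ : _ = phi 0 * g1 + K * l `^ (- alpha) *
    (l * (E * (Lap l (fun t => PA b c eps (y t)) + H) + Lap l (fun t => PB a p (y t))))); last first.
  rewrite /X ti -/K -/g1 -/E; field; exact: lt0r_neq0.
rewrite lerD2l ler_wpM2l//.
have E0 : 0 <= E by exact: expR_ge0.
have h1 := ler_wpM2l E0 hA.
have h2 := ler_wpM2l (ltW l0) (lerD h1 hB).
have h3 : p / (8 * g1) * X ^+ 2 <= (5 / 4 * E - 1) * p * (l * Q).
  apply: (@le_trans _ _ (p / 8 * (X ^+ 2 / g1))).
    by rewrite le_eqVlt; apply/orP; left; apply/eqP; field; rewrite !gt_eqF.
  apply: (@le_trans _ _ (p / 8 * (l * Q))); first by rewrite ler_pM2l// divr_gt0.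
  by rewrite ler_wpM2r// mulrC ler_pM2r//; lra.
apply: (@le_trans _ _ (l * (E * (b * Y + 5 / 4 * p * Q) + (a * Y + - p * Q)) + l * E * H)).
  rewrite (_ : l * (_ + _) + _ = a * (1 - E) * X + (5 / 4 * E - 1) * p * (l * Q) + l * E * H).
    by rewrite lerD2r lerD2l.
  by rewrite /X ab; field.
rewrite (_ : l * (E * (Lap _ _ + H) + _) = l * (E * Lap l (fun t => PA b c eps (y t)) + Lap l (fun t => PB a p (y t))) + l * E * H); last by ring.
by rewrite lerD2r.
Qed.

Let Lap_bound y l : continuous y -> (forall t, `|y t| < r) -> 0 < l ->
  `|l * Lap l y| <= r * g1.
Proof.
move=> cy yr l0; have ty := id_tame cy yr l0.
have l2 : 0 < l / 2 by rewrite divr_gt0.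
have ll : l / 2 < l by rewrite ltr_pdivrMr// ltr_pMr// ltr1n.
have tc x : tame (l / 2) `|x| (fun=> x).
  by apply: bounded_tame => //; exact: cst_continuous.
rewrite ler_norml; have e x : x * g1 = l * Lap l (fun=> x).
  by rewrite Lap_cst// -/g1; field; exact: lt0r_neq0.
rewrite -mulNr !e !ler_pM2l//; apply/andP; split.
  apply: (Lap_le l2 ll (tc _) ty) => t _.
  by have := yr t; rewrite ltr_norml => /andP[/ltW].
apply: (Lap_le l2 ll ty (tc _)) => t _.
by have := yr t; rewrite ltr_norml => /andP[_ /ltW].
Qed.

(** The value [b y0 + p y0^2] of [- PB y0] is attained by [PA] between 0 and a
    small positive number when [0 <= b], and between [y0] and [2 y0] when
    [b < 0], where the linear term decreases. *)
Lemma compatible_values rho : 0 < rho ->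
  exists u0 y0 : R, [/\ 0 < y0, `|y0| <= rho, `|u0| <= rho & PA b c eps u0 + PB a p y0 = 0].
Proof.
move=> rho0.
pose y1 := Num.min (rho / 2) (p / (4 * eps)).
have y10 : 0 < y1 by rewrite lt_min !divr_gt0// mulr_gt0.
have y1r : y1 <= rho / 2 by rewrite ge_min lexx.
have y1e : y1 <= p / (4 * eps) by rewrite ge_min lexx orbT.
have low y0 : 0 < y0 -> y0 <= y1 -> b * y0 + p * y0 ^+ 2 <= PA b c eps y0.
  move=> y00 yy; rewrite /PA -subr_ge0.
  rewrite (_ : _ - _ = y0 ^+ 2 * (p / 2 - eps * y0)); last by rewrite cp; field.
  rewrite mulr_ge0 ?sqr_ge0// subr_ge0.
  have := le_trans yy y1e; rewrite ler_pdivlMr ?mulr_gt0// => h.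
  have := mulr_gt0 eps0 y00; have := p0; lra.
have ivt y0 (lo hi : R) : 0 < y0 -> y0 <= rho -> 0 <= lo -> lo <= hi -> hi <= rho ->
    (PA b c eps lo <= b * y0 + p * y0 ^+ 2 <= PA b c eps hi \/
     PA b c eps hi <= b * y0 + p * y0 ^+ 2 <= PA b c eps lo) ->
    exists u0 y0 : R, [/\ 0 < y0, `|y0| <= rho, `|u0| <= rho & PA b c eps u0 + PB a p y0 = 0].
  move=> y00 yr lo0 lohi hir h.
  have [||u] := @IVT R (PA b c eps) lo hi (b * y0 + p * y0 ^+ 2) lohi.
  - exact: continuous_subspaceT (@PA_continuous R b c eps).
  - case: h => /andP[h1 h2]; have h3 := le_trans h1 h2.
      by rewrite (min_l h3) (max_r h3) h1 h2.
    by rewrite (min_r h3) (max_l h3) h1 h2.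
  rewrite in_itv/= => /andP[u1 u2] Eu.
  exists u, y0; split=> //; first by rewrite ger0_norm// ltW.
    by rewrite ger0_norm; [exact: le_trans u2 hir|exact: le_trans lo0 u1].
  by rewrite Eu /PB ab; ring.
have [b0|b0] := leP 0 b.
  apply: (ivt y1 0 y1) => //; try lra; last first.
    left; rewrite low//= andbT; rewrite {1}/PA !mulr0 addr0 subrr.
    by rewrite addr_ge0// mulr_ge0 ?sqr_ge0// ltW.
pose y0 := Num.min y1 (- b / (4 * c)).
have y00 : 0 < y0 by rewrite lt_min y10 divr_gt0 ?oppr_gt0// mulr_gt0.
have yy : y0 <= y1 by rewrite ge_min lexx.
have yb : y0 <= - b / (4 * c) by rewrite ge_min lexx orbT.
apply: (ivt y0 y0 (2 * y0)) => //; try (have := rho0; lra).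
right; rewrite low// andbT /PA -subr_ge0.
rewrite (_ : _ - _ = y0 * ((- b - 4 * c * y0) + p * y0 + 8 * eps * y0 ^+ 2)); last by ring.
have h1 : 0 <= - b - 4 * c * y0.
  by rewrite subr_ge0; move: yb; rewrite ler_pdivlMr ?mulr_gt0// (mulrC y0).
have h2 : 0 <= p * y0 by rewrite mulr_ge0// ltW.
have h3 : 0 <= 8 * eps * y0 ^+ 2 by rewrite mulr_ge0 ?sqr_ge0// mulr_ge0// ltW.
by rewrite mulr_ge0 ?(ltW y00)//; lra.
Qed.

(** Starting above the equilibrium, the Abel mean stays away from 0 at low
    frequencies because the errors are of order [l^(1 - alpha)], while the
    factor [l^(- alpha)] in front of its square makes it unbounded. *)
Lemma unstable_degenerate_fractional : alpha < 1 -> unstable alpha tau F xs.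
Proof.
move=> al_lt1 st.
have mean phi y l := @abel_mean_inequality phi y l; have bnd := Lap_bound.
move: K0 g10 mean bnd; move: (K) (g1) => kp gm kp0 gm0 mean bnd.
have [rho rho0 H] := confined_solution al0 al1 (ltW tau0) FE tau0 r0 st.
have [u0 [y0 [y00 y0r u0r co]]] := compatible_values rho0.
have [phi1 dphi] := transition_datum tau0 u0 y0.
have phi0 : transition tau u0 y0 0 = y0 by exact: transition_ge.
have [||y [z [my _ yr _]]] := H _ _ dphi.
- by move=> t; exact: transition_norm.
- by rewrite transition_le// phi0.
have phi_ge t : 0 <= t -> transition tau u0 y0 t = transition tau u0 y0 0.
  by move=> t0; rewrite phi0 transition_ge.
have [yphi cy _] := my.
have cphi : continuous (transition tau u0 y0).
  have [d _ _ _ _] := dphi => t.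
  by apply: differentiable_continuous; apply/derivable1_diffP; case: (d t).
have cPphi : continuous (fun t => PA b c eps (transition tau u0 y0 t)).
  move=> t; apply: (@continuous_comp _ _ _ (transition tau u0 y0) (PA b c eps)); first exact: cphi.
  exact: PA_continuous.
have [M M0 HM] : exists2 M, 0 <= M & forall t, `|PA b c eps (transition tau u0 y0 t)| <= M.
  have [M M0 HM] := continuous_bounded (2 * rho) (@continuous_shift _ rho _ (@PA_continuous R b c eps)).
  exists M => // t; have := transition_norm tau t u0r y0r; rewrite ler_norml => /andP[h1 h2].
  by have := HM (transition tau u0 y0 t + rho); rewrite addrK; apply; lra.
have be0 : 0 < 1 - alpha by rewrite subr_gt0.
pose W := kp * (`|a| * tau * (r * gm) + expR 1 * M * tau) + 1.
have W0 : 0 < W.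
  apply: ltr_wpDl => //; apply: mulr_ge0; first exact: ltW.
  have h1 : 0 <= r * gm by rewrite mulr_ge0// ltW.
  have h2 : 0 <= `|a| * tau by rewrite mulr_ge0// ltW.
  have h3 : 0 <= expR 1 * M * tau by apply: mulr_ge0; [rewrite mulr_ge0 ?expR_ge0|exact: ltW].
  by rewrite addr_ge0// mulr_ge0.
have yg0 : 0 < y0 * gm / 2 by rewrite divr_gt0// mulr_gt0.
have [l1 l10 H1] := powR_small be0 (divr_gt0 yg0 W0).
pose V := kp * (p / (8 * gm) * (y0 * gm / 2) ^+ 2).
have V0 : 0 < V by rewrite mulr_gt0// mulr_gt0 ?exprn_gt0// divr_gt0// mulr_gt0.
have rg0 : 0 < r * gm by rewrite mulr_gt0.
have [l2 l20 H2] := powR_small al0 (divr_gt0 V0 rg0).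
pose l := Num.min (Num.min l1 l2) (Num.min (1 / (10 * tau)) 1).
have l0 : 0 < l by rewrite !lt_min l10 l20 ltr01 divr_gt0// mulr_gt0.
have ll1 : l <= l1 by rewrite /l !ge_min lexx.
have ll2 : l <= l2 by rewrite /l !ge_min lexx orbT.
have lt : l * tau <= 1 / 10.
  have : l <= 1 / (10 * tau) by rewrite /l !ge_min lexx !orbT.
  by rewrite ler_pdivlMr ?mulr_gt0//; lra.
have := mean _ _ _ my yr phi_ge l0 lt; rewrite phi0 /=.
set X := l * Lap l y; set E := expR (- (l * tau)); set Hh := hist _ _ _.
have XB : `|X| <= r * gm by exact: bnd.
have Hb : `|Hh| <= expR 1 * M * tau.
  by apply: hist_bound => //; [lra|exact: ltW].
have E1 : 0 <= E <= 1.
  by rewrite expR_ge0 -expR0 ler_expR oppr_le0 mulr_ge0// ltW.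
have E2 : 1 - E <= l * tau by have := expR_ge1Dx (- (l * tau)); rewrite -/E; lra.
have /andP[E01 E11] := E1.
have pl : 0 < l `^ (- alpha) by rewrite powR_gt0.
have lpow : l `^ (- alpha) * l = l `^ (1 - alpha).
  rewrite -[X in _ * X](powRr1 (ltW l0)) -powRD; last by rewrite (gt_eqF l0) implybT.
  by congr (_ `^ _); ring.
have err : `|kp * l `^ (- alpha) * (a * (1 - E) * X + l * E * Hh)| <= y0 * gm / 2.
  rewrite normrM ger0_norm; last by rewrite mulr_ge0// ltW.
  have h1 : `|a * (1 - E) * X| <= `|a| * (l * tau) * (r * gm).
    rewrite normrM (normrM a); apply: ler_pM => //.
    by rewrite ler_wpM2l// ger0_norm// subr_ge0.
  have h2 : `|l * E * Hh| <= l * (expR 1 * M * tau).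
    rewrite -mulrA normrM (gtr0_norm l0) ler_pM2l// normrM.
    by rewrite (ger0_norm E01) -[X in _ <= X]mul1r; apply: ler_pM.
  have h3 := le_trans (ler_normD _ _) (lerD h1 h2).
  have h4 := ler_wpM2l (ltW (mulr_gt0 kp0 pl)) h3.
  apply: le_trans h4 _.
  rewrite [X in X <= _](_ : _ = kp * (`|a| * tau * (r * gm) + expR 1 * M * tau) * (l `^ (- alpha) * l)); last by ring.
  rewrite lpow; apply: (@le_trans _ _ (W * l `^ (1 - alpha))).
    by rewrite ler_wpM2r ?powR_ge0// lerDl.
  by rewrite mulrC -ler_pdivlMr//; exact: H1.
have sq0 : 0 <= kp * l `^ (- alpha) * (p / (8 * gm) * X ^+ 2).
  apply: mulr_ge0; first by rewrite mulr_ge0// ltW.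
  by rewrite mulr_ge0 ?sqr_ge0// divr_ge0 ?(ltW p0)// mulr_ge0// ltW.
rewrite (_ : kp * _ * (_ + _ + _) = kp * l `^ (- alpha) * (a * (1 - E) * X + l * E * Hh) +
   kp * l `^ (- alpha) * (p / (8 * gm) * X ^+ 2)); last by ring.
move=> main.
have Xlow : y0 * gm / 2 + kp * l `^ (- alpha) * (p / (8 * gm) * X ^+ 2) <= X.
  by move: err; rewrite ler_norml => /andP[e1 _]; move: main e1; lra.
have Xy : y0 * gm / 2 <= X by apply: le_trans Xlow; rewrite lerDl.
have X2 : (y0 * gm / 2) ^+ 2 <= X ^+ 2.
  by rewrite lerXn2r ?nnegrE ?(ltW yg0)//; exact: le_trans (ltW yg0) Xy.
have : l `^ (- alpha) * V <= kp * l `^ (- alpha) * (p / (8 * gm) * X ^+ 2).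
  rewrite /V [X in X <= _](_ : _ = kp * l `^ (- alpha) * (p / (8 * gm) * (y0 * gm / 2) ^+ 2)); last by ring.
  rewrite ler_wpM2l//; first by rewrite mulr_ge0// ltW.
  by rewrite ler_wpM2l// divr_ge0 ?(ltW p0)// mulr_ge0// ltW.
have : r * gm <= l `^ (- alpha) * V.
  rewrite powRN (mulrC _ V) ler_pdivlMr ?powR_gt0// mulrC -ler_pdivlMr//.
  exact: H2.
have := le_trans (ler_norm X) XB; lra.
Qed.

(** At order 1 the errors no longer vanish with [l], and the initial value is put
    at the equilibrium: the positive contribution of a pulse history alone makes
    the quadratic inequality for the Abel mean unsolvable at low frequencies. *)
Lemma unstable_degenerate_integer : alpha = 1 -> unstable alpha tau F xs.
Proof.
move=> al_1 st.
have mean phi y l := @abel_mean_inequality phi y l; have bnd := Lap_bound.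
move: K0 g10 mean bnd; move: (K) (g1) => kp gm kp0 gm0 mean bnd.
have [rho rho0 H] := confined_solution al0 al1 (ltW tau0) FE tau0 r0 st.
pose k1 := Num.min rho (c / (2 * eps)).
have k10 : 0 < k1 by rewrite lt_min rho0 divr_gt0// mulr_gt0.
pose k := if 0 <= b then k1 else - k1.
have kn : `|k| = k1 by rewrite /k; case: ifP => _; rewrite ?normrN gtr0_norm.
have kc : `|k| <= c / (2 * eps) by rewrite kn ge_min lexx orbT.
have krho : `|k| <= rho by rewrite kn ge_min lexx.
have kn0 : k != 0 by rewrite -normr_gt0 kn.
have bk : 0 <= b * k.
  rewrite /k; case: (leP 0 b) => b0; first by rewrite mulr_ge0// ltW.
  by rewrite mulrN oppr_ge0 mulr_le0_ge0// ltW.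
have [phi1 dphi] := pulse_datum tau0 k.
have P0 : pulse tau k 0 = 0 by apply: pulse_out => //; left.
have Pt : pulse tau k (- tau) = 0 by apply: pulse_out => //; right.
have [||y [z [my _ yr _]]] := H _ _ dphi.
- by move=> t; apply: le_trans krho; exact: pulse_norm.
- by rewrite Pt P0 /PA /PB !mulr0 subrr subr0 !addr0.
have phi_ge t : 0 <= t -> pulse tau k t = pulse tau k 0.
  by move=> t0; rewrite P0; apply: pulse_out => //; left.
have hp := hist_pulse_gt0 tau0 c0 eps0 kn0 kc bk.
set h0 := hist 0 tau _ in hp.
pose K1 := 1 + kp * `|a| * tau.
pose c1 := kp * (p / (8 * gm)); pose c2 := kp * (9 / 10) * h0.
have K10 : 0 < K1 by apply: ltr_wpDr => //; apply: mulr_ge0; [rewrite mulr_ge0// ltW|exact: ltW].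
have c10 : 0 < c1 by rewrite mulr_gt0// divr_gt0// mulr_gt0.
have c20 : 0 < c2 by rewrite mulr_gt0// mulr_gt0// divr_gt0.
pose l := Num.min (1 / (10 * tau)) (2 * c1 * c2 / K1 ^+ 2).
have l0 : 0 < l.
  rewrite lt_min; apply/andP; split; first by rewrite divr_gt0// mulr_gt0.
  by rewrite divr_gt0 ?exprn_gt0// mulr_gt0// mulr_gt0.
have lt : l * tau <= 1 / 10.
  have : l <= 1 / (10 * tau) by rewrite /l ge_min lexx.
  by rewrite ler_pdivlMr ?mulr_gt0//; lra.
have lc : l * K1 ^+ 2 <= 2 * c1 * c2.
  by rewrite -ler_pdivlMr ?exprn_gt0// /l ge_min lexx orbT.
have := mean _ _ _ my yr phi_ge l0 lt; rewrite P0 /= mul0r add0r.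
set X := l * Lap l y; set E := expR (- (l * tau)); set Hh := hist _ _ _.
have HH : h0 <= Hh by exact: hist_pulse_ge.
rewrite al_1 powR_inv1 ?(ltW l0)//.
have E9 : 9 / 10 <= E by have := expR_ge1Dx (- (l * tau)); rewrite -/E; lra.
have E2 : 1 - E <= l * tau by have := expR_ge1Dx (- (l * tau)); rewrite -/E; lra.
have E11 : 0 <= 1 - E by rewrite subr_ge0 -expR0 ler_expR oppr_le0 mulr_ge0// ltW.
rewrite (_ : kp / l * _ = kp * a * ((1 - E) / l) * X + c1 * X ^+ 2 / l + kp * E * Hh); last first.
  by rewrite /c1; field; rewrite !gt_eqF.
move=> main.
have h1 : - (kp * `|a| * tau * `|X|) <= kp * a * ((1 - E) / l) * X.
  rewrite lerNl; apply: le_trans (ler_norm _) _; rewrite normrN normrM (normrM (kp * a)) (normrM kp) (gtr0_norm kp0).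
  rewrite ler_wpM2r// ler_wpM2l//; first by rewrite mulr_ge0// ltW.
  by rewrite ger0_norm ?divr_ge0 ?(ltW l0)// ler_pdivrMr// mulrC.
have h2 : c2 <= kp * E * Hh.
  rewrite /c2; apply: ler_pM => //; rewrite ?(ltW hp)//.
    by rewrite mulr_ge0 ?divr_ge0// ltW.
  by rewrite ler_pM2l.
have key : c1 * X ^+ 2 / l + c2 <= K1 * `|X|.
  by have := ler_norm X; move: main h1 h2; rewrite /K1 mulrDl mul1r; lra.
have X2 : X ^+ 2 = `|X| ^+ 2 by rewrite real_normK// num_real.
move: key; rewrite X2; move: (normr_ge0 X); set x := `|X| => x0 key.
have key' : c1 * x ^+ 2 + l * c2 <= l * K1 * x.
  rewrite -(mulrA l); apply: le_trans (ler_wpM2l (ltW l0) key).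
  by rewrite mulrDr (mulrC l (_ / l)) divfK// lt0r_neq0.
have sq : 0 <= (2 * c1 * x - l * K1) ^+ 2 by exact: sqr_ge0.
have := ler_wpM2l (ltW c10) key'.
have lcc := ler_wpM2l (ltW l0) lc.
have pos : 0 < l * c1 * c2 by apply: mulr_gt0 => //; exact: mulr_gt0.
rewrite sqrrB in sq; move: sq lcc pos.
rewrite (_ : (2 * c1 * x) ^+ 2 = 4 * (c1 * (c1 * x ^+ 2))); last by ring.
rewrite (_ : 2 * c1 * x * (l * K1) *+ 2 = 4 * (c1 * (l * K1 * x))); last by rewrite -mulr_natl; ring.
rewrite (_ : (l * K1) ^+ 2 = l * (l * K1 ^+ 2)); last by ring.
rewrite (_ : l * (2 * c1 * c2) = 2 * (l * c1 * c2)); last by ring.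
rewrite (_ : c1 * (c1 * x ^+ 2 + l * c2) = c1 * (c1 * x ^+ 2) + l * c1 * c2); last by ring.
lra.
Qed.
End DegenerateEquilibrium.

(** * Linear responses *)
Section LinearResponse.
Context {R : realType}.
Implicit Types (s t l : R) (f g h u v w phi : R -> R).

Definition C1 f f1 := (forall t : R, is_derive t 1 f (f1 t)) /\ continuous f1.

Lemma C1_continuous f f1 : C1 f f1 -> continuous f.
Proof.
by move=> [df _] t; apply: differentiable_continuous; apply/derivable1_diffP; case: (df t).
Qed.

Lemma pos_ramp f : f 0 = 0 -> pos f = f \o @ramp R.
Proof.
move=> f0; apply/funext => t /=; have [t0|t0] := ltP 0 t.
  by rewrite posE// rampE// ltW.
by rewrite pos_le0// ramp_le0.
Qed.

Lemma pos_continuous f : continuous f -> f 0 = 0 -> continuous (pos f).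
Proof.
move=> cf f0; rewrite pos_ramp// => t.
by apply: continuous_comp; [exact: ramp_continuous|exact: cf].
Qed.

(** At 0, the difference quotients of the truncated function are 0 or those of
    [f]. *)
Lemma C1_pos f f1 : C1 f f1 -> f 0 = 0 -> f1 0 = 0 -> C1 (pos f) (pos f1).
Proof.
move=> [df cf1] f0 f10; split; last exact: pos_continuous.
move=> s; have [s0|s0|<-] := ltgtP 0 s.
- rewrite posE//; apply: near_eq_is_derive (df s); near=> t; rewrite posE//.
  by near: t; exact: lt_nbhsr.
- rewrite pos_le0 ?ltW//.
  have h : is_derive s 1 (cst 0 : R -> R) 0 by exact: is_derive_cst.
  apply: near_eq_is_derive h; near=> t; rewrite pos_le0// ltW//.
  by near: t; exact: lt_nbhsl.
rewrite pos_le0//.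
have H : (fun h : R => h^-1 *: (pos f (h *: (1:R) + 0) - pos f 0)) @ 0^' --> (0:R).
  have [/cvg_ex[l hl] El] := df 0.
  have E : l = 0 by rewrite -f10 -El; apply/esym/cvg_lim.
  move: hl; rewrite E => /cvgrPdist_lt hl.
  apply/cvgrPdist_lt => e e0; have := hl e e0; apply: filterS => h /=.
  rewrite !(pos_le0 f (lexx 0)) f0 !sub0r !normrN !subr0.
  apply: le_lt_trans.
  rewrite /GRing.scale/= !normrM ler_wpM2l// /pos; case: ifP => // _.
  by rewrite normr0.
split; first by apply/cvg_ex; exists 0.
by apply/cvg_lim.
Unshelve. all: by end_near. Qed.

Lemma C1M f f1 g g1 : C1 f f1 -> C1 g g1 ->
  C1 (fun t => f t * g t) (fun t => f t * g1 t + g t * f1 t).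
Proof.
move=> cf cg; have [df cf1] := cf; have [dg cg1] := cg; split.
  by move=> t; have := is_deriveM (df t) (dg t).
move=> t; apply: cvgD; apply: cvgM; [|exact: cg1| |exact: cf1].
  exact: C1_continuous cf t.
exact: C1_continuous cg t.
Qed.

Lemma C1D f f1 g g1 : C1 f f1 -> C1 g g1 ->
  C1 (fun t => f t + g t) (fun t => f1 t + g1 t).
Proof.
move=> [df cf1] [dg cg1]; split; last by move=> t; apply: cvgD; [exact: cf1|exact: cg1].
by move=> t; have := is_deriveD (df t) (dg t).
Qed.

Lemma C1Z k f f1 : C1 f f1 -> C1 (fun t => k * f t) (fun t => k * f1 t).
Proof.
move=> [df cf1]; split; last by move=> t; apply: cvgM; [exact: cvg_cst|exact: cf1].
by move=> t; have := is_deriveZ k (df t).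
Qed.

Lemma C1_affine k l f f1 : C1 f f1 -> C1 (fun t => f (k * t + l)) (fun t => f1 (k * t + l) * k).
Proof.
move=> [df cf1]; split; first by move=> t; exact: is_derive_affine.
move=> t; apply: cvgM; last exact: cvg_cst.
by apply: (@continuous_comp _ _ _ (fun t => k * t + l) f1); [exact: affine_continuous|exact: cf1].
Qed.

Lemma C1_shift d f f1 : C1 f f1 -> C1 (fun t => f (t + d)) (fun t => f1 (t + d)).
Proof.
move=> h; have := C1_affine 1 d h.
by under eq_fun do rewrite mul1r; under [X in C1 _ X]eq_fun do rewrite mul1r mulr1.
Qed.

Lemma C1_compact_datum (tau : R) f f1 : 0 < tau -> C1 f f1 ->
  (forall t, 0 <= t \/ t <= - tau -> f t = 0 /\ f1 t = 0) -> datum tau f f1.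
Proof.
move=> tau0 Cf out; have [df cf1] := Cf.
have bnd g : continuous g -> (forall t, 0 <= t \/ t <= - tau -> g t = 0) ->
    exists2 M, 0 <= M & forall t, `|g t| <= M.
  move=> cg g0; have [M M0 HM] := continuous_bounded tau (@continuous_shift _ tau g cg).
  exists M => // t; have [t0|t0] := leP 0 t; first by rewrite g0 ?normr0//; left.
  have [tt|tt] := leP t (- tau); first by rewrite g0 ?normr0//; right.
  by have := HM (t + tau); rewrite addrK; apply; lra.
have [M M0 HM] := bnd f (C1_continuous Cf) (fun t o => (out t o).1).
have [M' M'0 HM'] := bnd f1 cf1 (fun t o => (out t o).2).
split=> //.
- exists (M + M') => t; split.
    by apply: le_trans (HM t) _; rewrite lerDl.
  by apply: le_trans (HM' t) _; rewrite lerDr.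
- by move=> t t0; rewrite !(out _ (or_introl _)).1// (out _ (or_introl _)).2.
- by move=> E; move: tau0; rewrite E ltxx.
Qed.

(** An integrand that vanishes up to time [d] restarts at [d]; for other
    integrands the memory of the kernel spoils this. *)
Lemma conv_shift p g d t : (forall s, s <= d -> g s = 0) -> 0 <= d ->
  L1 (fun s => ker p (t + d - s) * pos g s) ->
  conv p g (t + d) = conv p (fun s => g (s + d)) t.
Proof.
move=> g0 d0 l; rewrite /conv -(Int_shift (- d) l); apply: Int_ext => s.
rewrite opprK (_ : t + d - (s + d) = t - s); last by ring.
congr (_ * _).
have [s0|s0] := ltP 0 s; first by rewrite !posE// ltr_wpDr.
rewrite (pos_le0 _ s0) /pos; case: ifP => // _.
by rewrite g0// -subr_ge0 opprD addrCA subrr addr0 oppr_ge0.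
Qed.

Variables (alpha tau a b : R).
Hypotheses (al0 : 0 < alpha) (al1 : alpha <= 1) (tau0 : 0 < tau).
Let k := kap alpha.
Let k0 : 0 < k. Proof. exact: kap_gt0. Qed.

(** [v] is the solution of D^alpha v = b v (t - tau) + a v (t) + h (t) which
    vanishes on the past *)
Definition response h v := continuous v /\
  forall t, v t = k * conv alpha (fun s => b * v (s - tau) + a * v s + h s) t.

Definition linear_mild := mild alpha tau (fun x => b * x) (fun x => a * x).

Lemma response_le0 h v t : response h v -> t <= 0 -> v t = 0.
Proof. by move=> [_ E] t0; rewrite E conv_le0// mulr0. Qed.

Lemma linear_continuous u f : continuous u -> continuous f ->
  continuous (fun s => b * u (s - tau) + a * u s + f s).
Proof.
move=> cu cf s; apply: cvgD (cf s); apply: cvgD; apply: cvgM; try exact: cvg_cst.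
  exact: (@continuous_shift _ tau u cu s).
exact: cu.
Qed.

(** At a large exponential rate the right-hand side is a contraction. *)
Lemma gronwall : exists2 be, 0 < be & forall u f c T, 0 <= c ->
  continuous u -> continuous f -> (forall t, t <= 0 -> `|u t| <= c) ->
  (forall t, 0 < t -> t <= T ->
    u t = k * conv alpha (fun s => b * u (s - tau) + a * u s + f s) t) ->
  (forall s, 0 < s -> s <= T -> `|f s| <= c * expR (be * s)) ->
  forall t, 0 <= t -> t <= T -> `|u t| <= c * expR (be * t).
Proof.
pose L := `|b| + `|a| + 1.
have L0 : 0 < L by rewrite ltr_wpDl// addr_ge0.
have [be be0 Hbe] := qc_small 1 al0 al1 (divr_gt0 (@ltr01 R) (mulr_gt0 (ltr0n R 2) (mulr_gt0 k0 L0))).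
exists be => // u f c T c0 cu cf u_le uE fc t t0 tT.
have T0 : 0 <= T by exact: le_trans tT.
pose F s := `|u s| * expR (- (be * s)).
have [|ts] := @EVT_max R F 0 T T0.
  apply: continuous_subspaceT => s; apply: cvgM.
    by apply: cvg_norm; exact: cu.
  apply: (@continuous_comp _ _ _ (fun s => - (be * s)) expR); last exact: continuous_expR.
  by apply: cvgN; apply: cvgM; [exact: cvg_cst|exact: cvg_id].
rewrite in_itv/= => /andP[ts0 tsT] Fmax.
have uF s : `|u s| = F s * expR (be * s).
  by rewrite /F -mulrA -expRD addrC subrr expR0 mulr1.
rewrite uF ler_wpM2r ?expR_ge0//.
apply: le_trans (Fmax t _) _; first by rewrite in_itv/= t0.
set m := F ts in Fmax *.
have um s : 0 <= s -> s <= T -> `|u s| <= m * expR (be * s).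
  by move=> s0 sT; rewrite uF ler_wpM2r ?expR_ge0// Fmax// in_itv/= s0.
rewrite leNgt; apply/negP => cm.
have m0 : 0 < m by exact: le_lt_trans cm.
have tsp : 0 < ts.
  rewrite lt_neqAle ts0 andbT; apply/eqP => E.
  move: cm; rewrite /m /F -E mulr0 oppr0 expR0 mulr1; apply/negP; rewrite -leNgt.
  exact: u_le.
pose G s := b * u (s - tau) + a * u s + f s.
have cG : continuous G by exact: linear_continuous.
have Gm s : 0 < s -> s < ts -> `|G s| <= (L * m) * wt 1 be s.
  move=> s0 sts; have sT := ltW (lt_le_trans sts tsT).
  rewrite /wt ker1// mul1r.
  have e1 : 1 <= expR (be * s) by rewrite -expR0 ler_expR mulr_ge0 ?ltW.
  have h1 : `|u (s - tau)| <= m * expR (be * s).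
    have [st|st] := leP (s - tau) 0.
      apply: le_trans (u_le _ st) _; apply: le_trans (ltW cm) _.
      by rewrite ler_peMr// ltW.
    apply: le_trans (um _ (ltW st) _) _; first by have := tau0; lra.
    by rewrite ler_pM2l// ler_expR ler_pM2l//; have := tau0; lra.
  have h2 := um s (ltW s0) sT.
  have h3 : `|f s| <= m * expR (be * s).
    by apply: le_trans (fc s s0 sT) _; rewrite ler_wpM2r ?expR_ge0// ltW.
  apply: le_trans (ler_normD _ _) _.
  rewrite (_ : L * m * _ = (`|b| * (m * expR (be * s)) + `|a| * (m * expR (be * s))) + m * expR (be * s)); last by rewrite /L; ring.
  apply: lerD h3; apply: le_trans (ler_normD _ _) _; rewrite !normrM.
  by apply: lerD; exact: ler_wpM2l.
have mG : measurable_fun setT (pos G).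
  by apply: measurable_pos; exact: continuous_measurable_fun.
have := conv_bound al0 al1 (@ltr01 R) (lexx 1) be0 mG Gm tsp.
have : `|u ts| = k * `|conv alpha G ts| by rewrite uE// normrM (gtr0_norm k0).
rewrite uF -/m /wt ker1// mul1r.
move: (conv alpha G ts) => x.
have := Hbe be (lexx _); have := qc_ge0 1 be al0 al1.
move: (qc _ _ _) => q q0 qe E xb.
have : m * expR (be * ts) <= m / 2 * expR (be * ts).
  rewrite E; apply: le_trans (ler_wpM2l (ltW k0) xb) _.
  rewrite mulrA ler_wpM2r ?expR_ge0//.
  have : k * L * q <= 1 / 2.
    apply: (@le_trans _ _ (k * L * (1 / (2 * (k * L))))).
      by rewrite ler_wpM2l// mulr_ge0 ?ltW.
    by rewrite le_eqVlt; apply/orP; left; apply/eqP; field; rewrite !lt0r_neq0.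
  move=> h; have := ler_wpM2l (ltW m0) h.
  by rewrite (_ : m * (k * L * q) = k * (L * m * q)); [lra|ring].
by rewrite ler_pM2r ?expR_gt0//; lra.
Qed.
End LinearResponse.

(** * Growth rates of linear solutions *)
Section GrowthRates.
Context {R : realType}.
Implicit Types (s t l : R) (f g h u v w phi : R -> R).
Variables (alpha tau a b : R).
Hypotheses (al0 : 0 < alpha) (al1 : alpha <= 1) (tau0 : 0 < tau).
Let k := kap alpha.
Let k0 : 0 < k. Proof. exact: kap_gt0. Qed.

Definition in_window phi := forall t, 0 <= t \/ t <= - tau -> phi t = 0.

(** an exponential bound for all linear solutions started at the equilibrium,
    uniform in their histories *)
Definition growth nu C := forall phi phi1 M w, datum tau phi phi1 ->
  in_window phi -> 0 < M -> (forall t, `|phi t| <= M) ->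
  linear_mild alpha tau a b phi w ->
  forall t, 0 <= t -> `|w t| <= C * M * expR (nu * t).

Lemma linear_mildE phi w t : in_window phi -> linear_mild alpha tau a b phi w ->
  0 <= t -> w t = k * conv alpha (fun s => b * w (s - tau) + a * w s) t.
Proof. by move=> pw [_ _ E] t0; rewrite E pw ?add0r//; left. Qed.

Lemma growth_exists : exists2 be, 0 < be & growth be 1.
Proof.
have [be be0 H] := gronwall a b al0 al1 tau0; exists be => //.
move=> phi phi1 M w _ pw M0 phiM mw t t0; rewrite mul1r.
have [wphi cw _] := mw.
apply: (H w (fun=> 0) M t (ltW M0) cw) => //.
- exact: cst_continuous.
- by move=> s s0; rewrite wphi.
- move=> s s0 _; rewrite (linear_mildE pw mw (ltW s0)); congr (_ * _).
  by apply: conv_ext => x _ _; rewrite addr0.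
- by move=> s _ _; rewrite normr0 mulr_ge0 ?expR_ge0// ltW.
Qed.

(** Below a real root of the characteristic equation the Laplace transform of
    a linear solution would have to be finite at the root, where it has a
    pole. *)
Lemma growth_ge_root l nu C : b != 0 -> 0 < l -> 0 < nu ->
  l `^ alpha = k * gam alpha * (a + b * expR (- (l * tau))) -> growth nu C -> l <= nu.
Proof.
move=> bn0 l0 nu0 root gr; rewrite leNgt; apply/negP => nul.
have [phi1 dphi] := pulse_datum tau0 b.
have pw : in_window (pulse tau b) by move=> t; exact: pulse_out.
have P0 : pulse tau b 0 = 0 by apply: pw; left.
have [|w [z [mw _ _ _]]] := global_solution al0 al1 (ltW tau0) (linear_c11 b) (linear_c11 a) dphi.
  by move=> _; rewrite P0 pw ?mulr0 ?addr0//; right.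
have b0 : 0 < `|b| by rewrite normr_gt0.
have wg := gr _ _ _ _ dphi pw b0 (pulse_norm tau b) mw.
have [wphi cw _] := mw.
have C0 : 0 <= C.
  have := wg 0 (lexx 0); rewrite mulr0 expR0 mulr1 => /(le_trans (normr_ge0 _)).
  by rewrite pmulr_lge0.
have tw : tame nu ((C + 1) * `|b|) w.
  split=> // t t0.
    by rewrite wphi//; apply: le_trans (pulse_norm tau b t) _; rewrite ler_peMl// lerDr.
  apply: le_trans (wg t (ltW t0)) _.
  by rewrite ler_wpM2r ?expR_ge0// ler_wpM2r// lerDl.
have weak c C' : `|c| * C' <= (`|b| + `|a|) * C' -> tame nu (`|c| * C') (fun t => c * w t) ->
    tame nu ((`|b| + `|a|) * C') (fun t => c * w t).
  move=> cc [h1 h2 h3]; split=> // t t0; first by apply: le_trans (h2 t t0) cc.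
  by apply: le_trans (h3 t t0) _; rewrite ler_wpM2r ?expR_ge0.
have D0 : 0 <= (C + 1) * `|b| by rewrite mulr_ge0// addr_ge0.
have tb : tame nu ((`|b| + `|a|) * ((C + 1) * `|b|)) (fun t => b * w t).
  by apply: weak (tameZ b tw); rewrite ler_wpM2r// lerDl.
have ta : tame nu ((`|b| + `|a|) * ((C + 1) * `|b|)) (fun t => a * w t).
  by apply: weak (tameZ a tw); rewrite ler_wpM2r// lerDr.
have phi_ge t : 0 <= t -> pulse tau b t = pulse tau b 0.
  by move=> t0; rewrite P0; apply: pw; left.
have := mild_laplace al0 al1 (ltW tau0) nu0 nul mw phi_ge tb ta.
rewrite P0 mul0r add0r (LapZ b nu0 nul tw) (LapZ a nu0 nul tw).
set H := hist _ _ _; set W := Lap l w; set E := expR _ => ti.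
have H0 : 0 < H.
  have [df _ _ _ _] := dphi.
  have cp : continuous (fun t => b * pulse tau b t).
    move=> t; apply: cvgM; first exact: cvg_cst.
    by apply: differentiable_continuous; apply/derivable1_diffP; case: (df t).
  have pp t : b * pulse tau b t = b ^+ 2 * pulse tau 1 t by rewrite pulseE; ring.
  have b2 : 0 < b ^+ 2 by rewrite exprn_even_gt0.
  have p0 t : 0 <= b * pulse tau b t.
    by rewrite pp mulr_ge0 ?(ltW b2)//; have /andP[] := pulse_01 tau t.
  rewrite /H (hist_ext _ _ (g := fun t => b * pulse tau b t)); last by move=> t t0; rewrite wphi.
  apply: lt_le_trans (hist_ge tau (ltW l0) cp p0).
  apply: (@hist_gt0 _ tau _ (- tau * 5 / 8) (- tau / 2) (b ^+ 2 * (1 / 2))) => //.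
  - by have := tau0; lra.
  - by have := tau0; lra.
  - by have := tau0; lra.
  - by rewrite mulr_gt0.
  - by move=> t /(pulse_mid tau0) h; rewrite pp ler_pM2l.
have lp : 0 < l `^ alpha by rewrite powR_gt0.
have K0 : 0 < k * gam alpha by rewrite mulr_gt0// gam_gt0.
have : l `^ alpha * W = l `^ alpha * W + k * gam alpha * (E * H).
  rewrite {1}ti powRN -/k.
  rewrite [LHS](_ : _ = k * gam alpha * (a + b * E) * W + k * gam alpha * (E * H)); last first.
    by field; exact: lt0r_neq0.
  by rewrite root.
have : 0 < k * gam alpha * (E * H) by apply: mulr_gt0 => //; rewrite mulr_gt0// expR_gt0.
by move=> h e; move: h; rewrite -(ltrD2l (l `^ alpha * W)) -e addr0 ltxx.
Qed.

(** At small [l] the left-hand side is the smaller one since [0 < a + b], and it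
    is the larger one for large [l]. *)
Lemma characteristic_root : 0 < a + b -> exists2 l, 0 < l &
  l `^ alpha = k * gam alpha * (a + b * expR (- (l * tau))).
Proof.
move=> ab0; pose K := k * gam alpha.
have K0 : 0 < K by rewrite mulr_gt0// gam_gt0.
pose D l := l `^ alpha - K * (a + b * expR (- (l * tau))).
have E01 l : 0 <= l -> 0 <= 1 - expR (- (l * tau)) <= l * tau.
  move=> l0; rewrite subr_ge0 -expR0 ler_expR oppr_le0 (mulr_ge0 l0 (ltW tau0))/=.
  by have := expR_ge1Dx (- (l * tau)); rewrite expR0; lra.
have [l1 l10 H1] := powR_small al0 (mulr_gt0 K0 (divr_gt0 ab0 (ltr0n R 2))).
pose lo := Num.min l1 ((a + b) / (2 * tau * (`|b| + 1))).
have lo0 : 0 < lo.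
  by rewrite lt_min l10 divr_gt0// mulr_gt0 ?mulr_gt0// ltr_wpDl.
have Dlo : D lo <= 0.
  rewrite subr_le0; apply: le_trans (H1 _ lo0 _) _; first by rewrite ge_min lexx.
  rewrite ler_pM2l//.
  have /andP[h1 h2] := E01 lo (ltW lo0).
  have h3 : lo * (2 * tau * (`|b| + 1)) <= a + b.
    by rewrite -ler_pdivlMr ?mulr_gt0 ?ltr_wpDl// ge_min lexx orbT.
  have h4 : b * (1 - expR (- (lo * tau))) <= `|b| * (lo * tau).
    apply: le_trans (ler_wpM2l (normr_ge0 b) h2).
    by rewrite ler_wpM2r// ler_norm.
  have := mulr_ge0 (ltW lo0) (ltW tau0); move: h3 h4; set e := expR _; nra.
pose hi := (lo `^ alpha + K * (`|a| + `|b|)) `^ alpha^-1.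
have lp : 0 < lo `^ alpha by rewrite powR_gt0.
have S0 : 0 <= K * (`|a| + `|b|) by rewrite mulr_ge0 ?addr_ge0// ltW.
have hip : hi `^ alpha = lo `^ alpha + K * (`|a| + `|b|).
  by rewrite -powRrM mulVf ?gt_eqF// powRr1// addr_ge0// ltW.
have lohi : lo <= hi.
  rewrite -[lo]powRr1 ?(ltW lo0)// -(mulfV (lt0r_neq0 al0)) powRrM.
  apply: ge0_ler_powR; rewrite ?nnegrE ?invr_ge0 ?powR_ge0 ?(ltW al0)//.
    by rewrite addr_ge0// ltW.
  by rewrite lerDl.
have hi0 : 0 < hi by exact: lt_le_trans lohi.
have Dhi : 0 <= D hi.
  rewrite /D hip subr_ge0; apply: (@le_trans _ _ (K * (`|a| + `|b|))); last by rewrite lerDr ltW.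
  rewrite ler_pM2l//; apply: lerD; first exact: ler_norm.
  apply: le_trans (ler_norm _) _; rewrite normrM ler_piMr// ger0_norm ?expR_ge0//.
  by rewrite -expR0 ler_expR oppr_le0 mulr_ge0// ltW.
have [||l] := @IVT R D lo hi 0 lohi.
- have cD l : 0 < l -> {for l, continuous D}.
    move=> l0; apply: (@continuousB _ _ _ (fun x => x `^ alpha)).
      by apply: differentiable_continuous; apply/derivable1_diffP; case: (is_derive1_powR alpha l0).
    apply: cvgM; first exact: cvg_cst.
    apply: cvgD; first exact: cvg_cst.
    apply: cvgM; first exact: cvg_cst.
    apply: (@continuous_comp _ _ _ (fun l => - (l * tau)) expR); last exact: continuous_expR.
    by apply: cvgN; apply: cvgM; [exact: cvg_id|exact: cvg_cst].
  apply: continuous_in_subspaceT => l; rewrite inE/= in_itv/= => /andP[h _].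
  by apply: cD; exact: lt_le_trans h.
- by rewrite (min_l (le_trans Dlo Dhi)) (max_r (le_trans Dlo Dhi)) Dlo.
rewrite in_itv/= => /andP[ll _] /eqP; rewrite subr_eq0 => /eqP E.
by exists l => //; exact: lt_le_trans ll.
Qed.

(** Three quarters of the infimum i of all rates: linear solutions exceed this
    rate, while twice of it, being larger than i, bounds them with some room.
    The infimum is positive by the characteristic root. *)
Lemma growth_threshold : b != 0 -> 0 < a + b -> exists om nu C,
  [/\ 0 < om, 0 < nu, nu < 2 * om, growth nu C & forall C', ~ growth om C'].
Proof.
move=> bn0 ab0; have [l l0 root] := characteristic_root ab0.
pose E := [set nu | 0 < nu /\ exists C, growth nu C].
have [be be0 gb] := growth_exists.
have E0 : E !=set0 by exists be; split=> //; exists 1.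
have lE : l <= inf E.
  by apply: lb_le_inf => // nu [nu0 [C gC]]; exact: growth_ge_root gC.
have i0 : 0 < inf E by exact: lt_le_trans lE.
have lbE : has_lbound E by exists 0 => x [/ltW].
have [|nu [nu0 [C gC]] nui] := @inf_lt _ E (3 / 2 * inf E) E0; first lra.
exists (3 / 4 * inf E), nu, C; split=> //; try lra.
move=> C' gC'; have : inf E <= 3 / 4 * inf E.
  by apply: ge_inf => //; split; [lra|exists C'].
lra.
Qed.
End GrowthRates.

(** * Superposition of linear solutions *)
Section Superposition.
Context {R : realType}.
Implicit Types (s t l : R) (f g h u v w phi : R -> R).
Variables (alpha tau a b : R).
Hypotheses (al0 : 0 < alpha) (al1 : alpha <= 1) (tau0 : 0 < tau).
Let k := kap alpha.
Let sg := tau / 2.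
Let sg0 : 0 < sg. Proof. by rewrite divr_gt0. Qed.

(** rises from 0 to 1 during the second half of the first delay interval *)
Definition cut s : R := smoothstep (4 / tau * s + - 2).
Definition cut' s : R := smoothstep' (4 / tau * s + - 2) * (4 / tau).

Lemma cut_C1 : C1 cut cut'.
Proof.
apply: C1_affine; split; last exact: smoothstep'_continuous.
by move=> t; exact: smoothstep_derive.
Qed.

Lemma cut_le s : s <= sg -> cut s = 0 /\ cut' s = 0.
Proof.
move=> ss; have h : 4 / tau * s + - 2 <= 0; last first.
  by rewrite /cut /cut' (smoothstep_le0 h).1 (smoothstep_le0 h).2 mul0r.
rewrite -subr_ge0 (_ : _ - _ = 4 / tau * (sg - s)); last first.
  by rewrite /sg; field; exact: lt0r_neq0.
by rewrite mulr_ge0 ?subr_ge0// divr_ge0// ltW.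
Qed.

Lemma cut_ge s : tau <= s -> cut s = 1 /\ cut' s = 0.
Proof.
move=> ss; have h : 2 <= 4 / tau * s + - 2.
  rewrite -subr_ge0 (_ : _ - _ = 4 / tau * (s - tau)); last by field; exact: lt0r_neq0.
  by rewrite mulr_ge0 ?subr_ge0// divr_ge0// ltW.
by rewrite /cut /cut' (smoothstep_ge2 h).1 (smoothstep_ge2 h).2 mul0r.
Qed.

Lemma cut_01 s : 0 <= cut s <= 1.
Proof. exact: smoothstep_01. Qed.

(** The part of the forcing in the first delay interval is the feedback of a
    suitable initial history; what is left vanishes for half a delay more. *)
Lemma peel h h1 v : b != 0 -> C1 h h1 -> (forall t, t <= 0 -> h t = 0) ->
  (forall t, t <= 0 -> h1 t = 0) -> response alpha tau a b h v ->
  exists phi phi1 w, [/\ datum tau phi phi1, in_window tau phi,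
    linear_mild alpha tau a b phi w,
    forall t, phi t = b^-1 * (h (t + tau) * (1 - cut (t + tau))) &
    response alpha tau a b (fun t => h (t + sg) * cut (t + sg))
      (fun t => v (t + sg) - pos w (t + sg))].
Proof.
move=> bn0 Ch h_le h1_le rv; have [cv vE] := rv.
pose g t := h t * (1 + - 1 * cut t).
have [Cg1 Cg] : exists g1, C1 g g1 /\ forall t, (t <= 0 \/ tau <= t) -> g1 t = 0.
  have C1c : C1 (fun=> 1 : R) (fun=> 0).
    by split; [move=> t; exact: is_derive_cst|exact: cst_continuous].
  eexists; split; first exact: C1M Ch (C1D C1c (C1Z (- 1) cut_C1)).
  move=> t [t0|tt] /=; first by rewrite h_le// h1_le// mul0r mulr0 addr0.
  by have [-> ->] := cut_ge tt; ring.
have [Cgg g1_out] := Cg.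
pose phi t := b^-1 * g (t + tau); pose phi1 t := b^-1 * Cg1 (t + tau).
have g_out t : t <= 0 \/ tau <= t -> g t = 0.
  move=> [t0|tt]; rewrite /g; first by rewrite h_le// mul0r.
  by have [-> _] := cut_ge tt; ring.
have sh t : 0 <= t \/ t <= - tau -> t + tau <= 0 \/ tau <= t + tau.
  by move=> [t0|t0]; [right; rewrite lerDr|left; lra].
have pw : in_window tau phi by move=> t /sh/g_out e; rewrite /phi e mulr0.
have dphi : datum tau phi phi1.
  apply: C1_compact_datum => //.
    exact: C1Z (C1_shift tau Cgg).
  by move=> t o; split; [exact: pw|rewrite /phi1 g1_out ?mulr0//; exact: sh].
have p0 : phi 0 = 0 by apply: pw; left.
have pt : phi (- tau) = 0 by apply: pw; right.
have [|w [z [mw _ _ _]]] := global_solution al0 al1 (ltW tau0) (linear_c11 b) (linear_c11 a) dphi.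
  by move=> _; rewrite p0 pt !mulr0 addr0.
exists phi, phi1, w; split=> //.
  by move=> t; rewrite /phi /g mulN1r.
have [wphi cw _] := mw.
have w0 : w 0 = 0 by rewrite wphi.
pose v' t := v t - pos w t.
have cpw := pos_continuous cw w0.
have cv' : continuous v' by move=> t; apply: cvgB; [exact: cv|exact: cpw].
pose r t := h t * cut t.
have cr : continuous r := C1_continuous (C1M Ch cut_C1).
have rv' : response alpha tau a b r v'.
  split=> // t; rewrite /v' vE.
  have -> : pos w t = k * conv alpha (fun s => b * w (s - tau) + a * w s) t.
    have [t0|t0] := ltP 0 t; first by rewrite posE// (linear_mildE pw mw (ltW t0)).
    by rewrite pos_le0// conv_le0// mulr0.
  rewrite -mulrBr; congr (_ * _).
  have cl : continuous (fun s => b * w (s - tau) + a * w s).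
    move=> s; apply: cvgD; apply: cvgM; try exact: cvg_cst; last exact: cw.
    exact: (@continuous_shift _ tau w cw s).
  rewrite -convB; last 2 first.
  - exact: L1_conv_continuous (linear_continuous cv (C1_continuous Ch)).
  - exact: L1_conv_continuous cl.
  apply: conv_ext => s s0 _; rewrite /v' (posE w s0).
  have : b * (w (s - tau) - pos w (s - tau)) = h s * (1 - cut s).
    have [st|st] := ltP 0 (s - tau).
      rewrite posE// subrr mulr0 (cut_ge _).1 ?subrr ?mulr0//.
      by rewrite -subr_ge0 ltW.
    rewrite (pos_le0 _ st) subr0 wphi// /phi subrK mulVKf// /g.
    by rewrite mulN1r.
  rewrite /r; move: (pos w (s - tau)) (w (s - tau)) (v (s - tau)) => x1 x2 x3 e.
  lra.
have [be be0 gw] := gronwall a b al0 al1 tau0.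
have v'_le t : t <= sg -> v' t = 0.
  have [t0|t0] := leP t 0; first by move=> _; exact: response_le0 rv' t0.
  move=> ts; have := gw v' r 0 sg (lexx 0) cv' cr _ _ _ t (ltW t0) ts.
  rewrite mul0r normr_le0 => H; apply/eqP/H.
  - by move=> s s0; rewrite (response_le0 rv' s0) normr0.
  - by move=> s _ _; have [_ ->] := rv'.
  - by move=> s _ ss; rewrite mul0r /r (cut_le ss).1 mulr0 normr0.
split.
  have -> : (fun t => v (t + sg) - pos w (t + sg)) = fun t => v' (t - - sg).
    by apply/funext => t; rewrite opprK.
  exact: continuous_shift.
move=> t; rewrite -/(v' (t + sg)) (rv'.2 (t + sg)) (@conv_shift _ _ _ sg) ?(ltW sg0)//.
- by congr (_ * _); apply: conv_ext => s _ _; rewrite /v' /r (addrAC s sg (- tau)).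
- move=> s ss; rewrite /r (cut_le ss).1 (v'_le s ss) (v'_le (s - tau)) ?mulr0 ?addr0 ?mulr0//.
  by apply: le_trans ss; rewrite gerBl ltW.
- exact: L1_conv_continuous (linear_continuous cv' cr).
Qed.

(** Superposition of shifted linear solutions: forcing that grows faster than
    every linear solution dictates the rate of the response. *)
Lemma forced_growth nu nu' C : b != 0 -> 0 < nu -> nu < nu' ->
  growth alpha tau a b nu C ->
  exists2 C', 0 < C' & forall h h1 v H t0, C1 h h1 -> (forall t, t <= 0 -> h t = 0) ->
    (forall t, t <= 0 -> h1 t = 0) ->
    response alpha tau a b h v -> 0 < H -> 0 <= t0 ->
    (forall s, 0 < s -> s <= t0 -> `|h s| <= H * expR (nu' * s)) ->
    `|v t0| <= C' * H * expR (nu' * t0).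
Proof.
move=> bn0 nu0 nn gr; have [be be0 gw] := gronwall a b al0 al1 tau0.
have b0 : 0 < `|b| by rewrite normr_gt0.
pose M := `|C| * (expR (nu' * tau) / `|b|).
have M0 : 0 <= M by rewrite mulr_ge0// divr_ge0// expR_ge0.
pose q := expR ((nu' - nu) * sg) - 1.
have q0 : 0 < q by rewrite subr_gt0 -expR0 ltr_expR mulr_gt0// subr_gt0.
pose N := M / q; have N0 : 0 <= N by rewrite divr_ge0// ltW.
pose B := expR ((nu' + be) * tau).
(* the subtracted term absorbs the response to the peeled pulse at each step *)
have key (n : nat) : forall h h1 v H t0, C1 h h1 -> (forall t, t <= 0 -> h t = 0) ->
    (forall t, t <= 0 -> h1 t = 0) ->
    response alpha tau a b h v -> 0 < H -> 0 <= t0 -> t0 < tau + n%:R * sg ->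
    (forall s, 0 < s -> s <= t0 -> `|h s| <= H * expR (nu' * s)) ->
    `|v t0| <= H * ((N + B) * expR (nu' * t0) - N * expR (nu * t0)).
  elim: n => [|n IH] h h1 v H t0 Ch h_le h1_le rv H0 t00.
    rewrite mul0r addr0 => tt hH; have [cv vE] := rv.
    have h1' : `|v t0| <= H * expR (nu' * tau) * expR (be * t0).
      apply: (gw v h _ t0) => //; first by rewrite mulr_ge0 ?expR_ge0// ltW.
      - exact: C1_continuous Ch.
      - by move=> s s0; rewrite (response_le0 rv s0) normr0 mulr_ge0 ?expR_ge0// ltW.
      - move=> s s0 st; apply: le_trans (hH s s0 st) _.
        apply: (@le_trans _ _ (H * expR (nu' * tau))).
          rewrite ler_pM2l// ler_expR ler_pM2l; last exact: lt_trans nn.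
          exact: ltW (le_lt_trans st tt).
        by rewrite ler_peMr ?mulr_ge0 ?expR_ge0 ?(ltW H0)// -expR0 ler_expR mulr_ge0 ?ltW.
    apply: le_trans h1' _; rewrite -mulrA ler_pM2l//.
    apply: (@le_trans _ _ B).
      by rewrite -expRD ler_expR mulrDl lerD2l ler_pM2l// ltW.
    have e1 : 1 <= expR (nu' * t0).
      by rewrite -expR0 ler_expR mulr_ge0// ltW// (lt_trans nu0).
    have e2 : expR (nu * t0) <= expR (nu' * t0) by rewrite ler_expR ler_wpM2r// ltW.
    have := ler_wpM2l N0 e2; have := ler_wpM2l (expR_ge0 ((nu' + be) * tau)) e1.
    rewrite -/B mulr1 mulrDl; lra.
  have [tt|tt] := ltP t0 tau.
    move=> _; apply: (IH h h1) => //; apply: lt_le_trans tt _.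
    by rewrite lerDl mulr_ge0// ltW.
  move=> tn hH.
  have [phi [phi1 [w [dphi pw mw phiE rv']]]] := peel bn0 Ch h_le h1_le rv.
  have t0p : 0 < t0 by exact: lt_le_trans tt.
  have st0 : sg <= t0 by apply: le_trans tt; rewrite /sg; have := tau0; lra.
  have P0 : 0 < H * (expR (nu' * tau) / `|b|) by rewrite mulr_gt0// divr_gt0// expR_gt0.
  have phiM t : `|phi t| <= H * (expR (nu' * tau) / `|b|).
    have [out|out] := pselect (0 <= t \/ t <= - tau); first by rewrite pw// normr0 ltW.
    have o1 : t < 0 by rewrite ltNge; apply/negP => e; apply: out; left.
    have o2 : - tau < t by rewrite ltNge; apply/negP => e; apply: out; right.
    have /andP[c1 c2] := cut_01 (t + tau).
    rewrite phiE normrM normfV (mulrA H) (mulrC _ (`|b|^-1)).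
    rewrite ler_pM2l ?invr_gt0// normrM (@ger0_norm _ (1 - _)) ?subr_ge0//.
    apply: (@le_trans _ _ `|h (t + tau)|); first by rewrite ler_piMr// gerBl.
    apply: le_trans (hH _ _ _) _; [lra|lra|].
    rewrite ler_pM2l// ler_expR ler_wpM2l ?(ltW (lt_trans nu0 nn))//; lra.
  have wt0 := gr _ _ _ _ dphi pw P0 phiM mw t0 t00.
  have nu'0 : 0 < nu' by exact: lt_trans nn.
  have := IH _ _ _ (H * expR (nu' * sg)) (t0 - sg) (C1_shift sg (C1M Ch cut_C1)) _ _ rv'.
  rewrite subrK posE// subr_ge0 => /(_ _ _ _ st0) IH'.
  set X := expR (nu' * t0); set Y := expR (nu * t0) in wt0 *.
  have E1 : expR (nu' * sg) * expR (nu' * (t0 - sg)) = X.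
    by rewrite -expRD; congr expR; ring.
  have E2 : expR (nu' * sg) * expR (nu * (t0 - sg)) = Y * (q + 1).
    by rewrite /q subrK -!expRD; congr expR; ring.
  have Nq : N * q = M by rewrite /N divfK// gt_eqF.
  have wt1 : `|w t0| <= H * M * Y.
    apply: le_trans wt0 _; rewrite ler_wpM2r ?expR_ge0// /M mulrCA.
    by rewrite ler_wpM2l ?(ltW H0)// ler_wpM2r ?divr_ge0 ?expR_ge0// ler_norm.
  have {}IH' : `|v t0 - w t0| <= H * ((N + B) * X - (N * Y + M * Y)).
    apply: (@le_trans _ _ (H * expR (nu' * sg) *
      ((N + B) * expR (nu' * (t0 - sg)) - N * expR (nu * (t0 - sg))))); last first.
      rewrite le_eqVlt; apply/orP; left; apply/eqP.
      rewrite -mulrA mulrBr (mulrCA _ (N + B)) (mulrCA _ N) E1 E2 -Nq; ring.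
    apply: IH'.
    - by move=> t tt0; rewrite (cut_le _).1 ?mulr0// gerDr.
    - by move=> t tt0; rewrite (cut_le _).1 ?(cut_le _).2 ?mul0r ?mulr0 ?addr0// gerDr.
    - by rewrite mulr_gt0// expR_gt0.
    - by move: tn; rewrite -natr1 mulrDl mul1r; lra.
    - move=> s s0 sts; rewrite normrM; have /andP[c1 c2] := cut_01 (s + sg).
      apply: (@le_trans _ _ `|h (s + sg)|); first by rewrite ler_piMr// ger0_norm.
      apply: le_trans (hH _ _ _) _; [by rewrite addr_gt0|lra|].
      by rewrite -mulrA -expRD; rewrite ler_pM2l// ler_expR; lra.
  have := ler_normD (w t0) (v t0 - w t0); rewrite addrC subrK.
  by move: wt1 IH'; lra.
exists (N + B); first by rewrite ltr_wpDl// expR_gt0.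
move=> h h1 v H t0 Ch h_le h1_le rv H0 t00 hH.
have tn : t0 < tau + (Num.bound (t0 / sg))%:R * sg.
  have := @archi_boundP R (t0 / sg); rewrite divr_ge0 ?(ltW sg0)// => /(_ isT).
  by rewrite ltr_pdivrMr//; have := tau0; lra.
apply: le_trans (key _ h h1 v H t0 Ch h_le h1_le rv H0 t00 tn hH) _.
rewrite (mulrC (N + B) H) -(mulrA H) ler_pM2l// gerBl mulr_ge0 ?expR_ge0//.
Qed.
End Superposition.

(** * The saddle case *)
Section Saddle.
Context {R : realType}.
Implicit Types (s t u v l : R).
Variables (alpha tau : R) (F : R -> R -> R) (xs a b c eps p : R).
Hypotheses (al0 : 0 < alpha) (al1 : alpha <= 1) (tau0 : 0 < tau).
Hypotheses (c0 : 0 < c) (eps0 : 0 < eps) (p0 : 0 < p).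
Hypothesis FE : forall u v, F (u + xs) (v + xs) = PA b c eps u + PB a p v.

Lemma datumZ e (phi phi1 : R -> R) : datum tau phi phi1 ->
  datum tau (fun t => e * phi t) (fun t => e * phi1 t).
Proof.
move=> [d cphi1 [M HM] phi_ge phi_c].
have [d' c'] := C1Z e (conj d cphi1); split=> //.
- by exists (`|e| * M) => t; rewrite !normrM; split; apply: ler_wpM2l => //; have [] := HM t.
- by move=> t t0; have [-> ->] := phi_ge t t0; rewrite mulr0.
- by move=> E t; have [-> ->] := phi_c E t; rewrite mulr0.
Qed.

(** the quadratic and cubic part of the right-hand side along [y] *)
Definition remainder (y : R -> R) t : R :=
  c * (y (t - tau) * y (t - tau)) + - eps * (y (t - tau) * y (t - tau) * y (t - tau)) +
  - p * (y t * y t).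

Lemma remainder_C1 y z : C1 y z -> y 0 = 0 -> y (- tau) = 0 ->
  exists2 g1, C1 (remainder y) g1 & g1 0 = 0.
Proof.
move=> Cy y0 yt; have Cd := C1_shift (- tau) Cy.
have C2 := C1M Cd Cd.
eexists; first exact: C1D (C1D (C1Z c C2) (C1Z (- eps) (C1M C2 Cd))) (C1Z (- p) (C1M Cy Cy)).
by rewrite /= sub0r y0 yt; ring.
Qed.

Lemma remainder_le y t M : M <= 1 -> `|y t| <= M -> `|y (t - tau)| <= M ->
  `|remainder y t| <= (c + eps + p) * M ^+ 2.
Proof.
rewrite /remainder; move: (y t) (y (t - tau)) => v u M1 vM uM.
have M0 : 0 <= M by exact: le_trans vM.
have u2 : `|u * u| <= M ^+ 2 by rewrite normrM expr2 ler_pM.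
have v2 : `|v * v| <= M ^+ 2 by rewrite normrM expr2 ler_pM.
have u3 : `|u * u * u| <= M ^+ 2.
  rewrite normrM; apply: le_trans u2; rewrite ler_piMr//; exact: le_trans M1.
have h1 := ler_wpM2l (ltW c0) u2; have h2 := ler_wpM2l (ltW eps0) u3.
have h3 := ler_wpM2l (ltW p0) v2.
apply: le_trans (ler_normD _ _) _; apply: (@le_trans _ _ (c * `|u * u| + eps * `|u * u * u| + p * `|v * v|)).
  apply: lerD; last by rewrite normrM normrN (gtr0_norm p0).
  apply: le_trans (ler_normD _ _) _.
  by rewrite (normrM c) (normrM (- eps)) normrN (gtr0_norm c0) (gtr0_norm eps0).
by rewrite !mulrDl; apply: lerD h3; apply: lerD.
Qed.

Section Trajectory.
Variables (r e : R) (phi w y : R -> R).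
Hypotheses (r0 : 0 < r) (pw : in_window tau phi).
Hypothesis mw : linear_mild alpha tau a b phi w.
Hypothesis my : mild alpha tau (TA b c eps r) (TB a p r) (fun t => e * phi t) y.
Hypothesis yr : forall t, `|y t| < r.

(** The deviation from the linear solution responds linearly to the nonlinear
    remainder. *)
Lemma deviation_response : response alpha tau a b (pos (remainder y)) (fun t => y t - e * w t).
Proof.
have [wphi cw wE] := mw; have [yphi cy yE] := my.
have cew : continuous (fun t => e * w t).
  by move=> t; apply: cvgM; [exact: cvg_cst|exact: cw].
split; first by move=> t; apply: cvgB; [exact: cy|exact: cew].
move=> t; have [t0|t0] := leP t 0; first by rewrite conv_le0// mulr0 yphi// wphi// subrr.
rewrite yE (linear_mildE pw mw (ltW t0)) pw; last by left; exact: ltW.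
rewrite mulr0 add0r mulrCA -mulrBr; congr (_ * _).
have cl : continuous (fun s => b * w (s - tau) + a * w s).
  move=> s; apply: cvgD; apply: cvgM; try exact: cvg_cst; last exact: cw.
  exact: (@continuous_shift _ tau w cw s).
have EG : Gof tau (TA b c eps r) (TB a p r) y = fun s => PA b c eps (y (s - tau)) + PB a p (y s).
  by apply/funext => s; rewrite /Gof TA_id ?TB_id// ltW.
have cG : continuous (Gof tau (TA b c eps r) (TB a p r) y).
  rewrite EG => s; apply: cvgD.
    apply: (@continuous_comp _ _ _ (fun s => y (s - tau)) (PA b c eps)); last exact: PA_continuous.
    exact: continuous_shift.
  by apply: (@continuous_comp _ _ _ y (PB a p)); [exact: cy|exact: PB_continuous].
rewrite -convZ; last exact: L1_conv_continuous.
rewrite -convB; [|exact: L1_conv_continuous|]; last first.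
  apply: L1_conv_continuous => // s.
  by apply: cvgM; [exact: cvg_cst|exact: cl].
apply: conv_ext => s s0 _; rewrite EG posE// /remainder /PA /PB.
move: (w (s - tau)) (w s) (y s) (y (s - tau)) => x1 x2 x3 x4; ring.
Qed.
End Trajectory.

(** The trajectory is followed up to a record time of the linear solution, at
    which the linear part has size [2 r] while the deviation is still at most
    half of it. *)
Lemma unstable_saddle : b != 0 -> 0 < a + b -> unstable alpha tau F xs.
Proof.
move=> bn0 ab0 st.
have [om [nu [C [om0 nu0 nuom gr ngr]]]] := growth_threshold al0 al1 tau0 bn0 ab0.
have [C' C'0 forced] := forced_growth al0 al1 tau0 bn0 nu0 nuom gr.
pose L := c + eps + p; have L0 : 0 < L by rewrite addr_gt0// addr_gt0.
have CL0 : 0 < C' * L by rewrite mulr_gt0.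
pose r := Num.min (1 / 3) (1 / (10 * (C' * L))).
have r0 : 0 < r by rewrite lt_min !divr_gt0// mulr_gt0.
have r3 : r <= 1 / 3 by rewrite ge_min lexx.
have rCL : C' * L * r <= 1 / 10.
  have : r <= 1 / (10 * (C' * L)) by rewrite ge_min lexx orbT.
  by rewrite ler_pdivlMr ?mulr_gt0//; lra.
have [rho1 rho10 Hsol] := confined_solution al0 al1 (ltW tau0) FE tau0 r0 st.
pose rho := Num.min rho1 (2 * r).
have rho0 : 0 < rho by rewrite lt_min rho10 mulr_gt0.
have rho_1 : rho <= rho1 by rewrite ge_min lexx.
have rho_r : rho <= 2 * r by rewrite ge_min lexx orbT.
apply: (ngr (2 * r / rho)) => phi phi1 M w dphi pw M0 phiM mw t1 t10.
rewrite leNgt; apply/negP => big.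
have [wphi cw wE] := mw.
(* the record time, and the amplitude that scales the record to [2 r] *)
pose D s := `|w s| * expR (- (om * s)).
have [|T] := @EVT_max R D 0 t1 t10.
  apply: continuous_subspaceT => s; apply: cvgM.
    by apply: cvg_norm; exact: cw.
  apply: (@continuous_comp _ _ _ (fun s => - (om * s)) expR); last exact: continuous_expR.
  by apply: cvgN; apply: cvgM; [exact: cvg_cst|exact: cvg_id].
rewrite in_itv/= => /andP[T0 Tt1] Dmax.
have wD s : `|w s| = D s * expR (om * s).
  by rewrite /D -mulrA -expRD addrC subrr expR0 mulr1.
have DT : 2 * r / rho * M < D T.
  apply: (@lt_le_trans _ _ (D t1)); last by apply: Dmax; rewrite in_itv/= t10 lexx.
  by move: big; rewrite wD ltr_pM2r ?expR_gt0.
have DT0 : 0 < D T.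
  by apply: le_lt_trans DT; rewrite mulr_ge0 ?divr_ge0 ?mulr_ge0// ltW.
have W0 : 0 < `|w T| by rewrite wD mulr_gt0// expR_gt0.
pose e := 2 * r / `|w T|.
have e0 : 0 < e by rewrite divr_gt0// mulr_gt0.
pose Th s := 2 * r * expR (- (om * (T - s))).
have Th0 s : 0 < Th s by rewrite /Th mulr_gt0 ?expR_gt0// mulr_gt0.
have Th_le s s' : s <= s' -> Th s <= Th s'.
  move=> ss; rewrite /Th ler_pM2l ?mulr_gt0// ler_expR lerN2 ler_pM2l//; lra.
have ThT s : s <= T -> Th s <= 2 * r.
  move=> /Th_le h; apply: le_trans h _.
  by rewrite /Th subrr mulr0 oppr0 expR0 mulr1.
have eD : e * D T * expR (om * T) = 2 * r by rewrite -mulrA -wD /e divfK// gt_eqF.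
have ThE s : Th s = e * D T * expR (om * s).
  rewrite /Th -eD -mulrA -expRD; congr (_ * expR _); ring.
have ew s : 0 <= s -> s <= T -> `|e * w s| <= Th s.
  move=> s0 sT; rewrite normrM (gtr0_norm e0) wD ThE -mulrA.
  rewrite ler_pM2l// ler_pM2r ?expR_gt0// Dmax// in_itv/= s0.
  exact: le_trans sT Tt1.
have ephi s : `|e * phi s| <= rho * expR (- (om * T)).
  rewrite normrM (gtr0_norm e0); apply: le_trans (ler_wpM2l (ltW e0) (phiM s)) _.
  have h : 2 * r * M <= rho * D T.
    by have := ltW DT; rewrite mulrAC ler_pdivrMr// mulrC (mulrC (D T)).
  rewrite /e mulrAC ler_pdivrMr// (_ : rho * _ * _ = rho * D T)//.
  by rewrite /D; ring.
have expT : expR (- (om * T)) <= 1.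
  by rewrite -expR0 ler_expR oppr_le0 mulr_ge0// ltW.
have [||y [z [my Cy yr _]]] := Hsol _ _ (datumZ e dphi).
- move=> s; apply: le_trans (ephi s) _; apply: le_trans rho_1.
  by rewrite ler_piMr// ltW.
- have p1 : phi 0 = 0 by apply: pw; left.
  have p2 : phi (- tau) = 0 by apply: pw; right.
  by rewrite p1 p2 /PA /PB !mulr0 subrr subr0 !addr0.
have [yphi cy _] := my.
have y0 : y 0 = 0 by rewrite yphi// pw ?mulr0//; left.
have yt : y (- tau) = 0 by rewrite yphi ?oppr_le0 ?(ltW tau0)// pw ?mulr0//; right.
have [g1 Cg g10] := remainder_C1 Cy y0 yt.
have g0 : remainder y 0 = 0 by rewrite /remainder sub0r y0 yt; ring.
have rv := deviation_response r0 pw mw my yr.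
have [cv _] := rv.
have cg : continuous (fun s => `|y s - e * w s| - 1 / 2 * Th s).
  move=> s; apply: cvgB; first by apply: cvg_norm; exact: cv.
  apply: cvgM; first exact: cvg_cst.
  apply: cvgM; first exact: cvg_cst.
  apply: (@continuous_comp _ _ _ (fun s => - (om * (T - s))) expR); last exact: continuous_expR.
  apply: cvgN; apply: cvgM; first exact: cvg_cst.
  by apply: cvgB; [exact: cvg_cst|exact: cvg_id].
(* at a first time where the deviation reaches half of the envelope, the
   superposition bound says that it is below it *)
have small : `|y T - e * w T| - 1 / 2 * Th T < 0.
  rewrite ltNge; apply/negP => reach.
  have [|s0 [s00 s0T hit below]] := first_hit cg _ T0 reach.
    by rewrite (response_le0 rv (lexx 0)) normr0 sub0r oppr_lt0 mulr_gt0.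
  have v_le s : 0 <= s -> s <= s0 -> `|y s - e * w s| <= 1 / 2 * Th s.
    move=> sp ss; rewrite -subr_le0.
    have [->|ne] := eqVneq s s0; first by rewrite hit.
    by apply/ltW/below => //; rewrite lt_neqAle ne.
  have y_le s : 0 <= s -> s <= s0 -> `|y s| <= 3 / 2 * Th s.
    move=> sp ss; rewrite -(subrK (e * w s) (y s)).
    apply: le_trans (ler_normD _ _) _.
    have := v_le s sp ss; have := ew s sp (le_trans ss s0T); lra.
  have y_hist s : s <= 0 -> `|y s| <= 2 * r * expR (- (om * T)).
    move=> sn; rewrite yphi//; apply: le_trans (ephi s) _.
    by rewrite ler_wpM2r// expR_ge0.
  (* the remainder is bounded by the square of the envelope, of rate [2 om] *)
  pose H := 9 / 4 * L * (2 * r * expR (- (om * T))) ^+ 2.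
  have H0 : 0 < H.
    by rewrite mulr_gt0 ?exprn_gt0 ?mulr_gt0 ?expR_gt0.
  have ThS s : 9 / 4 * L * Th s ^+ 2 = H * expR (2 * om * s).
    have -> : Th s = 2 * r * expR (- (om * T)) * expR (om * s).
      by rewrite /Th -(mulrA (2 * r)) -expRD; congr (_ * expR _); ring.
    rewrite /H (_ : expR (2 * om * s) = expR (om * s) ^+ 2); first by ring.
    by rewrite -expRM_natl mulrA.
  have := forced _ _ _ H s0 (C1_pos Cg g0 g10) _ _ rv H0 (ltW s00) _.
  have -> : `|y s0 - e * w s0| = 1 / 2 * Th s0 by apply/eqP; rewrite -subr_eq0 hit.
  move=> K; have : 1 / 2 * Th s0 <= C' * H * expR (2 * om * s0).
    apply: K; [by move=> s; exact: pos_le0|by move=> s; exact: pos_le0|].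
    move=> s sp ss; rewrite posE// -ThS.
    rewrite (_ : 9 / 4 * L * _ = L * (3 / 2 * Th s) ^+ 2); last by field.
    apply: remainder_le.
    - have := ThT s (le_trans ss s0T); lra.
    - exact: y_le (ltW sp) ss.
    - have [sn|sn] := leP (s - tau) 0.
        apply: le_trans (y_hist _ sn) _.
        apply: (@le_trans _ _ (Th s)); last by have := Th0 s; lra.
        apply: le_trans (Th_le 0 s (ltW sp)).
        by rewrite /Th subr0.
      apply: le_trans (y_le _ (ltW sn) _) _; first by have := tau0; lra.
      rewrite ler_pM2l//; apply: Th_le; have := tau0; lra.
  rewrite -(mulrA C') -ThS (_ : C' * _ = 9 / 4 * (C' * L * Th s0) * Th s0); last by ring.
  rewrite ler_pM2r//; have := ler_wpM2l (ltW CL0) (ThT s0 s0T).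
  move: rCL; lra.
have : 2 * r <= `|y T| + `|y T - e * w T|.
  have -> : 2 * r = `|e * w T| by rewrite normrM (gtr0_norm e0) /e divfK// gt_eqF.
  by rewrite -{1}[e * w T](subKr (y T)); exact: ler_normB.
have : Th T = 2 * r by rewrite /Th subrr mulr0 oppr0 expR0 mulr1.
have := yr T; move: small; lra.
Qed.
End Saddle.

(** * The instability theorem *)
Theorem theorem7 (R : realType) (alpha delta epsilon p q : R)
    (halpha0 : 0 < alpha) (halpha1 : alpha <= 1)
    (hepsilon : epsilon != 0)
    (hdisc : 0 <= p ^+ 2 + 4 * epsilon * (delta + q))
    (hepsilon0 : 0 < epsilon) (hp : 0 < p) (hqd : q + delta < 0) :
  forall tau : R, 0 <= tau ->
    is_equilibrium alpha tau (dde_rhs delta epsilon p q)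
      (x2star delta epsilon p q) /\
    unstable alpha tau (dde_rhs delta epsilon p q)
      (x2star delta epsilon p q).
Proof.
move=> tau tau0; set x := x2star delta epsilon p q.
set sd := Num.sqrt (p ^+ 2 + 4 * epsilon * (delta + q)).
have sd0 : 0 <= sd by exact: sqrtr_ge0.
have sd2 : sd ^+ 2 = p ^+ 2 + 4 * epsilon * (delta + q) by rewrite sqr_sqrtr.
have xE : 2 * epsilon * x = - p + sd.
  by rewrite /x /x2star -/sd; field; exact: hepsilon.
have sdp : sd < p.
  rewrite -(@ltr_pXn2r _ 2) ?nnegrE ?(ltW hp)// sd2 -subr_gt0.
  rewrite (_ : _ - _ = 4 * epsilon * - (q + delta)); last by ring.
  by rewrite mulr_gt0 ?oppr_gt0// mulr_gt0.
have e2 : 0 < 2 * epsilon by rewrite mulr_gt0.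
have x0 : x < 0 by rewrite -(pmulr_rlt0 _ e2) xE; lra.
have xq : epsilon * x ^+ 2 + p * x - (q + delta) = 0.
  apply: (mulfI (lt0r_neq0 (mulr_gt0 (ltr0n R 4) hepsilon0))); rewrite mulr0.
  rewrite [LHS](_ : _ = (2 * epsilon * x + p) ^+ 2 - (p ^+ 2 + 4 * epsilon * (delta + q))); last by ring.
  by rewrite xE addrAC addNr add0r -sd2 subrr.
pose a := q - 2 * p * x; pose b := delta - 3 * epsilon * x ^+ 2; pose c := - 3 * epsilon * x.
have sdE : sd = 2 * epsilon * x + p by rewrite xE; ring.
have ab : a + b = - x * sd.
  apply/eqP; rewrite -subr_eq0; apply/eqP.
  rewrite (_ : _ - _ = - (epsilon * x ^+ 2 + p * x - (q + delta))); first by rewrite xq oppr0.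
  by rewrite sdE /a /b; ring.
have c0 : 0 < c by rewrite /c mulNr mulNr oppr_gt0 pmulr_rlt0// mulr_gt0.
have eq0 : dde_rhs delta epsilon p q x x = 0.
  rewrite /dde_rhs (_ : _ + _ = - x * (epsilon * x ^+ 2 + p * x - (q + delta))); last by ring.
  by rewrite xq mulr0.
have FE u v : dde_rhs delta epsilon p q (u + x) (v + x) = PA b c epsilon u + PB a p v.
  apply/eqP; rewrite -subr_eq0; apply/eqP.
  rewrite (_ : _ - _ = dde_rhs delta epsilon p q x x)//.
  by rewrite /dde_rhs /PA /PB /a /b /c; ring.
split; first exact: constant_is_equilibrium.
(* without delay only one-sided quadratic growth is used, so that vanishing and
   positive discriminants need no distinction *)
have [t0|tn0] := eqVneq tau 0.
  apply: (unstable_without_delay halpha0 halpha1 tau0 FE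
    (k := epsilon * - x / 2) (e := - x / 2)) => //.
  - by rewrite divr_gt0// mulr_gt0// oppr_gt0.
  - by rewrite divr_gt0// oppr_gt0.
  move=> v v0 vx.
  have -> : PA b c epsilon v + PB a p v = v * (- x - v) * (epsilon * v + sd).
    apply/eqP; rewrite -subr_eq0; apply/eqP.
    rewrite [LHS](_ : _ = v * (a + b - - x * sd) + v ^+ 2 * (sd - (2 * epsilon * x + p))).
      by rewrite ab sdE !subrr !mulr0 addr0.
    by rewrite /PA /PB /c; ring.
  apply: (@le_trans _ _ (v * (- x / 2) * (epsilon * v))).
    by rewrite le_eqVlt; apply/orP; left; apply/eqP; field.
  apply: ler_pM.
  - by rewrite mulr_ge0// divr_ge0// oppr_ge0 ltW.
  - by rewrite mulr_ge0// ltW.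
  - by rewrite ler_wpM2l//; lra.
  - by rewrite lerDl.
have tp : 0 < tau by rewrite lt_neqAle eq_sym tn0.
(* the linearization a y(t) + b y(t - tau) has the characteristic root 0 when
   the discriminant vanishes, and a positive one otherwise *)
have [s0|sn0] := eqVneq sd 0.
  have ab' : a = - b by apply/eqP; rewrite -subr_eq0 opprK ab s0 mulr0.
  have cp : c = 3 / 2 * p.
    have : 2 * epsilon * x = - p by rewrite xE s0 addr0.
    by rewrite /c; lra.
  have [a1|a1] := ltP alpha 1.
    exact: unstable_degenerate_fractional FE a1.
  apply: (unstable_degenerate_integer halpha0 halpha1 tp hepsilon0 hp ab' cp FE).
  by apply/eqP; rewrite eq_le halpha1.
have ab0 : 0 < a + b.
  by rewrite ab mulr_gt0 ?oppr_gt0// lt_neqAle eq_sym sn0.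
have [b0|bn0] := eqVneq b 0.
  by apply: (unstable_undelayed_linear_part halpha0 halpha1 tp c0 hepsilon0 hp FE b0); move: ab0; rewrite b0 addr0.
exact: unstable_saddle FE bn0 ab0.
Qed.
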